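(* Let $0<R'<R$, let $n\ge2$ be an integer, let $f$ be a non-constant meromorphic function in $D(0,R)=\{z\in\mathbb{C}:0<|z|<R\}$ with a singular point at the origin, of finite iterated order $\sigma_n(f,0)=\sigma<\infty$, let $\varepsilon>0$ be a given constant, and let $k\in\mathbb{N}$ be a positive integer. Then the following two statements hold. (i) There exists a set $E_1^*\subset(0,R')$ of finite logarithmic measure, $\int_0^{R'}\frac{\chi_{E_1^*}(t)}{t}\,dt<\infty$, such that for all $z$ with $r=|z|\in(0,R')\setminus E_1^*$, $$\left|\frac{f^{(k)}(z)}{f(z)}\right|\le\exp_{n-1}\left\{\frac{1}{r^{\sigma+\varepsilon}}\right\}. \qquad ( * )$$ (ii) There exists a set $E_2^*\subset[0,2\pi)$ of linear measure zero such that for every $\theta\in[0,2\pi)\setminus E_2^*$ there exists a constant $r_0=r_0(\theta)>0$ such that $( * )$ holds for all $z$ satisfying $\arg z=\theta$ and $r=|z|<r_0$.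
   Context: For a meromorphic function $f$ in $D(0,R)=\{z\in\mathbb{C}:0<|z|<R\}$ and a fixed $R'$ with $0<R'<R$, put $$m_0(r,f)=\frac1{2\pi}\int_0^{2\pi}\ln^+|f(re^{i\varphi})|\,d\varphi,\qquad N_0(r,R',f)=\int_r^{R'}\frac{n(t,f)}{t}\,dt,$$ where $n(t,f)$ is the number of poles of $f$ in $\{z:t\le|z|\le R'\}$, counted with multiplicity, and $T_0(r,f)=T_0(r,R',f)=m_0(r,f)+N_0(r,R',f)$. The iterated order of $f$ near $0$ is $$\sigma_n(f,0)=\sigma_{n,T}(f,0)=\limsup_{r\to0}\frac{\log_n^+T_0(r,f)}{-\log r},$$ where $\log_1^+x=\log^+x=\max\{\log x,0\}$ and $\log_n^+x=\log^+\log_{n-1}^+x$ for $n\ge2$. Also $\exp_1x=\exp x$ and $\exp_{n}x=\exp(\exp_{n-1}x)$ for $n\ge2$. $\chi_E$ denotes the characteristic function of a set $E$. *)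

(* Defs.v *)
(* MathComp world: MathComp-Analysis over an abstract [R : realType], complex
   numbers [R[i]] from mathcomp-real-closed. The carrier is written [R[i]^o]
   because the topology and the normed structure are attached to that alias. *)
From HB Require Import structures.
From mathcomp Require Import all_boot all_order all_algebra.
From mathcomp Require Import all_classical all_reals all_analysis.
From mathcomp Require Import complex.

Set Implicit Arguments.
Unset Strict Implicit.
Unset Printing Implicit Defensive.

Import Order.TTheory GRing.Theory Num.Theory.
Import numFieldNormedType.Exports.

Local Open Scope classical_set_scope.
Local Open Scope ring_scope.
Local Open Scope complex_scope.

(* The norm [`|z|] is an element of [R[i]] with zero imaginary part (lemma
   [normc_def]); [cabs z] is the same number in [R]. *)
Definition cabs (R : realType) (z : R[i]^o) : R := complex.Re `|z : R[i]|.

Definition polar (R : realType) (r theta : R) : R[i]^o :=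
  (r * cos theta) +i* (r * sin theta).

Definition punctured_disc (R : realType) (rho : R) : set R[i]^o :=
  [set z | 0 < cabs z < rho].

(* Here [R[i]^o] is a normed module over the field [R[i]], so that [derivable]
   and [derive1] refer to complex differentiation. *)
Definition holomorphic_at (R : realType) (f : R[i]^o -> R[i]^o) (a : R[i]^o) :=
  \forall z \near a, derivable f z 1.

(* The value [f a] at a pole [a] is unconstrained. *)
Definition has_pole_of_order (R : realType) (f : R[i]^o -> R[i]^o) (a : R[i]^o)
    (m : nat) : Prop :=
  [/\ (0 < m)%N,
      \forall z \near a^', derivable f z 1 &
      exists2 c : R[i]^o, c != 0 &
        (z - a) ^+ m * f z @[z --> a^'] --> c].

Definition meromorphic_on (R : realType) (U : set R[i]^o)
    (f : R[i]^o -> R[i]^o) : Prop :=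
  forall a, U a ->
    holomorphic_at f a \/ exists m, has_pole_of_order f a m.

(* The point [a] is not a removable singularity: it may be a pole, an essential
   singularity or an accumulation point of poles. *)
Definition singular_at (R : realType) (f : R[i]^o -> R[i]^o) (a : R[i]^o) :
    Prop :=
  ~ exists2 g : R[i]^o -> R[i]^o, holomorphic_at g a &
      \forall z \near a^', g z = f z.

(* The order is unique when it exists; [0] at a point which is not a pole. *)
Definition pole_multiplicity (R : realType) (f : R[i]^o -> R[i]^o)
    (a : R[i]^o) : nat :=
  xget 0%N [set m | has_pole_of_order f a m].

(* Only finitely many terms are nonzero for [f] meromorphic in a neighbourhood
   of the closed annulus. *)
Definition pole_count (R : realType) (R' : R) (f : R[i]^o -> R[i]^o)
    (t : R) : R :=
  \sum_(a \in [set a : R[i]^o | t <= cabs a <= R'])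
    ((pole_multiplicity f a)%:R : R).

Definition logp (R : realType) (x : R) : R := Num.max (ln x) 0.

Definition m0 (R : realType) (f : R[i]^o -> R[i]^o) (r : R) : R :=
  (2 * pi)^-1 *
  Rintegral lebesgue_measure `[0, 2 * pi]
    (fun phi => logp (cabs (f (polar r phi)))).

Definition N0 (R : realType) (R' : R) (f : R[i]^o -> R[i]^o) (r : R) : R :=
  Rintegral lebesgue_measure `[r, R'] (fun t => pole_count R' f t / t).

Definition T0 (R : realType) (R' : R) (f : R[i]^o -> R[i]^o) (r : R) : R :=
  m0 f r + N0 R' f r.

(* [iter_logp 0] and [iter_exp 0] are the identity. *)
Definition iter_logp (R : realType) (n : nat) (x : R) : R := iter n (@logp R) x.

Definition iter_exp (R : realType) (n : nat) (x : R) : R := iter n (@expR R) x.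

Definition iterated_order (R : realType) (R' : R) (n : nat)
    (f : R[i]^o -> R[i]^o) : \bar R :=
  limf_esup (fun r : R => (iter_logp n (T0 R' f r) / - ln r)%:E) 0^'+.

(* [v] is the (finite) value at [z] of the meromorphic function given by [h]
   off a discrete set: it is [h z] where [h] is continuous, it fills removable
   singularities, and there is no such [v] at a pole. *)
Definition meromorphic_value (R : realType) (h : R[i]^o -> R[i]^o)
    (z v : R[i]^o) : Prop :=
  h w @[w --> z^'] --> v.

(* Main.v *)
Require Import Defs.
From mathcomp Require Import all_boot all_order all_algebra.
From mathcomp Require Import all_classical all_reals all_analysis.
From mathcomp Require Import measurable_realfun complex ring lra.

(* On an annulus avoiding the origin, [f] is a finite product of factors
   [(w - c) ^ m] times a zero-free holomorphic function [G]. Jensen's formula,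
   with two reference circles fixed once and for all, bounds the mean of
   [|ln |f||] over a small circle, and the number of zeros between that circle
   and the reference ones, by a polynomial in [T0] and [ln (1 / r)]. As [ln |G|]
   is the real part of a primitive of [G' / G], integrating by parts relates the
   two Laurent coefficients of [z G' / G] of opposite indices to a Fourier
   coefficient of [ln |G|]; two circles suffice to recover them, so that [G' / G],
   hence [f' / f] off small discs around the zeros and poles, is bounded by a
   power of [T0 / r]. Then [f] varies by a bounded factor on smaller discs, and
   the Cauchy estimates bound [f^(k) / f]. Since [exp_(n-1)] of a power of [1 / r]
   absorbs all polynomial losses when the exponent increases, the excluded discs
   of the dyadic annulus [|z| ~ 2^-m] may be taken with radii so small that they
   have summable shadows on the radii (for the logarithmic measure) and on the
   arguments; the second statement then follows from the Borel-Cantelli lemma. *)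

Set Implicit Arguments.
Unset Strict Implicit.
Unset Printing Implicit Defensive.

Import Order.TTheory GRing.Theory Num.Theory.
Import numFieldNormedType.Exports.
Import ComplexField.Normc.

Local Open Scope classical_set_scope.
Local Open Scope ring_scope.
Local Open Scope complex_scope.

(** * Limits of complex-valued functions *)

Section complex_limits.
Variable R : realType.
Local Notation C := R[i].
Local Notation nm := (@normc R).

(** The origin may be an essential singularity, so no value of [f] there can anchor Jensen's
    formula: circle means of [ln |G|] are only known to be affine in [ln r], and the two reference
    circles serve to eliminate the two unknown constants. Goursat's theorem is proved in polar
    coordinates, where the rectangle of an annulus closes up and its radial sides cancel. One
    bisection principle, [rectangle_induction], supplies this theorem as well as the compactness and
    connectedness arguments on annuli. Logarithmic means of [f] are compared only on circles free of
    zeros and poles; every interval contains such radii, while [T0] is controlled at all radii. No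
    constant is optimised: on the annulus of outer radius [q = 2 ^- m] everything is measured
    against one number [W], namely [2 ^+ m] times the bound of [T0], up to a constant. There are at
    most [5 * W ^+ 2] zeros and poles, the discs have radius [W ^- 4], and [f' / f] is at most
    [W ^+ 8]. As [n >= 2], [exp_(n-1)] contains at least one exponential, and the gap between
    [sigma + eps / 2] and [sigma + eps] lets it absorb a fixed power of [W]. *)

Lemma nm_ge0 (z : C) : 0 <= nm z.
Proof. by case: z => a b; exact: sqrtr_ge0. Qed.

Lemma nmD (z w : C) : nm (z + w) <= nm z + nm w.
Proof. exact: le_normcD. Qed.

Lemma nmN (z : C) : nm (- z) = nm z.
Proof. exact: normcN. Qed.

Lemma nmB (z w : C) : nm (z - w) <= nm z + nm w.
Proof. by rewrite -(nmN w); exact: nmD. Qed.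

Lemma nm_distC (z w : C) : nm (z - w) = nm (w - z).
Proof. by rewrite -nmN opprB. Qed.

Lemma nm_distD (w z v : C) : nm (z - v) <= nm (z - w) + nm (w - v).
Proof. by apply: le_trans (nmD _ _); rewrite addrA subrK. Qed.

Lemma nm_eq0 (z : C) : (nm z == 0) = (z == 0).
Proof.
apply/eqP/eqP => [/eq0_normc//|->]; exact: normc0.
Qed.

Lemma nm_gt0 (z : C) : (0 < nm z) = (z != 0).
Proof. by rewrite lt_neqAle nm_ge0 andbT eq_sym nm_eq0. Qed.

Lemma nm_real (x : R) : nm x%:C = `|x|.
Proof. by rewrite /= expr0n addr0 sqrtr_sqr. Qed.

Lemma nmX (z : C) n : nm (z ^+ n) = nm z ^+ n.
Proof.
elim: n => [|n ih]; first by rewrite !expr0 normc1.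
by rewrite !exprS normcM ih.
Qed.

Lemma nm_sqr (z : C) : nm z ^+ 2 = complex.Re z ^+ 2 + complex.Im z ^+ 2.
Proof. by case: z => a b /=; rewrite sqr_sqrtr ?addr_ge0 ?sqr_ge0. Qed.

Lemma Re_le_nm (z : C) : `|complex.Re z| <= nm z.
Proof.
rewrite -(ler_pXn2r (n := 2)) ?nnegrE ?nm_ge0// nm_sqr real_normK ?num_real//.
by rewrite lerDl sqr_ge0.
Qed.

Lemma Im_le_nm (z : C) : `|complex.Im z| <= nm z.
Proof.
rewrite -(ler_pXn2r (n := 2)) ?nnegrE ?nm_ge0// nm_sqr real_normK ?num_real//.
by rewrite lerDr sqr_ge0.
Qed.

Lemma nm_le_ReIm (z : C) : nm z <= `|complex.Re z| + `|complex.Im z|.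
Proof.
rewrite -(ler_pXn2r (n := 2)) ?nnegrE ?nm_ge0 ?addr_ge0// nm_sqr.
rewrite -(real_normK (num_real (complex.Re z))).
rewrite -(real_normK (num_real (complex.Im z))).
by rewrite sqrrD lerD2r lerDl mulrn_wge0// mulr_ge0.
Qed.

Lemma nm_distB (z w : C) : `|nm z - nm w| <= nm (z - w).
Proof.
rewrite ler_norml; apply/andP; split.
  have := nmB z (z - w); rewrite opprB addrC subrK => h; lra.
have := nmD (z - w) w; rewrite subrK => h; lra.
Qed.

Lemma nm_conj (z : C) : nm z^* = nm z.
Proof. by case: z => a b /=; rewrite sqrrN. Qed.

Lemma nm_sum (I : Type) (r : seq I) (P : pred I) (F : I -> C) :
  nm (\sum_(i <- r | P i) F i) <= \sum_(i <- r | P i) nm (F i).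
Proof.
elim/big_ind2 : _ => [|x1 x2 y1 y2 h1 h2|//]; first by rewrite normc0.
by apply: le_trans (nmD _ _) _; rewrite lerD.
Qed.

(** Neighbourhoods with radii in [R], because the norm of the library takes its values in [R[i]];
    [nbhs_cnb] identifies the two filters. *)
Definition cnb (a : C) : set_system C :=
  [set P | exists2 d : R, 0 < d & forall w, nm (w - a) < d -> P w].

Global Instance cnb_filter a : ProperFilter (cnb a).
Proof.
apply: Build_ProperFilter_ex.
  by move=> P [d d0 h]; exists a; apply: h; rewrite subrr normc0.
split.
- by exists 1.
- move=> P Q [d d0 hP] [e e0 hQ]; exists (Num.min d e).
    by rewrite lt_min d0.
  by move=> w; rewrite lt_min => /andP[/hP ? /hQ].
- by move=> P Q PQ [d d0 h]; exists d => // w /h /PQ.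
Qed.

(** The filter is arbitrary, so that the same rules serve complex neighbourhoods, real ones and
    one-sided ones. *)
Definition clim (X : Type) (F : set_system X) (f : X -> C) (l : C) :=
  forall e : R, 0 < e -> \forall x \near F, nm (f x - l) < e.

Lemma clim_cst X (F : set_system X) {FF : Filter F} (l : C) : clim F (fun=> l) l.
Proof. by move=> e e0; apply: nearW => x; rewrite subrr normc0. Qed.

Lemma climD X (F : set_system X) {FF : Filter F} f g (a b : C) :
  clim F f a -> clim F g b -> clim F (fun x => f x + g x) (a + b).
Proof.
move=> fa gb e e0; have e2 : 0 < e / 2 by rewrite divr_gt0.
near=> x.
have h1 : nm (f x - a) < e / 2 by near: x; exact: fa.
have h2 : nm (g x - b) < e / 2 by near: x; exact: gb.
have -> : f x + g x - (a + b) = (f x - a) + (g x - b) by ring.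
by apply: le_lt_trans (nmD _ _) _; lra.
Unshelve. all: by end_near. Qed.

Lemma climN X (F : set_system X) {FF : Filter F} f (a : C) :
  clim F f a -> clim F (fun x => - f x) (- a).
Proof.
by move=> fa e /fa; apply: filterS => x; rewrite -opprD nmN.
Qed.

Lemma climB X (F : set_system X) {FF : Filter F} f g (a b : C) :
  clim F f a -> clim F g b -> clim F (fun x => f x - g x) (a - b).
Proof. by move=> fa /climN; exact: climD. Qed.

Lemma climM X (F : set_system X) {FF : Filter F} f g (a b : C) :
  clim F f a -> clim F g b -> clim F (fun x => f x * g x) (a * b).
Proof.
move=> fa gb e e0.
have K0 : 0 < nm a + nm b + 1.
  by rewrite ltr_wpDl// addr_ge0// nm_ge0.
have e1 : 0 < Num.min 1 (e / 2 / (nm a + nm b + 1)).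
  by rewrite lt_min ltr01/= !divr_gt0.
near=> x.
have : nm (f x - a) < Num.min 1 (e / 2 / (nm a + nm b + 1)).
  by near: x; exact: fa.
rewrite lt_min => /andP[h1 h1'].
have : nm (g x - b) < Num.min 1 (e / 2 / (nm a + nm b + 1)).
  by near: x; exact: gb.
rewrite lt_min => /andP[_ h2'].
have -> : f x * g x - a * b = (f x - a) * (g x - b) + ((f x - a) * b +
   a * (g x - b)) by ring.
apply: le_lt_trans (nmD _ _) _; rewrite normcM.
apply: (@le_lt_trans _ _ (nm (g x - b) + (nm (f x - a) * nm b + nm a * nm (g x - b)))).
  rewrite lerD//; last by apply: le_trans (nmD _ _) _; rewrite !normcM.
  by rewrite ler_piMl ?nm_ge0// ltW.
move: h1' h2'; rewrite !ltr_pdivlMr// => h1' h2'.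
have := nm_ge0 (f x - a); have := nm_ge0 (g x - b).
have := nm_ge0 a; have := nm_ge0 b; nra.
Unshelve. all: by end_near. Qed.

Lemma climV X (F : set_system X) {FF : Filter F} f (a : C) : a != 0 ->
  clim F f a -> clim F (fun x => (f x)^-1) a^-1.
Proof.
move=> a0 fa e e0.
have na : 0 < nm a by rewrite nm_gt0.
have e1 : 0 < Num.min (nm a / 2) (e * nm a ^+ 2 / 2).
  by rewrite lt_min !divr_gt0// mulr_gt0// exprn_gt0.
near=> x.
have : nm (f x - a) < Num.min (nm a / 2) (e * nm a ^+ 2 / 2).
  by near: x; exact: fa.
rewrite lt_min => /andP[h1 h2].
have fx : nm a / 2 < nm (f x).
  have := nm_distB a (f x); rewrite nm_distC ler_norml => /andP[_]; lra.
have fx0 : f x != 0 by rewrite -nm_gt0; apply: le_lt_trans fx; rewrite divr_ge0 ?nm_ge0.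
have -> : (f x)^-1 - a^-1 = - (f x - a) / (f x * a).
  by field; rewrite ?fx0 ?a0.
rewrite normcM normcV normcM nmN ltr_pdivrMr; last by rewrite mulr_gt0 ?nm_gt0.
apply: lt_trans h2 _; have ena := mulr_gt0 e0 na; rewrite expr2; nra.
Unshelve. all: by end_near. Qed.

Lemma climX X (F : set_system X) {FF : Filter F} f (a : C) n :
  clim F f a -> clim F (fun x => f x ^+ n) (a ^+ n).
Proof.
move=> fa; elim: n => [|n ih].
  by rewrite expr0; apply: clim_cst.
by rewrite exprS; under eq_fun do rewrite exprS; exact: climM.
Qed.

Lemma clim_sum X (F : set_system X) {FF : Filter F} (I : Type) (r : seq I)
    (f : I -> X -> C) (a : I -> C) :
  (forall i, clim F (f i) (a i)) ->
  clim F (fun x => \sum_(i <- r) f i x) (\sum_(i <- r) a i).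
Proof.
move=> h; elim: r => [|i r ih].
  by rewrite big_nil; under eq_fun do rewrite big_nil; exact: clim_cst.
by rewrite big_cons; under eq_fun do rewrite big_cons; exact: climD.
Qed.

Lemma clim_near X (F : set_system X) {FF : Filter F} f g (a : C) :
  (\forall x \near F, f x = g x) -> clim F f a -> clim F g a.
Proof.
move=> fg fa e e0; near=> x.
have <- : f x = g x by near: x.
by near: x; exact: fa.
Unshelve. all: by end_near. Qed.

Lemma clim_unique X (F : set_system X) {FF : ProperFilter F} f (a b : C) :
  clim F f a -> clim F f b -> a = b.
Proof.
move=> fa fb; apply/eqP; rewrite -subr_eq0 -nm_eq0 eq_le nm_ge0 andbT.
apply/ler_addgt0Pr => e e0; rewrite add0r.
have e2 : 0 < e / 2 by rewrite divr_gt0.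
have [x [h1 h2]] := filter_ex (filterI (fa _ e2) (fb _ e2)).
apply: le_trans (nm_distD (f x) _ _) _; move: h1; rewrite nm_distC => h1.
by rewrite [leRHS]splitr lerD// ltW.
Qed.

Lemma clim_comp X (F : set_system X) {FF : Filter F} f (a b : C) (G : C -> C) :
  clim F f a -> clim (cnb a) G b -> clim F (G \o f) b.
Proof.
move=> fa Gb e e0; have [d d0 h] := Gb e e0.
near=> x; apply: h; near: x; exact: fa.
Unshelve. all: by end_near. Qed.

Lemma clim_id (a : C) : clim (cnb a) id a.
Proof. by move=> e e0; exists e. Qed.

Lemma clim_squeeze X (F : set_system X) {FF : Filter F} f (a : C) g :
  (\forall x \near F, nm (f x - a) <= nm (g x)) -> clim F g 0 -> clim F f a.
Proof.
move=> fg g0 e e0; near=> x.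
apply: (@le_lt_trans _ _ (nm (g x))); first by near: x.
by rewrite -[g x]subr0; near: x; exact: g0.
Unshelve. all: by end_near. Qed.

Lemma clim_ReP X (F : set_system X) {FF : Filter F} f (a : C) :
  clim F f a -> (complex.Re (f x) @[x --> F] --> complex.Re a).
Proof.
move=> fa; apply/cvgrPdist_lt => e e0; near=> x.
rewrite distrC; apply: (@le_lt_trans _ _ (nm (f x - a))).
  by rewrite -raddfB; exact: Re_le_nm.
by near: x; exact: fa.
Unshelve. all: by end_near. Qed.

Lemma clim_ImP X (F : set_system X) {FF : Filter F} f (a : C) :
  clim F f a -> (complex.Im (f x) @[x --> F] --> complex.Im a).
Proof.
move=> fa; apply/cvgrPdist_lt => e e0; near=> x.
rewrite distrC; apply: (@le_lt_trans _ _ (nm (f x - a))).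
  by rewrite -raddfB; exact: Im_le_nm.
by near: x; exact: fa.
Unshelve. all: by end_near. Qed.

Lemma clim_nm X (F : set_system X) {FF : Filter F} f (a : C) :
  clim F f a -> (nm (f x) @[x --> F] --> nm a).
Proof.
move=> fa; apply/cvgrPdist_lt => e e0; near=> x.
rewrite distrC; apply: le_lt_trans (nm_distB _ _) _.
by near: x; exact: fa.
Unshelve. all: by end_near. Qed.

Lemma clim_real X (F : set_system X) {FF : Filter F} (f : X -> R) (a : R) :
  (f x @[x --> F] --> a) -> clim F (fun x => (f x)%:C) a%:C.
Proof.
move=> fa e e0; near=> x.
rewrite -rmorphB nm_real; near: x.
by move/cvgrPdist_lt : fa => /(_ _ e0); apply: filterS => x; rewrite distrC.
Unshelve. all: by end_near. Qed.

End complex_limits.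

(** * Derivatives *)

Section derivatives.
Variable R : realType.
Local Notation C := R[i].
Local Notation nm := (@normc R).

Section generic.
Variables (X : Type) (N : X -> set_system X) (iota : X -> C).
Context {FF : forall a, Filter (N a)}.
Hypothesis iota_lim : forall a, clim (N a) iota (iota a).
Hypothesis N_self : forall a (P : set X), N a P -> P a.

(* Caratheodory's form of differentiability, uniform in the domain (the reals or
   the complex numbers). *)
Definition der (F : X -> C) (a : X) (d : C) :=
  exists2 psi : X -> C,
    \forall x \near N a, F x = F a + psi x * (iota x - iota a) &
    clim (N a) psi d.

Lemma der_cst c a : der (fun=> c) a 0.
Proof.
by exists (fun=> 0); [apply: nearW => x; rewrite mul0r addr0|exact: clim_cst].
Qed.

Lemma der_id a : der iota a 1.
Proof.
by exists (fun=> 1); [apply: nearW => x; rewrite mul1r subrKC|exact: clim_cst].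
Qed.

Lemma der_lim F a d : der F a d -> clim (N a) F (F a).
Proof.
move=> [psi h hp].
have -> : F a = F a + d * (iota a - iota a) by ring.
apply: (@clim_near _ _ _ _ (fun x => F a + psi x * (iota x - iota a))).
  by apply: filterS h => x ->.
by apply: climD; [exact: clim_cst|apply: climM => //; apply: climB => //;
  exact: clim_cst].
Qed.

Lemma derD F G a d e : der F a d -> der G a e ->
  der (fun x => F x + G x) a (d + e).
Proof.
move=> [psi h hp] [phi k kp]; exists (fun x => psi x + phi x); last exact: climD.
by apply: filterS2 h k => x -> ->; ring.
Qed.

Lemma derM F G a d e : der F a d -> der G a e ->
  der (fun x => F x * G x) a (d * G a + F a * e).
Proof.
move=> [psi h hp] [phi k kp].
exists (fun x => psi x * G a + F a * phi x + psi x * phi x * (iota x - iota a)).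
  by apply: filterS2 h k => x -> ->; ring.
have -> : d * G a + F a * e = d * G a + F a * e + d * e * (iota a - iota a).
  by ring.
have cc c : clim (N a) (fun=> c) c by exact: clim_cst.
apply: climD; first by apply: climD; apply: climM.
by apply: climM; [exact: climM|exact: climB].
Qed.

Lemma derZ F a d c : der F a d -> der (fun x => c * F x) a (c * d).
Proof. by move=> h; have := derM (der_cst c a) h; rewrite mul0r add0r. Qed.

Lemma derN F a d : der F a d -> der (fun x => - F x) a (- d).
Proof.
move=> h; rewrite -mulN1r; under eq_fun do rewrite -mulN1r; exact: derZ.
Qed.

Lemma derB F G a d e : der F a d -> der G a e ->
  der (fun x => F x - G x) a (d - e).
Proof. by move=> h /derN; exact: derD. Qed.

Lemma der_near F G a d : (\forall x \near N a, F x = G x) ->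
  der F a d -> der G a d.
Proof.
move=> FG [psi h hp]; exists psi => //.
by rewrite -(N_self FG); apply: filterS2 FG h => x <-.
Qed.

Lemma clim_neq0 (F : X -> C) a l : l != 0 -> clim (N a) F l -> \forall x \near N a, F x != 0.
Proof.
rewrite -nm_gt0 => l0 /(_ _ l0); apply: filterS => x.
by apply: contraTneq => ->; rewrite sub0r nmN ltxx.
Qed.

Lemma derV F a d : F a != 0 -> der F a d ->
  der (fun x => (F x)^-1) a (- d / F a ^+ 2).
Proof.
move=> Fa0 hF; have Fl := der_lim hF; case: hF => psi h hp.
exists (fun x => - psi x / (F x * F a)).
  apply: filterS2 h (clim_neq0 Fa0 Fl) => x E Fx0.
  have -> : - psi x / (F x * F a) * (iota x - iota a) =
            - (psi x * (iota x - iota a)) / (F x * F a) by ring.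
  have -> : psi x * (iota x - iota a) = F x - F a by rewrite E; ring.
  by field; rewrite ?Fx0 ?Fa0.
rewrite expr2; apply: climM; first exact: climN.
apply: climV; first by rewrite mulf_neq0.
by apply: climM => //; exact: clim_cst.
Qed.

Lemma der_div F G a d e : G a != 0 -> der F a d -> der G a e ->
  der (fun x => F x / G x) a ((d * G a - F a * e) / G a ^+ 2).
Proof.
move=> Ga hF hG; have := derM hF (derV Ga hG).
by congr der; field.
Qed.

Lemma derX F a d n : der F a d ->
  der (fun x => F x ^+ n) a (n%:R * F a ^+ n.-1 * d).
Proof.
move=> hF; elim: n => [|n ih].
  by rewrite !mul0r; under eq_fun do rewrite expr0; exact: der_cst.
under eq_fun do rewrite exprS.
have := derM hF ih; congr der; case: n {ih} => [|n] /=; first by rewrite !expr0; ring.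
by rewrite exprS -[n.+2%:R]natr1; ring.
Qed.

End generic.

Definition cder := der (@cnb R) id.
Definition rder := der (fun t : R => nbhs t) (fun t : R => t%:C).

Lemma cnb_self (a : C) (P : set C) : cnb a P -> P a.
Proof. by move=> [d d0 h]; apply: h; rewrite subrr normc0. Qed.

Lemma clim_id' (a : C) : clim (cnb a) id (id a).
Proof. exact: clim_id. Qed.

Lemma clim_idR (a : R) : clim (nbhs a) (fun t => t%:C) a%:C.
Proof. exact: clim_real. Qed.

Lemma rder_lim F t d : rder F t d -> clim (nbhs t) F (F t).
Proof. by apply: der_lim; exact: clim_idR. Qed.

Lemma cder_lim F t d : cder F t d -> clim (cnb t) F (F t).
Proof. by apply: der_lim; exact: clim_id. Qed.

Lemma rderD F G a d e : rder F a d -> rder G a e -> rder (fun x => F x + G x) a (d + e).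
Proof. by apply: derD; exact: clim_idR. Qed.

Lemma rderM F G a d e : rder F a d -> rder G a e -> rder (fun x => F x * G x) a (d * G a + F a * e).
Proof. by apply: derM; exact: clim_idR. Qed.

Lemma rderZ F a d c : rder F a d -> rder (fun x => c * F x) a (c * d).
Proof. by apply: derZ; exact: clim_idR. Qed.

Lemma rderX F a d n : rder F a d -> rder (fun x => F x ^+ n) a (n%:R * F a ^+ n.-1 * d).
Proof. by apply: derX; exact: clim_idR. Qed.

Lemma rderV F a d : F a != 0 -> rder F a d ->
  rder (fun x => (F x)^-1) a (- d / F a ^+ 2).
Proof. by apply: derV; exact: clim_idR. Qed.

Lemma rder_cst c a : rder (fun=> c) a 0.
Proof. exact: der_cst. Qed.

Lemma cderD F G a d e : cder F a d -> cder G a e -> cder (fun x => F x + G x) a (d + e).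
Proof. by apply: derD; exact: clim_id'. Qed.

Lemma cderB F G a d e : cder F a d -> cder G a e -> cder (fun x => F x - G x) a (d - e).
Proof. by apply: derB; exact: clim_id'. Qed.

Lemma cderM F G a d e : cder F a d -> cder G a e -> cder (fun x => F x * G x) a (d * G a + F a * e).
Proof. by apply: derM; exact: clim_id'. Qed.

Lemma cderZ F a d c : cder F a d -> cder (fun x => c * F x) a (c * d).
Proof. by apply: derZ; exact: clim_id'. Qed.

Lemma cderX F a d n : cder F a d -> cder (fun x => F x ^+ n) a (n%:R * F a ^+ n.-1 * d).
Proof. by apply: derX; exact: clim_id'. Qed.

Lemma cderV F a d : F a != 0 -> cder F a d ->
  cder (fun x => (F x)^-1) a (- d / F a ^+ 2).
Proof. by apply: derV; exact: clim_id'. Qed.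

Lemma cder_div F G a d e : G a != 0 -> cder F a d -> cder G a e ->
  cder (fun x => F x / G x) a ((d * G a - F a * e) / G a ^+ 2).
Proof. by apply: der_div; exact: clim_id'. Qed.

Lemma cder_cst c a : cder (fun=> c) a 0.
Proof. exact: der_cst. Qed.

Lemma cder_near F G a d : (\forall x \near cnb a, F x = G x) -> cder F a d -> cder G a d.
Proof. by apply: der_near; exact: cnb_self. Qed.

Lemma cder_id a : cder id a 1.
Proof. exact: der_id. Qed.

(** The inner domain is left arbitrary: with a real parameter this differentiates a holomorphic
    function along a curve. *)
Lemma der_comp X (N : X -> set_system X) (iota : X -> C)
    {FF : forall a, Filter (N a)}
    (iota_lim : forall a, clim (N a) iota (iota a)) F G a d e :
  der N iota F a d -> cder G (F a) e -> der N iota (G \o F) a (e * d).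
Proof.
move=> hF [phi [r r0 k] kp]; have Fl := @der_lim _ _ _ FF iota_lim _ _ _ hF.
case: hF => psi h hp; exists (fun x => phi (F x) * psi x).
  have h2 := Fl _ r0.
  rewrite near_simpl; apply: (@filterS2 _ (N a) _ _ _ _ _ h h2) => x E /k E2; rewrite /= E2.
  by rewrite -[in phi (F x) * psi x * _]mulrA; congr (_ + phi _ * _); rewrite E; ring.
by apply: climM => //; exact: (clim_comp Fl kp).
Qed.

Lemma rder_comp F G t d e : rder F t d -> cder G (F t) e -> rder (G \o F) t (e * d).
Proof. by apply: der_comp; exact: clim_idR. Qed.

Lemma cder_comp F G t d e : cder F t d -> cder G (F t) e -> cder (G \o F) t (e * d).
Proof. by apply: der_comp; exact: clim_id. Qed.

Lemma near_shift0 (P : set R) (t : R) : nbhs t P ->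
  \forall h \near (0 : R), P (h + t).
Proof.
move=> tP; have /(_ P) : (fun h => h + t) @ (0 : R) --> t.
  rewrite -[X in _ --> X]add0r; apply: cvgD; [exact: cvg_id|exact: cvg_cst].
exact.
Qed.

Lemma cvg_dnbhs0 (phi : R -> R) (t l : R) : (phi x @[x --> t] --> l) ->
  phi (h + t) @[h --> 0^'] --> l.
Proof.
move=> hl; apply: cvg_within_filter.
by move=> P /hl; exact: near_shift0.
Qed.

Section component.
Variables (part : C -> R).
Hypothesis part_add : forall z w, part (z + w) = part z + part w.
Hypothesis part_mul : forall z (x : R), part (z * x%:C) = part z * x.
Hypothesis part_lim : forall F (l : C) t,
  clim (nbhs (t : R)) F l -> part (F x) @[x --> t] --> part l.

(** Since [part] is additive and commutes with real factors, the difference quotient of [part (F s)]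
    is exactly [part (psi (h + t))]. *)
Lemma rder_part F t d : rder F t d -> is_derive t 1 (fun s => part (F s)) (part d).
Proof.
move=> [psi h hp].
have key : h^-1 *: (part (F (h *: 1 + t)) - part (F t)) @[h --> 0^'] --> part d.
  apply: (@cvg_trans _ (part (psi (h + t)) @[h --> 0^'])); last first.
    exact: (cvg_dnbhs0 (part_lim hp)).
  apply: near_eq_cvg.
  have /nbhs_dnbhs h' := near_shift0 h.
  near=> x.
  have xn0 : x != 0 by near: x; exact: nbhs_dnbhs_neq.
  have E : F (x + t) = F t + psi (x + t) * ((x + t)%:C - t%:C) by near: x; exact: h'.
  rewrite scaler1 E part_add [part (F t) + _]addrC addrK.
  by rewrite -rmorphB addrK part_mul /GRing.scale /= mulrC mulfK.
apply: DeriveDef.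
  by apply/cvg_ex; eexists; exact: key.
by apply/cvg_lim => //.
Unshelve. all: by end_near. Qed.
End component.

Lemma rder_Re F t d : rder F t d ->
  is_derive t 1 (fun s => complex.Re (F s)) (complex.Re d).
Proof.
apply: (@rder_part (@complex.Re R)) => [z w|[a b] x|G l s].
- exact: raddfD.
- by rewrite /= mulr0 subr0.
- exact: clim_ReP.
Qed.

Lemma rder_Im F t d : rder F t d ->
  is_derive t 1 (fun s => complex.Im (F s)) (complex.Im d).
Proof.
apply: (@rder_part (@complex.Im R)) => [z w|[a b] x|G l s].
- exact: raddfD.
- by rewrite /= mulr0 add0r.
- exact: clim_ImP.
Qed.

Lemma rder_real (f : R -> R) (t d : R) : is_derive t 1 f d ->
  rder (fun s => (f s)%:C) t d%:C.
Proof.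
move=> [fd fE].
(* The value [d] at [t] makes the difference quotient continuous there. *)
exists (fun s => (if s == t then d else (f s - f t) / (s - t))%:C).
  apply: nearW => s; rewrite -rmorphB -rmorphM -rmorphD; congr (_%:C).
  by case: eqVneq => [->|st]; [rewrite subrr mulr0 addr0|rewrite divfK ?subr_eq0// subrKC].
apply: clim_real; apply/cvgrPdist_lt => e e0.
have : h^-1 *: (f (h *: 1 + t) - f t) @[h --> 0^'] --> d by rewrite -fE; exact: fd.
move=> /cvgrPdist_lt /(_ _ e0); rewrite /dnbhs near_withinE => h.
have : \forall x \near t, x - t != 0 -> `|d - (x - t)^-1 *: (f ((x - t) *: 1 + t) - f t)| < e.
  have /(_ _ h) : (fun x => x - t) @ t --> (0 : R).
    by rewrite -(subrr t); apply: cvgB; [exact: cvg_id|exact: cvg_cst].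
  by [].
apply: filterS => s /=; have [->|st] := eqVneq s t; first by move=> _; rewrite ?eqxx subrr normr0.
rewrite subr_eq0 => /(_ st).
by rewrite scaler1 subrK /GRing.scale /= mulrC.
Qed.

Lemma rder_id (t : R) : rder (fun s => s%:C) t 1.
Proof. by apply: der_id. Qed.

Definition cis (t : R) : C := cos t +i* sin t.

Lemma polarE (r t : R) : polar r t = r%:C * cis t.
Proof. by rewrite /polar /cis; congr (_ +i* _); rewrite mul0r ?subr0 ?addr0. Qed.

Lemma cisE (t : R) : cis t = (cos t)%:C + 'i * (sin t)%:C.
Proof. by rewrite /cis; congr (_ +i* _); rewrite !(mul0r, mulr0, mul1r, subr0, addr0, add0r). Qed.

Lemma nm_cis (t : R) : nm (cis t) = 1.
Proof. by rewrite /= cos2Dsin2 sqrtr1. Qed.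

Lemma rder_cis (t : R) : rder cis t ('i * cis t).
Proof.
have -> : cis = fun t => (cos t)%:C + 'i * (sin t)%:C by apply/funext => s; exact: cisE.
have -> : 'i * ((cos t)%:C + 'i * (sin t)%:C) = (- sin t)%:C + 'i * (cos t)%:C :> C.
  by rewrite mulrDr mulrA -expr2 sqr_i rmorphN; ring.
apply: rderD; first exact: (rder_real (is_derive_cos t)).
by apply: rderZ; exact: (rder_real (is_derive_sin t)).
Qed.
End derivatives.

(** * Integrals of continuous functions *)

Section bisection.
Variable R : realType.

Lemma exists_half_lt (d : R) : 0 < d -> exists n : nat, (2^-1) ^+ n < d.
Proof.
move=> d0; exists (Num.truncn d^-1).+1.
have h := truncnS_gt d^-1; set n := (Num.truncn d^-1).+1 in h *.
have h2 : (n%:R < (2 : R) ^+ n)%R by rewrite -natrX ltr_nat ltn_expl.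
rewrite exprVn -(invrK d) ltf_pV2 ?posrE ?exprn_gt0 ?invr_gt0//.
exact: lt_trans h h2.
Qed.

(* Bisection of a rectangle into cells similar to it: a property of cells that
   is inherited from the four quarters and holds for all small cells around any
   given point holds for the whole rectangle. *)
Lemma rectangle_induction (x0 y0 A B : R) (P : R -> R -> R -> Prop) :
  0 <= A -> 0 <= B ->
  let inside p q t := [/\ x0 <= p, p + t * A <= x0 + A, y0 <= q &
    q + t * B <= y0 + B] in
  (forall p q t, 0 < t -> inside p q t ->
    P p q (t / 2) -> P (p + t / 2 * A) q (t / 2) ->
    P p (q + t / 2 * B) (t / 2) -> P (p + t / 2 * A) (q + t / 2 * B) (t / 2) ->
    P p q t) ->
  (forall x y, x0 <= x <= x0 + A -> y0 <= y <= y0 + B ->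
    exists2 d : R, 0 < d & forall p q t, 0 < t < d -> inside p q t ->
      p <= x <= p + t * A -> q <= y <= q + t * B -> P p q t) ->
  P x0 y0 1.
Proof.
move=> A0 B0 inside split local; apply: contrapT => nP.
pose tn n : R := (2^-1) ^+ n.
have t0 : tn 0%N = 1 by rewrite /tn expr0.
have tn0 n : 0 < tn n by rewrite exprn_gt0// invr_gt0.
have tnS n : tn n.+1 = tn n / 2 by rewrite /tn exprSr.
(* A bad cell has a bad quarter by [split]; the bad cells so obtained shrink to a point, where
   [local] is contradicted. *)
pose bad n (c : R * R) := ~ P c.1 c.2 (tn n) /\ inside c.1 c.2 (tn n).
have step n (c : R * R) : exists c' : R * R, bad n c ->
    [/\ bad n.+1 c', c.1 <= c'.1, c'.1 + tn n.+1 * A <= c.1 + tn n * A,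
       c.2 <= c'.2 & c'.2 + tn n.+1 * B <= c.2 + tn n * B].
  have [[nPc ic]|nb] := pselect (bad n c); last by exists c.
  have hA : 0 <= tn n / 2 * A by rewrite mulr_ge0// divr_ge0// ltW.
  have hB : 0 <= tn n / 2 * B by rewrite mulr_ge0// divr_ge0// ltW.
  have EA : tn n * A = tn n / 2 * A + tn n / 2 * A by field.
  have EB : tn n * B = tn n / 2 * B + tn n / 2 * B by field.
  apply: contrapT => /forallNP nc; apply: nPc.
  have [i1 i2 i3 i4] := ic.
  have q (c' : R * R) : inside c'.1 c'.2 (tn n.+1) -> c.1 <= c'.1 ->
     c'.1 + tn n.+1 * A <= c.1 + tn n * A ->
     c.2 <= c'.2 -> c'.2 + tn n.+1 * B <= c.2 + tn n * B -> P c'.1 c'.2 (tn n / 2).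
    move=> h1 h2 h3 h4 h5; apply: contrapT => nP'; apply: (nc c') => _.
    by split => //; split => //; rewrite tnS.
  apply: split => //.
  - apply: (q c); rewrite ?tnS ?lexx//; [split|..]; lra.
  - apply: (q (c.1 + tn n / 2 * A, c.2)); rewrite ?tnS//=; [split|..]; lra.
  - apply: (q (c.1, c.2 + tn n / 2 * B)); rewrite ?tnS//=; [split|..]; lra.
  - apply: (q (c.1 + tn n / 2 * A, c.2 + tn n / 2 * B)); rewrite ?tnS//=;
    [split|..]; lra.
have [next nextP] : {next : nat -> R * R -> R * R & forall n c, bad n c ->
    [/\ bad n.+1 (next n c), c.1 <= (next n c).1,
        (next n c).1 + tn n.+1 * A <= c.1 + tn n * A,
        c.2 <= (next n c).2 & (next n c).2 + tn n.+1 * B <= c.2 + tn n * B]}.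
  exists (fun n c => sval (cid (step n c))) => n c.
  exact: (svalP (cid (step n c))).
pose s := fix s n := if n is n'.+1 then next n' (s n') else (x0, y0).
have sb n : bad n (s n).
  elim: n => [|n ih]; last by have [] := nextP _ _ ih.
  by rewrite /bad t0 /=; split => //; split; lra.
(* Nested intervals, stated for either coordinate of the corner; the common point is the supremum of
   the left ends. *)
have nested (f : R * R -> R) (L : R) :
    (forall n, f (s n) <= f (s n.+1)) ->
    (forall n, f (s n.+1) + tn n.+1 * L <= f (s n) + tn n * L) -> 0 <= L ->
    exists x, forall n, f (s n) <= x <= f (s n) + tn n * L.
  move=> h1 h2 L0.
  have m1 n k : f (s n) <= f (s (n + k)%N).
    by elim: k => [|k ih]; rewrite ?addn0// addnS; exact: le_trans ih _.
  have m2 n k : f (s (n + k)%N) + tn (n + k)%N * L <= f (s n) + tn n * L.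
    by elim: k => [|k ih]; rewrite ?addn0// addnS; apply: le_trans ih.
  have m3 n m : f (s m) <= f (s n) + tn n * L.
    have le1 k : f (s k) <= f (s k) + tn k * L.
      by rewrite lerDl mulr_ge0// ltW.
    case: (leqP n m) => nm.
      by rewrite -(subnKC nm); apply: le_trans (m2 n (m - n)%N).
    apply: le_trans (le1 n); rewrite -(subnKC (ltnW nm)); exact: m1.
  exists (sup (range (fun m => f (s m)))) => n; apply/andP; split.
    apply: ub_le_sup; last by exists n.
    by exists (f (s 0%N) + tn 0%N * L) => _ [m _ <-].
  apply: ge_sup; first by exists (f (s 0%N)), 0%N.
  by move=> _ [m _ <-].
have [x xP] := nested fst A (fun n => let: And5 _ h _ _ _ := nextP _ _ (sb n) in h)
  (fun n => let: And5 _ _ h _ _ := nextP _ _ (sb n) in h) A0.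
have [y yP] := nested snd B (fun n => let: And5 _ _ _ h _ := nextP _ _ (sb n) in h)
  (fun n => let: And5 _ _ _ _ h := nextP _ _ (sb n) in h) B0.
have xi : x0 <= x <= x0 + A by have := xP 0%N; rewrite /= /tn expr0 mul1r.
have yi : y0 <= y <= y0 + B by have := yP 0%N; rewrite /= /tn expr0 mul1r.
have [d d0 h] := local x y xi yi.
have [n nd] := exists_half_lt d0.
have [nPn iPn] := sb n.
by apply: nPn; apply: h => //; rewrite tn0.
Qed.

End bisection.

Section integrals.
Variable R : realType.
Local Notation C := R[i].
Local Notation nm := (@normc R).
Local Notation mu := (@lebesgue_measure R).

Definition rint (a b : R) (phi : R -> R) : R :=
  Rintegral mu `[a, b] phi.

Definition cint (a b : R) (phi : R -> C) : C :=
  rint a b (fun t => complex.Re (phi t)) +i* rint a b (fun t => complex.Im (phi t)).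

Definition cts_on (a b : R) (phi : R -> R) :=
  forall t, a <= t <= b -> {for t, continuous phi}.

Definition ccts_on (a b : R) (phi : R -> C) :=
  forall t, a <= t <= b -> clim (nbhs t) phi (phi t).

Lemma cts_within a b phi : cts_on a b phi -> {within `[a, b], continuous phi}.
Proof.
move=> h; apply: continuous_in_subspaceT => t.
by rewrite inE /= in_itv /=; exact: h.
Qed.

Lemma cts_integrable a b phi : cts_on a b phi ->
  mu.-integrable `[a, b] (EFin \o phi).
Proof.
move=> h; apply: continuous_compact_integrable; first exact: segment_compact.
exact: cts_within.
Qed.

Lemma mulcE (a b c d : R) :
  (a +i* b) * (c +i* d) = (a * c - b * d) +i* (a * d + b * c) :> C.
Proof. by []. Qed.

Lemma eq_rint a b (f g : R -> R) : (forall t, a <= t <= b -> f t = g t) ->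
  rint a b f = rint a b g.
Proof.
by move=> h; apply: eq_Rintegral => t; rewrite inE /= in_itv /=; exact: h.
Qed.

Lemma rintD a b f g : cts_on a b f -> cts_on a b g ->
  rint a b (fun t => f t + g t) = rint a b f + rint a b g.
Proof. by move=> hf hg; apply: RintegralD => //; exact: cts_integrable. Qed.

Lemma rintZ a b c f : cts_on a b f ->
  rint a b (fun t => c * f t) = c * rint a b f.
Proof. by move=> hf; apply: RintegralZl => //; exact: cts_integrable. Qed.

Lemma rint_le a b f g : cts_on a b f -> cts_on a b g ->
  (forall t, a <= t <= b -> f t <= g t) -> rint a b f <= rint a b g.
Proof.
move=> hf hg h; apply: le_Rintegral.
- exact: measurable_itv.
- exact: cts_integrable.
- exact: cts_integrable.
- by move=> t; rewrite /= in_itv /=; exact: h.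
Qed.

Lemma cts_cst a b c : cts_on a b (fun=> c).
Proof. by move=> t _; exact: cvg_cst. Qed.

Lemma rint_cst a b c : a <= b -> rint a b (fun=> c) = c * (b - a).
Proof.
move=> ab; rewrite /rint Rintegral_cst//= lebesgue_measure_itv /= lte_fin.
by case: ltgtP ab => // -> _; rewrite subrr.
Qed.

Lemma rint_norm_le a b f M : a <= b -> cts_on a b f ->
  (forall t, a <= t <= b -> `|f t| <= M) -> `|rint a b f| <= M * (b - a).
Proof.
move=> ab hf h; rewrite ler_norml; apply/andP; split.
  rewrite -mulNr -rint_cst//; apply: rint_le => //; first exact: cts_cst.
  by move=> t /h; rewrite ler_norml => /andP[].
rewrite -rint_cst//; apply: rint_le => //; first exact: cts_cst.
by move=> t /h; rewrite ler_norml => /andP[].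
Qed.

Lemma rint_abs_le a b f : cts_on a b f -> `|rint a b f| <= rint a b (fun t => `|f t|).
Proof. by move=> h; apply: le_normr_Rintegral => //; exact: cts_integrable. Qed.

Lemma rint_cat a c b f : a <= c <= b -> cts_on a b f ->
  rint a b f = rint a c f + rint c b f.
Proof.
move=> /andP[ac cb] h.
have h' := cts_integrable h.
have := @Rintegral_itvB R f (BLeft a) (BRight b) c h'.
rewrite !bnd_simp => /(_ ac cb); rewrite /rint => /eqP; rewrite subr_eq => /eqP ->.
rewrite addrC; congr (_ + _); apply: Rintegral_itv_obnd_cbnd.
apply: integrableS h' => //; apply: subset_itv; rewrite bnd_simp //.
Qed.

Lemma rint_FTC (a b : R) (F f : R -> R) : a <= b ->
  (forall t, a <= t <= b -> is_derive t 1 F (f t)) -> cts_on a b f ->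
  rint a b f = F b - F a.
Proof.
rewrite le_eqVlt => /orP[/eqP <- _ _|ab hF hf].
  by rewrite subrr /rint set_itv1 Rintegral_set1.
have cF : cts_on a b F.
  by move=> t /hF [d _]; apply: differentiable_continuous; apply/derivable1_diffP.
rewrite /rint /Rintegral (@continuous_FTC2 R f F a b)//.
- exact: cts_within.
- split.
  + move=> t; rewrite in_itv /= => /andP[/ltW h1 /ltW h2].
    have tab : a <= t <= b by rewrite h1 h2.
    by have [] := hF t tab.
  + by apply: cvg_at_right_filter; apply: cF; rewrite lexx ltW.
  + by apply: cvg_at_left_filter; apply: cF; rewrite lexx ltW.
- move=> t; rewrite in_itv /= => /andP[/ltW h1 /ltW h2].
  have tab : a <= t <= b by rewrite h1 h2.
  by rewrite derive1E; have [_ ->] := hF t tab.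
Qed.

Lemma ccts_Re a b (phi : R -> C) : ccts_on a b phi ->
  cts_on a b (fun t => complex.Re (phi t)).
Proof. by move=> h t /h; exact: clim_ReP. Qed.

Lemma ccts_Im a b (phi : R -> C) : ccts_on a b phi ->
  cts_on a b (fun t => complex.Im (phi t)).
Proof. by move=> h t /h; exact: clim_ImP. Qed.

Lemma ccts_nm a b (phi : R -> C) : ccts_on a b phi ->
  cts_on a b (fun t => nm (phi t)).
Proof. by move=> h t /h; exact: clim_nm. Qed.

Lemma cctsM a b (f g : R -> C) : ccts_on a b f -> ccts_on a b g ->
  ccts_on a b (fun t => f t * g t).
Proof. by move=> hf hg t tab; apply: climM; [exact: hf|exact: hg]. Qed.

Lemma ccts_cst a b (c : C) : ccts_on a b (fun=> c).
Proof. by move=> t _; exact: clim_cst. Qed.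

Lemma cctsZ a b c (f : R -> C) : ccts_on a b f -> ccts_on a b (fun t => c * f t).
Proof. by move=> hf; apply: cctsM => //; exact: ccts_cst. Qed.

Lemma cctsN a b (f : R -> C) : ccts_on a b f -> ccts_on a b (fun t => - f t).
Proof. by move=> hf t tab; apply: climN; exact: hf. Qed.

Lemma eq_cint a b (f g : R -> C) : (forall t, a <= t <= b -> f t = g t) ->
  cint a b f = cint a b g.
Proof.
by move=> h; congr (_ +i* _); apply: eq_rint => t /h ->.
Qed.

Lemma cintD a b (f g : R -> C) : ccts_on a b f -> ccts_on a b g ->
  cint a b (fun t => f t + g t) = cint a b f + cint a b g.
Proof.
move=> hf hg; rewrite /cint.
transitivity (rint a b (fun t => complex.Re (f t) + complex.Re (g t)) +i*
  rint a b (fun t => complex.Im (f t) + complex.Im (g t))).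
  by congr (_ +i* _); apply: eq_rint => t _; rewrite raddfD.
by rewrite !rintD//; first [exact: ccts_Re|exact: ccts_Im].
Qed.

Lemma cintZ a b (c : C) (f : R -> C) : ccts_on a b f ->
  cint a b (fun t => c * f t) = c * cint a b f.
Proof.
move=> hf; case: c => p q; rewrite /cint.
have hR := ccts_Re hf; have hI := ccts_Im hf.
have hZ c (g : R -> R) : cts_on a b g -> cts_on a b (fun t => c * g t).
  by move=> hg t tab; apply: cvgM; [exact: cvg_cst|exact: hg].
transitivity (rint a b (fun t => p * complex.Re (f t) + (- q) * complex.Im (f t)) +i*
  rint a b (fun t => p * complex.Im (f t) + q * complex.Re (f t))).
  congr (_ +i* _); apply: eq_rint => t _; case: (f t) => u v /=; ring.
rewrite !rintD ?rintZ//; try exact: hZ.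
rewrite mulcE; congr (_ +i* _); ring.
Qed.

Lemma cintN a b (f : R -> C) : ccts_on a b f ->
  cint a b (fun t => - f t) = - cint a b f.
Proof.
by move=> h; rewrite -mulN1r -cintZ//; apply: eq_cint => t _; rewrite mulN1r.
Qed.

Lemma cintB a b (f g : R -> C) : ccts_on a b f -> ccts_on a b g ->
  cint a b (fun t => f t - g t) = cint a b f - cint a b g.
Proof. by move=> hf hg; rewrite cintD ?cintN//; exact: cctsN. Qed.

(** The factor 2 comes from bounding real and imaginary parts separately. It propagates to [mean_le]
    and to the Cauchy estimates, where constants are harmless. *)
Lemma cint_norm_le a b (f : R -> C) M : a <= b -> ccts_on a b f ->
  (forall t, a <= t <= b -> nm (f t) <= M) -> nm (cint a b f) <= 2 * M * (b - a).
Proof.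
move=> ab hf h; apply: le_trans (nm_le_ReIm _) _.
have -> : 2 * M * (b - a) = M * (b - a) + M * (b - a) by ring.
rewrite /cint /=; apply: lerD.
  apply: rint_norm_le => //; first exact: ccts_Re.
  by move=> t /h; apply: le_trans; exact: Re_le_nm.
apply: rint_norm_le => //; first exact: ccts_Im.
by move=> t /h; apply: le_trans; exact: Im_le_nm.
Qed.

Lemma cint_nm_le a b (f : R -> C) : ccts_on a b f ->
  nm (cint a b f) <= 2 * rint a b (fun t => nm (f t)).
Proof.
move=> hf; apply: le_trans (nm_le_ReIm _) _.
have hR := ccts_Re hf; have hI := ccts_Im hf; have hN := ccts_nm hf.
have hA g : cts_on a b g -> cts_on a b (fun t => `|g t|).
  by move=> hg t tab; apply: cvg_norm; exact: hg.
rewrite /cint /= mulr2n mulrDl !mul1r; apply: lerD.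
  apply: le_trans (rint_abs_le hR) _; apply: rint_le => //; first exact: hA.
  by move=> t _; exact: Re_le_nm.
apply: le_trans (rint_abs_le hI) _; apply: rint_le => //; first exact: hA.
by move=> t _; exact: Im_le_nm.
Qed.

Lemma cint_cat a c b (f : R -> C) : a <= c <= b -> ccts_on a b f ->
  cint a b f = cint a c f + cint c b f.
Proof.
move=> acb hf; rewrite /cint (rint_cat acb (ccts_Re hf)).
by rewrite (rint_cat acb (ccts_Im hf)).
Qed.

Lemma cint_FTC (a b : R) (F f : R -> C) : a <= b ->
  (forall t, a <= t <= b -> rder F t (f t)) -> ccts_on a b f ->
  cint a b f = F b - F a.
Proof.
move=> ab hF hf.
have E1 := rint_FTC ab (fun t tab => rder_Re (hF t tab)) (ccts_Re hf).
have E2 := rint_FTC ab (fun t tab => rder_Im (hF t tab)) (ccts_Im hf).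
rewrite /cint E1 E2.
by case: (F b); case: (F a).
Qed.

Lemma cint_cst a b (c : C) : a <= b -> cint a b (fun=> c) = c * (b - a)%:C.
Proof.
move=> ab; rewrite /cint !rint_cst//; case: c => p q.
by rewrite mulcE; congr (_ +i* _) => /=; ring.
Qed.

Lemma cint_sum a b (I : Type) (r : seq I) (f : I -> R -> C) :
  (forall i, ccts_on a b (f i)) ->
  cint a b (fun t => \sum_(i <- r) f i t) = \sum_(i <- r) cint a b (f i).
Proof.
move=> hf; elim: r => [|i r ih].
  rewrite big_nil; transitivity ((0 : C) * cint a b (fun=> 0)); last by rewrite mul0r.
  rewrite -cintZ; last exact: ccts_cst.
  by apply: eq_cint => t _; rewrite big_nil mul0r.
have hS : ccts_on a b (fun t => \sum_(j <- r) f j t).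
  by move=> t tab; apply: clim_sum => j; exact: hf.
rewrite big_cons -ih -(cintD (hf i) hS).
by apply: eq_cint => t _; rewrite big_cons.
Qed.

End integrals.

Arguments normc : simpl never.

(** * Goursat's theorem on an annulus *)

Section goursat.
Variable R : realType.
Local Notation C := R[i].
Local Notation nm := (@normc R).

Definition ccts (F : C -> C) (z : C) := clim (cnb z) F (F z).
Definition hol (F : C -> C) (z : C) := exists d, cder F z d.

Lemma hol_ccts F z : hol F z -> ccts F z.
Proof. by move=> [d]; exact: cder_lim. Qed.

Lemma ccts_id z : ccts id z. Proof. exact: clim_id. Qed.
Lemma ccts_const c z : ccts (fun=> c) z. Proof. exact: clim_cst. Qed.
Lemma ccts_mul F G z : ccts F z -> ccts G z -> ccts (fun w => F w * G w) z.
Proof. exact: climM. Qed.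
Lemma ccts_add F G z : ccts F z -> ccts G z -> ccts (fun w => F w + G w) z.
Proof. exact: climD. Qed.
Lemma ccts_sub F G z : ccts F z -> ccts G z -> ccts (fun w => F w - G w) z.
Proof. exact: climB. Qed.
Lemma ccts_inv F z : F z != 0 -> ccts F z -> ccts (fun w => (F w)^-1) z.
Proof. exact: climV. Qed.

Definition pol (r t : R) : C := r%:C * cis t.

Lemma nm_pol (r t : R) : 0 <= r -> nm (pol r t) = r.
Proof. by move=> r0; rewrite normcM nm_cis mulr1 nm_real ger0_norm. Qed.

Lemma rder_pol_t (r t : R) : rder (pol r) t ('i * pol r t).
Proof.
rewrite /pol; have -> : 'i * (r%:C * cis t) = r%:C * ('i * cis t) :> C by ring.
by apply: rderZ; exact: rder_cis.
Qed.

Lemma rder_pol_r (r t : R) : rder (pol^~ t) r (cis t).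
Proof.
have := rderM (rder_id r) (rder_cst (cis t) r).
by rewrite mul1r mulr0 addr0.
Qed.

Lemma pol_cts_t (r : R) a b : ccts_on a b (pol r).
Proof. by move=> t _; apply: rder_lim; exact: rder_pol_t. Qed.

Lemma pol_cts_r (t : R) a b : ccts_on a b (pol^~ t).
Proof. by move=> r _; apply: rder_lim; exact: rder_pol_r. Qed.

Lemma cis_cts a b : ccts_on a b (@cis R).
Proof. by move=> t _; apply: rder_lim; exact: rder_cis. Qed.

Lemma ccts_on_comp a b (g : R -> C) F : ccts_on a b g ->
  (forall t, a <= t <= b -> ccts F (g t)) -> ccts_on a b (fun t => F (g t)).
Proof.
by move=> hg hF t tab; apply: (clim_comp (hg _ tab)); exact: hF.
Qed.

Lemma nm_i : nm 'i = 1.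
Proof. by rewrite /normc expr0n expr1n add0r sqrtr1. Qed.

Lemma nm_cisB (s t : R) : nm (cis t - cis s) <= 2 * `|t - s|.
Proof.
wlog st : s t / s <= t.
  move=> W; case: (leP s t) => [|/ltW] st; first exact: W.
  by rewrite nm_distC distrC; exact: W.
have hc : ccts_on s t (fun u => 'i * cis u) by apply: cctsZ; exact: cis_cts.
rewrite -(cint_FTC st (fun u _ => rder_cis u) hc) ger0_norm ?subr_ge0//.
rewrite -[2 in leRHS]mulr1; apply: cint_norm_le => // u _.
by rewrite normcM nm_cis nm_i mulr1.
Qed.

Lemma nm_polB (r s x y : R) : 0 <= x ->
  nm (pol r s - pol x y) <= `|r - x| + x * (2 * `|s - y|).
Proof.
move=> x0.
have -> : pol r s - pol x y = (r - x)%:C * cis s + x%:C * (cis s - cis y).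
  by rewrite /pol rmorphB; ring.
apply: le_trans (nmD _ _) _; rewrite !normcM nm_cis !nm_real mulr1 (ger0_norm x0).
by rewrite lerD2l ler_wpM2l// nm_cisB.
Qed.

(** Integral of [F w dw] along a circular arc, ['i * pol r t] being the velocity; [side_r] is its
    analogue along a radius. *)
Definition side_t (F : C -> C) (r a b : R) :=
  cint a b (fun t => F (pol r t) * ('i * pol r t)).
Definition side_r (F : C -> C) (t a b : R) :=
  cint a b (fun r => F (pol r t) * cis t).

(** The contour integral of [F] around the image of [[p, p'] x [q, q']] under polar coordinates. *)
Definition polar_loop (F : C -> C) (p p' q q' : R) :=
  side_t F p' q q' - side_t F p q q' - (side_r F q' p p' - side_r F q p p').

Definition cts_rect (F : C -> C) (p p' q q' : R) :=
  forall r t, p <= r <= p' -> q <= t <= q' -> ccts F (pol r t).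

Lemma side_t_cts F p p' q q' r : cts_rect F p p' q q' -> p <= r <= p' ->
  ccts_on q q' (fun t => F (pol r t) * ('i * pol r t)).
Proof.
move=> h pr; apply: cctsM; last by apply: cctsZ; exact: pol_cts_t.
by apply: ccts_on_comp => [|t qt]; [exact: pol_cts_t|exact: h].
Qed.

Lemma side_r_cts F p p' q q' t : cts_rect F p p' q q' -> q <= t <= q' ->
  ccts_on p p' (fun r => F (pol r t) * cis t).
Proof.
move=> h qt; apply: cctsM; last exact: ccts_cst.
by apply: ccts_on_comp => [|r pr]; [exact: pol_cts_r|exact: h].
Qed.

Lemma polar_loopB F G p p' q q' : p <= p' -> q <= q' ->
  cts_rect F p p' q q' -> cts_rect G p p' q q' ->
  polar_loop (fun w => F w - G w) p p' q q' =
  polar_loop F p p' q q' - polar_loop G p p' q q'.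
Proof.
move=> pp qq hF hG.
have T r : p <= r <= p' ->
    side_t (fun w => F w - G w) r q q' = side_t F r q q' - side_t G r q q'.
  move=> pr; rewrite /side_t.
  rewrite -(cintB (side_t_cts hF pr) (side_t_cts hG pr)).
  by apply: eq_cint => t _; rewrite mulrBl.
have S t : q <= t <= q' ->
    side_r (fun w => F w - G w) t p p' = side_r F t p p' - side_r G t p p'.
  move=> qt; rewrite /side_r.
  rewrite -(cintB (side_r_cts hF qt) (side_r_cts hG qt)).
  by apply: eq_cint => r _; rewrite mulrBl.
by rewrite /polar_loop !T ?S ?lexx ?pp ?qq//; ring.
Qed.

(** An affine function has the antiderivative [G], so each side is a difference of values of [G] at
    corners, and these cancel around the loop. *)
Lemma polar_loop_affine (c0 c1 : C) p p' q q' : p <= p' -> q <= q' ->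
  polar_loop (fun w => c0 + c1 * w) p p' q q' = 0.
Proof.
move=> pp qq.
pose F w := c0 + c1 * w.
pose G (w : C) := c0 * w + c1 / 2 * w ^+ 2.
have hG w : cder G w (F w).
  have := cderD (cderZ c0 (cder_id w)) (cderZ (c1 / 2) (cderX 2 (cder_id w))).
  congr (cder _ w _); rewrite /F /= !expr1; by field.
have hF : cts_rect F p p' q q'.
  move=> r t _ _; apply: ccts_add; first exact: ccts_const.
  by apply: ccts_mul; [exact: ccts_const|exact: ccts_id].
have T r : p <= r <= p' -> side_t F r q q' = G (pol r q') - G (pol r q).
  move=> pr; apply: (cint_FTC (F := fun t => G (pol r t))) => //.
    by move=> t _; exact: (rder_comp (rder_pol_t r t) (hG _)).
  exact: side_t_cts hF pr.
have S t : q <= t <= q' -> side_r F t p p' = G (pol p' t) - G (pol p t).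
  move=> qt; apply: (cint_FTC (F := fun r => G (pol r t))) => //.
    by move=> r _; exact: (rder_comp (rder_pol_r r t) (hG _)).
  exact: side_r_cts hF qt.
by rewrite /polar_loop !T ?S ?lexx ?pp ?qq//; ring.
Qed.

Lemma polar_loop_split F p m p' q n q' : p <= m <= p' -> q <= n <= q' ->
  cts_rect F p p' q q' ->
  polar_loop F p p' q q' = polar_loop F p m q n + polar_loop F m p' q n +
    (polar_loop F p m n q' + polar_loop F m p' n q').
Proof.
move=> pmp qnq hF; have /andP[pm mp] := pmp; have /andP[qn nq] := qnq.
have T r : p <= r <= p' -> side_t F r q q' = side_t F r q n + side_t F r n q'.
  by move=> pr; exact: (cint_cat qnq (side_t_cts hF pr)).
have S t : q <= t <= q' -> side_r F t p p' = side_r F t p m + side_r F t m p'.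
  by move=> qt; exact: (cint_cat pmp (side_r_cts hF qt)).
have pp := le_trans pm mp; have qq := le_trans qn nq.
by rewrite /polar_loop !T ?S ?lexx ?pp ?qq//; ring.
Qed.

Lemma polar_loop_le F p p' q q' M : 0 <= p -> p <= p' -> q <= q' ->
  cts_rect F p p' q q' -> 0 <= M ->
  (forall r t, p <= r <= p' -> q <= t <= q' -> nm (F (pol r t)) <= M) ->
  nm (polar_loop F p p' q q') <= 4 * M * (p' * (q' - q) + (p' - p)).
Proof.
move=> p0 pp qq hF M0 hM.
have T r : p <= r <= p' -> nm (side_t F r q q') <= 2 * (M * p') * (q' - q).
  move=> pr; apply: cint_norm_le => //; first exact: side_t_cts hF pr.
  move=> t qt; rewrite !normcM nm_i mul1r -/(pol r t).
  have /andP[p1 p2] := pr; have r0 := le_trans p0 p1.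
  by rewrite -normcM -/(pol r t) nm_pol// ler_pM ?nm_ge0// hM.
have S t : q <= t <= q' -> nm (side_r F t p p') <= 2 * M * (p' - p).
  move=> qt; apply: cint_norm_le => //; first exact: side_r_cts hF qt.
  by move=> r pr; rewrite normcM nm_cis mulr1 hM.
rewrite /polar_loop; have h1 := T p'; have h2 := T p; have h3 := S q'; have h4 := S q.
rewrite !lexx !pp /= in h1 h2; rewrite !lexx !qq /= in h3 h4.
have := nmB (side_t F p' q q' - side_t F p q q') (side_r F q' p p' - side_r F q p p').
have := nmB (side_t F p' q q') (side_t F p q q').
have := nmB (side_r F q' p p') (side_r F q p p').
move: (h1 isT) (h2 isT) (h3 isT) (h4 isT); lra.
Qed.

(** Near a point, [F] differs from its tangent affine function by at most [e] times the distance. As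
    the loop of the latter vanishes, the loop around a cell of scale [t] is at most
    [e * K * t ^+ 2], a bound that four quarters reproduce exactly. *)
Lemma goursat F (x0 y0 A B : R) : 0 <= x0 -> 0 <= A -> 0 <= B ->
  (forall r t, x0 <= r <= x0 + A -> y0 <= t <= y0 + B -> hol F (pol r t)) ->
  polar_loop F x0 (x0 + A) y0 (y0 + B) = 0.
Proof.
move=> x00 A0 B0 hF.
(* A cell of scale [t] has diameter at most [t * D]; the second factor of [K] bounds the length of
   its sides, up to the constant of [polar_loop_le]. *)
pose D := A + (x0 + A) * (2 * B).
pose K := 4 * D * ((x0 + A) * B + A).
have D0 : 0 <= D by rewrite /D !(addr_ge0, mulr_ge0).
have K0 : 0 <= K by rewrite /K !(addr_ge0, mulr_ge0).
suff key e : 0 < e -> nm (polar_loop F x0 (x0 + A) y0 (y0 + B)) <= e * K.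
  apply/eqP; rewrite -nm_eq0 eq_le nm_ge0 andbT; apply/ler_addgt0Pr => e e0.
  have K1 : 0 < K + 1 by rewrite ltr_wpDl.
  rewrite add0r; apply: le_trans (key (e / (K + 1)) _) _; first by rewrite divr_gt0.
  by rewrite mulrAC ler_pdivrMr// ler_pM2l// lerDl.
move=> e0.
have hFc : cts_rect F x0 (x0 + A) y0 (y0 + B).
  by move=> r t h1 h2; apply: hol_ccts; exact: hF.
have := @rectangle_induction R x0 y0 A B (fun p q t =>
  nm (polar_loop F p (p + t * A) q (q + t * B)) <= e * K * t ^+ 2) A0 B0.
rewrite /= !mul1r expr1n mulr1; apply.
- move=> p q t t0 [i1 i2 i3 i4] h1 h2 h3 h4.
  have tA : 0 <= t / 2 * A by rewrite mulr_ge0// divr_ge0// ltW.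
  have tB : 0 <= t / 2 * B by rewrite mulr_ge0// divr_ge0// ltW.
  have EA : p + t / 2 * A + t / 2 * A = p + t * A by field.
  have EB : q + t / 2 * B + t / 2 * B = q + t * B by field.
  rewrite (@polar_loop_split F p (p + t / 2 * A) _ q (q + t / 2 * B) _); last first.
  + move=> r s /andP[r1 r2] /andP[s1 s2]; apply: hFc.
      by rewrite (le_trans i1 r1) (le_trans r2 i2).
    by rewrite (le_trans i3 s1) (le_trans s2 i4).
  + by rewrite -EB !lerDl tB.
  + by rewrite -EA !lerDl tA.
  rewrite EA in h2 h4; rewrite EB in h3 h4.
  have sq : (t / 2) ^+ 2 = t ^+ 2 / 4 by field.
  rewrite !sq in h1 h2 h3 h4.
  apply: le_trans (nmD _ _) _.
  have := nmD (polar_loop F p (p + t / 2 * A) q (q + t / 2 * B))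
   (polar_loop F (p + t / 2 * A) (p + t * A) q (q + t / 2 * B)).
  have := nmD (polar_loop F p (p + t / 2 * A) (q + t / 2 * B) (q + t * B))
   (polar_loop F (p + t / 2 * A) (p + t * A) (q + t / 2 * B) (q + t * B)).
  lra.
- move=> x y xx yy.
  have x1 : 0 <= x by have /andP[h _] := xx; exact: le_trans h.
  have [d [psi Fpsi psid]] := hF x y xx yy.
  pose w0 := pol x y; pose L w := F w0 - d * w0 + d * w.
  have [dl dl0 hdl] : \forall w \near cnb w0, nm (F w - L w) <= e * nm (w - w0).
    have := psid _ e0; apply: filterS2 Fpsi => w Fw /ltW hw.
    have -> : F w - L w = (psi w - d) * (w - w0) by rewrite Fw /L /w0 /=; ring.
    by rewrite normcM ler_wpM2r ?nm_ge0.
  have D1 : 0 < D + 1 by rewrite ltr_wpDl.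
  exists (Num.min 1 (dl / (D + 1))); first by rewrite lt_min ltr01 divr_gt0.
  move=> p q t /andP[t0]; rewrite lt_min => /andP[t1 tdl] [i1 i2 i3 i4] xp yq.
  have tA : 0 <= t * A by rewrite mulr_ge0// ltW.
  have tB : 0 <= t * B by rewrite mulr_ge0// ltW.
  have pp : p <= p + t * A by rewrite lerDl.
  have qq : q <= q + t * B by rewrite lerDl.
  have cF : cts_rect F p (p + t * A) q (q + t * B).
    move=> r s /andP[r1 r2] /andP[s1 s2]; apply: hFc.
      by rewrite (le_trans i1 r1) (le_trans r2 i2).
    by rewrite (le_trans i3 s1) (le_trans s2 i4).
  have cL : cts_rect L p (p + t * A) q (q + t * B).
    move=> r s _ _; apply: ccts_add; first exact: ccts_const.
    by apply: ccts_mul; [exact: ccts_const|exact: ccts_id].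
  have cFL : cts_rect (fun w => F w - L w) p (p + t * A) q (q + t * B).
    by move=> r s h1 h2; apply: ccts_sub; [exact: cF|exact: cL].
  have -> : polar_loop F p (p + t * A) q (q + t * B) =
      polar_loop (fun w => F w - L w) p (p + t * A) q (q + t * B).
    by rewrite polar_loopB// polar_loop_affine// subr0.
  have near_w0 r s : p <= r <= p + t * A -> q <= s <= q + t * B ->
      nm (pol r s - w0) <= t * D.
    move=> /andP[r1 r2] /andP[s1 s2]; apply: le_trans (nm_polB _ _ _ x1) _.
    move: xp yq => /andP[x2 x3] /andP[y2 y3].
    have a1 : `|r - x| <= t * A by rewrite ler_norml; apply/andP; split; lra.
    have a2 : `|s - y| <= t * B by rewrite ler_norml; apply/andP; split; lra.
    have xA : x <= x0 + A by have /andP[] := xx.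
    have -> : t * D = t * A + (x0 + A) * (2 * (t * B)) by rewrite /D; ring.
    by rewrite lerD// ler_pM// ?mulr_ge0// ler_wpM2l.
  have p0 : 0 <= p by exact: le_trans i1.
  apply: le_trans (@polar_loop_le _ _ _ _ _ (e * (t * D)) _ _ _ _ _ _) _ => //.
  + by rewrite !mulr_ge0// ltW.
  + move=> r s rr ss; apply: le_trans (hdl _ _) _.
      apply: le_lt_trans (near_w0 _ _ rr ss) _.
      move: tdl; rewrite ltr_pdivlMr//; apply: le_lt_trans.
      by apply: ler_wpM2l; [exact: ltW|rewrite lerDl].
    by apply: ler_wpM2l; [exact: ltW|exact: near_w0].
  have -> : e * K * t ^+ 2 = 4 * (e * (t * D)) * ((x0 + A) * (t * B) + t * A).
    by rewrite /K; ring.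
  apply: ler_wpM2l; first by rewrite !mulr_ge0// ltW.
  by rewrite (addrC q) addrK (addrC p (t * A)) addrK lerD2r ler_wpM2r// (addrC (t * A)).
Qed.

(** This is [1 / (2 * pi * 'i)] times the contour integral of [h w / w] over the circle of radius
    [r]; hence the factor [w] in the Cauchy kernels below. *)
Definition mean (h : C -> C) (r : R) : C :=
  ((2 * pi)^-1)%:C * cint 0 (2 * pi) (fun t => h (pol r t)).

Lemma pi2_gt0 : (0 : R) < 2 * pi.
Proof. by rewrite mulr_gt0// pi_gt0. Qed.

Lemma eq_mean (g h : C -> C) r : 0 <= r -> (forall z, nm z = r -> g z = h z) ->
  mean g r = mean h r.
Proof.
move=> r0 gh; rewrite /mean; congr (_ * _); apply: eq_cint => t _.
by apply: gh; exact: nm_pol.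
Qed.

(* Goursat applied to h w / w on a polar rectangle that closes up. *)
Lemma mean_hol (h : C -> C) (r1 r2 : R) : 0 < r1 -> r1 <= r2 ->
  (forall z, r1 <= nm z <= r2 -> hol h z) -> mean h r1 = mean h r2.
Proof.
move=> r10 r12 hh.
pose F w := h w / w.
have hF r t : r1 <= r <= r2 -> hol F (pol r t).
  move=> rr; have r0 : 0 < r by case/andP: rr => + _; exact: lt_le_trans.
  have [d hd] : hol h (pol r t) by apply: hh; rewrite nm_pol// ltW.
  have p0 : pol r t != 0 by rewrite -nm_gt0 nm_pol// ltW.
  by eexists; apply: cder_div => //; [exact: hd|exact: cder_id].
have := @goursat F r1 0 (r2 - r1) (2 * pi) (ltW r10) _ (ltW pi2_gt0).
rewrite subr_ge0 subrKC add0r => /(_ r12 (fun r t rr _ => hF r t rr)).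
rewrite /polar_loop.
have -> : side_r F (2 * pi) r1 r2 = side_r F 0 r1 r2.
  apply: eq_cint => r _; rewrite /pol /cis.
  by rewrite mulr_natl -[pi *+ 2]add0r cosD2pi sinD2pi.
have T r : r1 <= r <= r2 -> side_t F r 0 (2 * pi) = 'i * cint 0 (2 * pi) (fun t => h (pol r t)).
  move=> rr; have r0 : 0 < r by case/andP: rr => + _; exact: lt_le_trans.
  rewrite -cintZ; last first.
    apply: ccts_on_comp => [|t _]; first exact: pol_cts_t.
    by apply: hol_ccts; apply: hh; rewrite nm_pol// ltW.
  apply: eq_cint => t _; rewrite /F; have p0 : pol r t != 0 by rewrite -nm_gt0 nm_pol// ltW.
  by field.
rewrite !T ?lexx ?r12// subrr subr0 => /eqP; rewrite subr_eq0.
move=> /eqP /mulfI E; rewrite /mean E//.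
by rewrite -nm_gt0 nm_i.
Qed.

End goursat.

(** * Circle means of the Cauchy kernel *)

Section cauchy.
Variable R : realType.
Local Notation C := R[i].
Local Notation nm := (@normc R).
Local Notation mu := (@lebesgue_measure R).

Lemma polar_form (z : C) : exists2 t, 0 <= t <= 2 * pi & z = pol (nm z) t.
Proof.
have [->|z0] := eqVneq z 0.
  exists 0; first by rewrite lexx ltW// pi2_gt0.
  by rewrite /pol normc0 mul0r.
case: z z0 => a b z0; set r := nm _.
have r0 : 0 < r by rewrite nm_gt0.
have r2 : r ^+ 2 = a ^+ 2 + b ^+ 2 by rewrite nm_sqr.
have ha : `|a| <= r := Re_le_nm (a +i* b).
have x1 : -1 <= a / r <= 1.
  by rewrite ler_pdivrMr// ler_pdivlMr// mulN1r mul1r -ler_norml.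
have c1 : r * cos (acos (a / r)) = a by rewrite acosK ?in_itv//= mulrC divfK// gt_eqF.
have s1 : r * sin (acos (a / r)) = `|b|.
  apply: (@pexpIrn _ 2) => //; rewrite ?nnegrE//.
    by rewrite mulr_ge0 ?(ltW r0)// sin_ge0_pi// acos_ge0// acos_lepi.
  rewrite exprMn sin2cos2 acosK ?in_itv//= real_normK ?num_real//.
  have -> : b ^+ 2 = r ^+ 2 - a ^+ 2 by rewrite r2; ring.
  by field; rewrite gt_eqF.
have t0 := acos_ge0 x1; have t1 := acos_lepi x1; have p0 := pi_gt0 R.
case: (leP 0 b) => b0.
  exists (acos (a / r)); first by rewrite t0/=; lra.
  rewrite /pol /cis mulcE !mul0r subr0 addr0 c1 s1 ger0_norm//.
exists (2 * pi - acos (a / r)); first by apply/andP; split; lra.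
rewrite /pol /cis mulr_natl addrC.
have -> : cos (- acos (a / r) + pi *+ 2) = cos (acos (a / r)) by rewrite cosD2pi cosN.
have -> : sin (- acos (a / r) + pi *+ 2) = - sin (acos (a / r)) by rewrite sinD2pi sinN.
by rewrite mulcE !mul0r subr0 addr0 c1 mulrN s1 ltr0_norm// opprK.
Qed.

Lemma mean_le h (r M : R) : 0 <= r -> (forall z, nm z = r -> ccts h z) ->
  (forall z, nm z = r -> nm (h z) <= M) -> nm (mean h r) <= 2 * M.
Proof.
move=> r0 hc hM; have p0 := pi2_gt0 R.
rewrite normcM nm_real ger0_norm ?invr_ge0 ?(ltW p0)// mulrC ler_pdivrMr//.
rewrite -[X in 2 * M * X]subr0; apply: cint_norm_le; first exact: ltW.
  by apply: ccts_on_comp => [|t _]; [exact: pol_cts_t|apply: hc; exact: nm_pol].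
by move=> t _; apply: hM; exact: nm_pol.
Qed.

Lemma circle_cts h (r : R) a b : 0 <= r -> (forall z, nm z = r -> ccts h z) ->
  ccts_on a b (fun t => h (pol r t)).
Proof.
move=> r0 hc; apply: ccts_on_comp => [|t _]; first exact: pol_cts_t.
by apply: hc; exact: nm_pol.
Qed.

Lemma meanD g h (r : R) : 0 <= r -> (forall z, nm z = r -> ccts g z) ->
  (forall z, nm z = r -> ccts h z) ->
  mean (fun w => g w + h w) r = mean g r + mean h r.
Proof.
by move=> r0 hg hh; rewrite /mean cintD ?mulrDr//; exact: circle_cts.
Qed.

Lemma meanB g h (r : R) : 0 <= r -> (forall z, nm z = r -> ccts g z) ->
  (forall z, nm z = r -> ccts h z) ->
  mean (fun w => g w - h w) r = mean g r - mean h r.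
Proof.
by move=> r0 hg hh; rewrite /mean cintB ?mulrBr//; exact: circle_cts.
Qed.

Lemma meanZ c h (r : R) : 0 <= r -> (forall z, nm z = r -> ccts h z) ->
  mean (fun w => c * h w) r = c * mean h r.
Proof.
by move=> r0 hh; rewrite /mean cintZ; [rewrite mulrCA|exact: circle_cts].
Qed.

Lemma mean_cst c (r : R) : mean (fun=> c) r = c.
Proof.
have p0 := pi2_gt0 R.
rewrite /mean cint_cst ?(ltW p0)// subr0 mulrCA -rmorphM mulVf ?gt_eqF//.
by rewrite mulr1.
Qed.

Lemma mean_sum (I : Type) (s : seq I) (h : I -> C -> C) (r : R) : 0 <= r ->
  (forall i z, nm z = r -> ccts (h i) z) ->
  mean (fun w => \sum_(i <- s) h i w) r = \sum_(i <- s) mean (h i) r.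
Proof.
move=> r0 hh; rewrite /mean cint_sum ?mulr_sumr// => i.
by apply: circle_cts => // z; exact: hh.
Qed.

Lemma nm_le_eps (z : C) : (forall e : R, 0 < e -> nm z <= e) -> z = 0.
Proof.
move=> h; apply/eqP; rewrite -nm_eq0 eq_le nm_ge0 andbT.
by apply/ler_addgt0Pr => e e0; rewrite add0r h.
Qed.

Lemma hol_id z : hol (@id C) z. Proof. by exists 1; exact: cder_id. Qed.
Lemma hol_cst (c : C) z : hol (fun=> c) z. Proof. by exists 0; exact: cder_cst. Qed.
Lemma holD F G (z : C) : hol F z -> hol G z -> hol (fun w => F w + G w) z.
Proof. by move=> [d h] [e k]; eexists; exact: cderD h k. Qed.
Lemma holB F G (z : C) : hol F z -> hol G z -> hol (fun w => F w - G w) z.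
Proof. by move=> [d h] [e k]; eexists; exact: cderB h k. Qed.
Lemma holM F G (z : C) : hol F z -> hol G z -> hol (fun w => F w * G w) z.
Proof. by move=> [d h] [e k]; eexists; exact: cderM h k. Qed.
Lemma holX F n (z : C) : hol F z -> hol (fun w => F w ^+ n) z.
Proof. by move=> [d h]; eexists; exact: cderX h. Qed.
Lemma holV F (z : C) : F z != 0 -> hol F z -> hol (fun w => (F w)^-1) z.
Proof. by move=> F0 [d h]; eexists; exact: cderV F0 h. Qed.
Lemma hol_div F G (z : C) : G z != 0 -> hol F z -> hol G z ->
  hol (fun w => F w / G w) z.
Proof. by move=> G0 hF hG; apply: holM => //; exact: holV. Qed.
Lemma hol_near F G (z : C) : (\forall w \near cnb z, F w = G w) -> hol F z -> hol G z.
Proof. by move=> FG [d h]; exists d; exact: cder_near FG h. Qed.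
Lemma hol_comp F G (z : C) : hol F z -> hol G (F z) -> hol (fun w => G (F w)) z.
Proof. by move=> [d h] [e k]; eexists; exact: cder_comp h k. Qed.

Lemma nm_subl (z w : C) : nm w - nm z <= nm (w - z).
Proof. by have := nm_distB w z; rewrite ler_norml => /andP[_]. Qed.

Lemma sub_neq0 (z w : C) : nm z != nm w -> w - z != 0.
Proof. by apply: contraNneq => /eqP; rewrite subr_eq0 => /eqP ->. Qed.

Lemma hol_kernel (z w : C) : w - z != 0 -> hol (fun w => w / (w - z)) w.
Proof.
move=> wz; apply: hol_div => //; first exact: hol_id.
by apply: holB; [exact: hol_id|exact: hol_cst].
Qed.

(** Below [nm z] the mean does not depend on the radius, and it tends to 0 with the radius. *)
Lemma mean_kernel_in (z : C) (r : R) : 0 < r -> r < nm z ->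
  mean (fun w => w / (w - z)) r = 0.
Proof.
move=> r0 rz; apply: nm_le_eps => e e0.
have d0 : 0 < nm z - r by rewrite subr_gt0.
pose s := Num.min r (e * (nm z - r) / 2).
have s0 : 0 < s by rewrite lt_min r0 divr_gt0// mulr_gt0.
have sr : s <= r by rewrite ge_min lexx.
have se : s <= e * (nm z - r) / 2 by rewrite ge_min lexx orbT.
have hk w : s <= nm w <= r -> hol (fun w => w / (w - z)) w.
  move=> /andP[_ wr]; apply: hol_kernel; apply: sub_neq0.
  by rewrite gt_eqF// (le_lt_trans wr).
rewrite -(mean_hol s0 sr hk); apply: le_trans (mean_le (M := e / 2) _ _ _) _ => //.
- exact: ltW.
- by move=> w ws; apply: hol_ccts; apply: hk; rewrite ws lexx.
- move=> w ws; rewrite normcM normcV ws.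
  have h1 : nm z - r <= nm (w - z).
    rewrite nm_distC; apply: le_trans (nm_subl _ _); rewrite ws; lra.
  rewrite ler_pdivrMr; last exact: lt_le_trans h1.
  by apply: le_trans se _; rewrite mulrAC ler_wpM2l// divr_ge0// ltW.
- by rewrite mulrC divfK.
Qed.

(** Beyond [nm z] the mean does not depend on the radius, and on large circles the kernel differs
    from 1 by [z / (w - z)], which tends to 0. *)
Lemma mean_kernel_out (z : C) (r : R) : nm z < r ->
  mean (fun w => w / (w - z)) r = 1.
Proof.
move=> zr; have r0 : 0 < r by exact: le_lt_trans (nm_ge0 z) zr.
have hk w : r <= nm w -> hol (fun w => w / (w - z)) w.
  move=> wr; apply: hol_kernel; apply: sub_neq0.
  by rewrite lt_eqF// (lt_le_trans zr).
apply/eqP; rewrite -subr_eq0; apply/eqP; apply: nm_le_eps => e e0.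
pose s := Num.max r (nm z + 2 * nm z / e + 1).
have rs : r <= s by rewrite le_max lexx.
have s1 : nm z + 2 * nm z / e + 1 <= s by rewrite le_max lexx orbT.
have s0 : 0 < s by exact: lt_le_trans rs.
have hs w : nm w = s -> w - z != 0.
  by move=> ws; apply: sub_neq0; rewrite ws lt_eqF// (lt_le_trans zr).
have hk2 w : nm w = s -> ccts (fun w => w / (w - z)) w.
  by move=> ws; apply: hol_ccts; apply: hk; rewrite ws.
rewrite (mean_hol r0 rs); last by move=> w /andP[/hk].
rewrite -(mean_cst 1 s) -meanB ?(ltW s0)//; last by move=> w _; exact: ccts_const.
apply: le_trans (mean_le (M := e / 2) _ _ _) _ => //.
- exact: ltW.
- move=> w ws; apply: ccts_sub; [exact: hk2|exact: ccts_const].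
- move=> w ws; have -> : w / (w - z) - 1 = z / (w - z).
    by field; exact: hs.
  have nz := nm_ge0 z.
  have q0 : 0 <= 2 * nm z / e by rewrite divr_ge0 ?(ltW e0)// mulr_ge0.
  have h1 : 2 * nm z / e + 1 <= nm (w - z).
    by apply: le_trans (nm_subl _ _); rewrite ws; lra.
  rewrite normcM normcV ler_pdivrMr; last by apply: lt_le_trans h1; lra.
  apply: (@le_trans _ _ (e / 2 * (2 * nm z / e))).
    by rewrite le_eqVlt; apply/orP; left; apply/eqP; field; rewrite gt_eqF.
  by rewrite ler_wpM2l ?divr_ge0 ?(ltW e0)//; apply: le_trans h1; lra.
- by rewrite mulrC divfK.
Qed.

(** Compactness by bisection: boundedness passes from four quarters to the whole cell and holds near
    each point by continuity. *)
Lemma annulus_bounded (F : C -> C) (a b : R) : 0 <= a -> a <= b ->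
  (forall z, a <= nm z <= b -> ccts F z) ->
  exists2 M, 0 <= M & forall z, a <= nm z <= b -> nm (F z) <= M.
Proof.
move=> a0 ab hF; have ba : 0 <= b - a by rewrite subr_ge0.
have p0 := pi2_gt0 R.
have := @rectangle_induction R a 0 (b - a) (2 * pi) (fun p q t =>
  exists2 M, 0 <= M & forall r s, p <= r <= p + t * (b - a) ->
   q <= s <= q + t * (2 * pi) -> nm (F (pol r s)) <= M) ba (ltW p0).
rewrite /= !mul1r add0r subrKC => H.
have {}[|x y xx yy|M M0 hM] := H; last first.
- exists M => // z zab; have [t tt zE] := polar_form z.
  by rewrite zE; exact: hM.
- have x0 : 0 <= x by have /andP[h _] := xx; exact: le_trans h.
  have [|d d0 hd] := hF (pol x y) _ 1 ltr01; first by rewrite nm_pol.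
  pose K := (b - a) + x * (2 * (2 * pi)).
  have K0 : 0 <= K by rewrite /K addr_ge0// mulr_ge0// mulr_ge0// ltW.
  have K1 : 0 < K + 1 by rewrite ltr_wpDl.
  exists (d / (K + 1)); first by rewrite divr_gt0.
  move=> p q t /andP[t0 td] _ /andP[x1 x2] /andP[y1 y2].
  exists (nm (F (pol x y)) + 1); first by rewrite addr_ge0// nm_ge0.
  move=> r s /andP[r1 r2] /andP[s1 s2].
  have hn : nm (pol r s - pol x y) < d.
    apply: le_lt_trans (nm_polB _ _ _ x0) _.
    have a1 : `|r - x| <= t * (b - a) by rewrite ler_norml; apply/andP; split; lra.
    have a2 : `|s - y| <= t * (2 * pi) by rewrite ler_norml; apply/andP; split; lra.
    have : t * K < d.
      move: td; rewrite ltr_pdivlMr//; apply: le_lt_trans.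
      by apply: ler_wpM2l; [exact: ltW|rewrite lerDl].
    apply: le_lt_trans; rewrite /K mulrDr lerD//.
    have -> : t * (x * (2 * (2 * pi))) = x * (2 * (t * (2 * pi))) by ring.
    by rewrite ler_wpM2l// ler_wpM2l.
  have := hd _ hn => /ltW; rewrite -(lerD2l (nm (F (pol x y)))); apply: le_trans.
  have := nmD (F (pol x y)) (F (pol r s) - F (pol x y)); by rewrite subrKC.
- move=> p q t t0 _ [M1 M10 h1] [M2 M20 h2] [M3 M30 h3] [M4 M40 h4].
  exists (M1 + M2 + M3 + M4); first by rewrite !addr_ge0.
  move=> r s /andP[r1 r2] /andP[s1 s2].
  have EA : p + t * (b - a) = p + t / 2 * (b - a) + t / 2 * (b - a) by field.
  have EB : q + t * (2 * pi) = q + t / 2 * (2 * pi) + t / 2 * (2 * pi) by field.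
  rewrite EA in r2; rewrite EB in s2.
  have [c|c] := leP r (p + t / 2 * (b - a)); have [c'|c'] := leP s (q + t / 2 * (2 * pi)).
  + by have := h1 r s; rewrite r1 s1 c c' => /(_ isT isT); lra.
  + by have := h3 r s; rewrite r1 s2 c (ltW c') => /(_ isT isT); lra.
  + by have := h2 r s; rewrite r2 s1 (ltW c) c' => /(_ isT isT); lra.
  + by have := h4 r s; rewrite r2 s2 (ltW c) (ltW c') => /(_ isT isT); lra.
Qed.

Lemma rint_param_cts (f : R -> R -> R) (a b u v M : R) :
  (forall x, u < x < v -> cts_on a b (f x)) ->
  (forall x y, u < x < v -> a <= y <= b -> {for x, continuous (f ^~ y)}) ->
  (forall x y, u < x < v -> a <= y <= b -> `|f x y| <= M) ->
  forall x, u < x < v -> {for x, continuous (fun x => rint a b (f x))}.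
Proof.
move=> h1 h2 h3 x xuv.
have := @continuity_under_integral R _ (measurableTypeR R) mu f `[a, b]
  (measurable_itv _) u v _ _ (fun=> M) _ _ x.
apply.
- by move=> y /=; rewrite in_itv => yuv; apply: cts_integrable; exact: h1.
- apply: aeW => y /=; rewrite in_itv /= => yab z; rewrite inE /= in_itv /= => zuv.
  exact: h2.
- by apply: cts_integrable; exact: cts_cst.
- move=> y; rewrite /= in_itv /= => yuv; apply: aeW => z; rewrite in_itv /= => zab.
  exact: h3.
- by rewrite inE /= in_itv.
Qed.

(** Continuity under the integral sign, dominated by the bound of [annulus_bounded]. *)
Lemma mean_cts (F : C -> C) (a b r : R) : 0 <= a -> a < r < b ->
  (forall z, a <= nm z <= b -> ccts F z) -> clim (nbhs r) (mean F) (mean F r).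
Proof.
move=> a0 arb hF; have ab : a <= b by case/andP: arb => /ltW h /ltW; exact: le_trans.
have [M M0 hM] := annulus_bounded a0 ab hF.
have in_ann (x : R) t : a < x < b -> a <= nm (pol x t) <= b.
  move=> /andP[ax xb]; rewrite nm_pol; first by rewrite !ltW.
  by apply: le_trans a0 _; exact: ltW.
have hx x : a < x < b -> ccts_on 0 (2 * pi) (fun t => F (pol x t)).
  by move=> xab; apply: ccts_on_comp => [|t _]; [exact: pol_cts_t|apply/hF/in_ann].
have hy x t : a < x < b -> clim (nbhs x) (fun x => F (pol x t)) (F (pol x t)).
  move=> xab; have h : ccts_on x x (fun x => F (pol x t)).
    apply: ccts_on_comp => [|s]; first exact: pol_cts_r.
    by rewrite -eq_le => /eqP <-; apply/hF/in_ann.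
  by apply: h; rewrite lexx.
apply: climM; first exact: clim_cst.
have E (G : R -> R) (P : R -> R) : (forall x, P x = G x) -> {for r, continuous G} ->
   P x @[x --> r] --> P r.
  by move=> PG; rewrite (funext PG).
have hR : {for r, continuous (fun x => rint 0 (2 * pi) (fun t => complex.Re (F (pol x t))))}.
  apply: (@rint_param_cts _ _ _ a b M) => //.
  - by move=> x /hx; exact: ccts_Re.
  - by move=> x y xab _; apply: (clim_ReP (hy _ _ xab)).
  - by move=> x y xab _; apply: le_trans (Re_le_nm _) _; apply/hM/in_ann.
have hI : {for r, continuous (fun x => rint 0 (2 * pi) (fun t => complex.Im (F (pol x t))))}.
  apply: (@rint_param_cts _ _ _ a b M) => //.
  - by move=> x /hx; exact: ccts_Im.
  - by move=> x y xab _; apply: (clim_ImP (hy _ _ xab)).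
  - by move=> x y xab _; apply: le_trans (Im_le_nm _) _; apply/hM/in_ann.
have cE (p q : R) : p +i* q = p%:C + 'i * q%:C :> C.
  by rewrite /real_complex_def !mulcE; congr (_ +i* _) => /=; ring.
rewrite /cint cE; under eq_fun do rewrite cE.
apply: climD; first exact: clim_real.
by apply: climM; [exact: clim_cst|exact: clim_real].
Qed.

End cauchy.

Opaque mean.

(** * Cauchy's formula *)

Section cauchy_formula.
Variable R : realType.
Local Notation C := R[i].
Local Notation nm := (@normc R).

(** The neighbourhoods of [cnb z] contain [z], so a limit along them is the value. *)
Lemma clim_self (psi : C -> C) z d : clim (cnb z) psi d -> psi z = d.
Proof.
move=> h; apply/eqP; rewrite -subr_eq0; apply/eqP; apply: nm_le_eps => e /h.
by move/cnb_self/ltW.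
Qed.

Lemma cnb_neq (z w : C) : w != z -> \forall v \near cnb w, v != z.
Proof.
rewrite -subr_eq0 -nm_gt0 => wz; exists (nm (w - z)) => // v.
by apply: contraTneq => ->; rewrite nm_distC ltxx.
Qed.

Lemma mean_cauchy_diff (h : C -> C) (c z : C) (r : R) : 0 <= r -> nm z != r ->
  (forall w, nm w = r -> ccts h w) ->
  mean (fun w => (h w - c) * (w / (w - z))) r =
  mean (fun w => h w * (w / (w - z))) r - c * mean (fun w => w / (w - z)) r.
Proof.
move=> r0 zr ch.
have ck w : nm w = r -> ccts (fun w => w / (w - z)) w.
  move=> wr; apply: hol_ccts; apply: hol_kernel.
  by apply: sub_neq0; rewrite wr.
have chk w : nm w = r -> ccts (fun w => h w * (w / (w - z))) w.
  by move=> wr; apply: ccts_mul; [exact: ch|exact: ck].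
have cck w : nm w = r -> ccts (fun w => c * (w / (w - z))) w.
  by move=> wr; apply: ccts_mul; [exact: ccts_const|exact: ck].
rewrite -(meanZ c r0 ck) -(meanB r0 chk cck).
by apply: eq_mean => // w wr; rewrite mulrBl.
Qed.

(* Crossing the circle through [z] is where continuity of the means is used. *)
Lemma cauchy_annulus (h : C -> C) (r1 r2 : R) (z : C) : 0 < r1 ->
  r1 < nm z < r2 -> (forall w, r1 <= nm w <= r2 -> hol h w) ->
  h z = mean (fun w => h w * (w / (w - z))) r2 -
        mean (fun w => h w * (w / (w - z))) r1.
Proof.
move=> r10 /andP[r1z zr2] hh.
have [d [psi hpsi psid]] : hol h z by apply: hh; rewrite !ltW.
(* The value at [z] is the limit, so [Phi] is continuous there; its holomorphy at [z] cannot be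
   invoked, since removability of singularities is derived from the present formula. *)
pose Phi w := if w == z then z * d else (h w - h z) * (w / (w - z)).
have Phi_cts_z : ccts Phi z.
  rewrite /ccts {2}/Phi eqxx.
  apply: (@clim_near _ _ _ _ (fun w => w * psi w)); last first.
    by apply: climM => //; exact: clim_id.
  apply: filterS hpsi => w E; rewrite /Phi.
  have [->|wz] := eqVneq w z; first by rewrite (clim_self psid).
  have wz' : w - z != 0 by rewrite subr_eq0.
  by rewrite E /=; field.
have Phi_hol w : r1 <= nm w <= r2 -> w != z -> hol Phi w.
  move=> wr wz; apply: (@hol_near _ (fun w => (h w - h z) * (w / (w - z)))).
    by apply: filterS (cnb_neq wz) => v vz; rewrite /Phi (negbTE vz).
  apply: holM; first by apply: holB; [exact: hh|exact: hol_cst].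
  by apply: hol_kernel; rewrite subr_eq0.
have Phi_cts w : r1 <= nm w <= r2 -> ccts Phi w.
  move=> wr; have [->//|wz] := eqVneq w z.
  by apply: hol_ccts; exact: Phi_hol.
have cm : clim (nbhs (nm z)) (mean Phi) (mean Phi (nm z)).
  by apply: (@mean_cts _ _ r1 r2) => //; [exact: ltW|rewrite r1z].
have E1 : mean Phi (nm z) = mean Phi r1.
  apply: (@clim_unique _ _ (nm z)^'- _ (mean Phi)).
    by move=> e /cm; exact: cvg_within.
  apply: (clim_near _ (clim_cst _)); near=> r.
  have rz : r < nm z by near: r; exact: nbhs_left_lt.
  have r1r : r1 < r by near: r; exact: nbhs_left_gt.
  apply: mean_hol => //; first exact: ltW.
  move=> w /andP[w1 w2]; have wz := le_lt_trans w2 rz.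
  apply: Phi_hol; first by rewrite w1 ltW// (lt_trans wz).
  by apply: contraTneq wz => ->; rewrite ltxx.
have E2 : mean Phi (nm z) = mean Phi r2.
  apply: (@clim_unique _ _ (nm z)^'+ _ (mean Phi)).
    by move=> e /cm; exact: cvg_within.
  apply: (clim_near _ (clim_cst _)); near=> r.
  have zr : nm z < r by near: r; exact: nbhs_right_gt.
  have rr2 : r < r2 by near: r; exact: nbhs_right_lt.
  apply: esym; apply: mean_hol.
  - by apply: le_lt_trans (nm_ge0 z) zr.
  - exact: ltW.
  - move=> w /andP[w1 w2]; have zw := lt_le_trans zr w1.
    apply: Phi_hol; first by rewrite w2 andbT ltW// (lt_trans r1z).
    by apply: contraTneq zw => ->; rewrite ltxx.
have r20 : 0 < r2 by apply: le_lt_trans (nm_ge0 z) zr2.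
have r12 : r1 <= r2 by exact: ltW (lt_trans r1z zr2).
have ME r : 0 < r -> r1 <= r <= r2 -> nm z != r ->
    mean Phi r = mean (fun w => h w * (w / (w - z))) r -
       h z * mean (fun w => w / (w - z)) r.
  move=> r0 rr zr.
  rewrite -(mean_cauchy_diff (h z) (ltW r0) zr); last first.
    by move=> w wr; apply: hol_ccts; apply: hh; rewrite wr.
  apply: eq_mean; first exact: ltW.
  move=> w wr; rewrite /Phi ifN//.
  by rewrite -subr_eq0; apply: sub_neq0; rewrite wr.
have rr1 : r1 <= r1 <= r2 by rewrite lexx.
have rr2 : r1 <= r2 <= r2 by rewrite lexx andbT.
have E3 := ME r1 r10 rr1 (negbT (gt_eqF r1z)).
have E4 := ME r2 r20 rr2 (negbT (lt_eqF zr2)).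
rewrite (mean_kernel_in r10 r1z) mulr0 subr0 in E3.
rewrite (mean_kernel_out zr2) mulr1 in E4.
rewrite -E3 -E1 E2 E4 opprB addrC subrK.
exact: erefl.
Unshelve. all: by end_near. Qed.

(** In [cauchy_annulus] the mean over the inner circle tends to 0 with its radius because [h] is
    bounded; nothing is asked of [h] at the centre. *)
Lemma cauchy_punctured (h : C -> C) (r M : R) (z : C) : 0 < nm z < r ->
  (forall w, 0 < nm w <= r -> hol h w) ->
  (forall w, 0 < nm w <= r -> nm (h w) <= M) ->
  h z = mean (fun w => h w * (w / (w - z))) r.
Proof.
move=> /andP[z0 zr] hh hM; apply/eqP; rewrite -subr_eq0; apply/eqP.
apply: nm_le_eps => e e0.
have M0 : 0 <= M by apply: le_trans (hM z _); rewrite ?nm_ge0// z0 ltW.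
pose s := Num.min (nm z / 2) (e * nm z / (4 * (M + 1))).
have M1 : 0 < M + 1 by rewrite ltr_wpDl.
have s0 : 0 < s by rewrite lt_min !divr_gt0// ?mulr_gt0.
have sz : s <= nm z / 2 by rewrite ge_min lexx.
have se : s <= e * nm z / (4 * (M + 1)) by rewrite ge_min lexx orbT.
have szl : s < nm z by apply: le_lt_trans sz _; rewrite ltr_pdivrMr//; lra.
rewrite (@cauchy_annulus h s r z)//; first last.
- by move=> w /andP[w1 w2]; apply: hh; rewrite w2 andbT (lt_le_trans s0).
- by rewrite szl.
rewrite addrAC subrr sub0r nmN.
have hws w : nm w = s -> nm z / 2 <= nm (w - z).
  by move=> ws; rewrite nm_distC; apply: le_trans (nm_subl _ _); rewrite ws; lra.
have hs w : nm w = s -> w - z != 0.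
  by move=> /hws hw; rewrite -nm_gt0; apply: lt_le_trans hw; rewrite divr_gt0.
have sr : s <= r by rewrite ltW// (lt_trans szl).
apply: le_trans (mean_le (M := e / 2) _ _ _) _ => //.
- exact: ltW.
- move=> w ws; apply: ccts_mul.
    by apply: hol_ccts; apply: hh; rewrite ws s0.
  by apply: hol_ccts; apply: hol_kernel; exact: hs.
- move=> w ws; rewrite !normcM normcV ws.
  have h1 : nm (h w) <= M + 1.
    by apply: (@le_trans _ _ M); [apply: hM; rewrite ws s0|rewrite lerDl].
  rewrite mulrA ler_pdivrMr; last by apply: lt_le_trans (hws _ ws); rewrite divr_gt0.
  apply: (@le_trans _ _ (e / 2 * (nm z / 2))); last first.
    by rewrite ler_wpM2l ?hws// divr_ge0// ltW.
  apply: (@le_trans _ _ ((M + 1) * s)); first by rewrite ler_wpM2r// ltW.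
  move: se; rewrite ler_pdivlMr ?mulr_gt0//; lra.
- by rewrite mulrC divfK.
Qed.

Definition cauchy_int (phi : C -> C) (r : R) (p : nat) (z : C) : C :=
  mean (fun w => phi w / (w - z) ^+ p) r.

Section cauchy_int.
Variables (phi : C -> C) (r : R).
Hypothesis r0 : 0 < r.
Hypothesis phi_cts : forall w, nm w = r -> ccts phi w.

Let ckern (p : nat) z w : nm z < r -> nm w = r -> ccts (fun w => phi w / (w - z) ^+ p) w.
Proof.
move=> zr wr; apply: ccts_mul; first exact: phi_cts.
apply: ccts_inv; first by rewrite expf_neq0// sub_neq0// wr lt_eqF.
apply: climX; apply: ccts_sub; [exact: ccts_id|exact: ccts_const].
Qed.

Let phi_bound : exists2 M, 0 <= M & forall w, nm w = r -> nm (phi w) <= M.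
Proof.
have [|M M0 hM] := @annulus_bounded _ phi r r (ltW r0) (lexx r).
  by move=> w; rewrite -eq_le => /eqP wr; apply: phi_cts.
by exists M => // w wr; apply: hM; rewrite wr lexx.
Qed.

(* Differentiation under the integral sign for kernels K w v, where w runs over
   the circle: a quotient kernel Q that is Lipschitz in v suffices. *)
Let cder_mean (K Q : C -> C -> C) (z : C) (d L : R) : 0 < d ->
  (forall v, nm (v - z) < d -> forall w, nm w = r -> ccts (K ^~ v) w) ->
  (forall v, nm (v - z) < d -> forall w, nm w = r -> ccts (Q ^~ v) w) ->
  (forall v w, nm (v - z) < d -> nm w = r -> K w v = K w z + Q w v * (v - z)) ->
  (forall v w, nm (v - z) < d -> nm w = r -> nm (Q w v - Q w z) <= L * nm (v - z)) ->
  cder (fun v => mean (K ^~ v) r) z (mean (Q ^~ z) r).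
Proof.
move=> d0 cK cQ KQ QL; have zz : nm (z - z) < d by rewrite subrr normc0.
exists (fun v => mean (Q ^~ v) r).
  exists d => // v vz; rewrite mulrC -meanZ ?(ltW r0)//; last exact: cQ.
  rewrite -meanD ?(ltW r0)//; last first.
  - by move=> w wr; apply: ccts_mul; [exact: ccts_const|exact: cQ].
  - exact: cK.
  by apply: eq_mean => [|w wr]; [exact: ltW|rewrite KQ// mulrC].
have L0 : 0 < `|L| + 1 by rewrite ltr_wpDl.
apply: (@clim_squeeze _ _ _ _ _ _ (fun v => (2 * (`|L| + 1))%:C * (v - z))).
  exists d => // v vz; rewrite -meanB ?(ltW r0)//; [|exact: cQ|exact: cQ].
  have L20 : 0 <= 2 * (`|L| + 1) by rewrite mulr_ge0// ltW.
  rewrite [leRHS]normcM nm_real (ger0_norm L20).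
  rewrite -mulrA; apply: mean_le; first exact: ltW.
    by move=> w wr; apply: ccts_sub; exact: cQ.
  move=> w wr; apply: le_trans (QL _ _ vz wr) _; rewrite ler_wpM2r ?nm_ge0//.
  by rewrite (le_trans (ler_norm L))// lerDl.
rewrite -(mulr0 (2 * (`|L| + 1))%:C); apply: climM; first exact: clim_cst.
by rewrite -(subrr z); apply: climB; [exact: clim_id|exact: clim_cst].
Qed.

Let near_facts (z v w : C) : nm z < r -> nm (v - z) < (r - nm z) / 2 -> nm w = r ->
  [/\ nm v < r, w - v != 0, w - z != 0, nm (w - v)^-1 <= 2 / (r - nm z) &
     nm (w - z)^-1 <= 2 / (r - nm z)].
Proof.
move=> zr vz wr; have d0 : 0 < r - nm z by rewrite subr_gt0.
have vle : nm v <= nm z + nm (v - z).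
  by have := nmD z (v - z); rewrite subrKC.
have h1 : (r - nm z) / 2 <= nm (w - v).
  apply: le_trans (nm_subl _ _); rewrite wr; lra.
have h2 : (r - nm z) / 2 <= nm (w - z).
  apply: le_trans (nm_subl _ _); rewrite wr; lra.
have e0 : 0 < (r - nm z) / 2 by rewrite divr_gt0.
have i1 := lt_le_trans e0 h1; have i2 := lt_le_trans e0 h2.
split.
- lra.
- by rewrite -nm_gt0.
- by rewrite -nm_gt0.
- by rewrite normcV -invf_div lef_pV2 ?posrE.
- by rewrite normcV -invf_div lef_pV2 ?posrE.
Qed.

Lemma cder_cauchy_int1 z : nm z < r ->
  cder (cauchy_int phi r 1) z (cauchy_int phi r 2 z).
Proof.
move=> zr; have d0 : 0 < r - nm z by rewrite subr_gt0.
have [M M0 hM] := phi_bound; pose B := 2 / (r - nm z).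
have B0 : 0 <= B by rewrite divr_ge0// ltW.
have := @cder_mean (fun w v => phi w / (w - v) ^+ 1)
  (fun w v => phi w / ((w - v) * (w - z))) z ((r - nm z) / 2) (M * B ^+ 3).
rewrite /cauchy_int => H.
have -> : mean (fun w => phi w / (w - z) ^+ 2) r =
    mean (fun w => phi w / ((w - z) * (w - z))) r by [].
apply: H.
- by rewrite divr_gt0.
- move=> v vz w wr; have [vr _ _ _ _] := near_facts zr vz wr; exact: ckern.
- move=> v vz w wr; have [vr h1 h2 _ _] := near_facts zr vz wr.
  apply: ccts_mul; first exact: phi_cts.
  apply: ccts_inv; first by rewrite mulf_neq0.
  by apply: ccts_mul; (apply: ccts_sub; [exact: ccts_id|exact: ccts_const]).
- move=> v w vz wr; have [_ h1 h2 _ _] := near_facts zr vz wr.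
  by rewrite !expr1; field; rewrite h1 h2.
- move=> v w vz wr; have [_ h1 h2 b1 b2] := near_facts zr vz wr.
  have -> : phi w / ((w - v) * (w - z)) - phi w / ((w - z) * (w - z)) =
    phi w * ((w - v)^-1 * (w - z)^-1 ^+ 2) * (v - z) by field; rewrite h1 h2.
  rewrite normcM ler_wpM2r ?nm_ge0// normcM ler_pM ?nm_ge0 ?hM// normcM.
  rewrite [B ^+ 3]exprS ler_pM ?nm_ge0// nmX.
  by rewrite ler_pXn2r ?nnegrE ?nm_ge0.
Qed.

(** This makes the derivative of a Cauchy integral holomorphic in turn; higher derivatives are
    reached by iteration rather than by higher kernels. *)
Lemma cder_cauchy_int2 z : nm z < r ->
  cder (cauchy_int phi r 2) z (2 * cauchy_int phi r 3 z).
Proof.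
move=> zr; have d0 : 0 < r - nm z by rewrite subr_gt0.
have [M M0 hM] := phi_bound; pose B := 2 / (r - nm z).
have B0 : 0 <= B by rewrite divr_ge0// ltW.
(* The difference quotient of [(w - v) ^- 2]: with [a = (w - v)^-1] and [b = (w - z)^-1] one has
   [a - b = a * b * (v - z)], hence [a ^+ 2 - b ^+ 2 = a * b * (a + b) * (v - z)]. *)
pose Q w v := phi w * ((w - v)^-1 * (w - z)^-1 * ((w - v)^-1 + (w - z)^-1)).
have := @cder_mean (fun w v => phi w / (w - v) ^+ 2) Q z
  ((r - nm z) / 2) (M * (3 * B ^+ 4)).
rewrite /cauchy_int => H.
have zz : nm (z - z) < (r - nm z) / 2 by rewrite subrr normc0 divr_gt0.
have -> : 2 * mean (fun w => phi w / (w - z) ^+ 3) r = mean (Q ^~ z) r.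
  rewrite -meanZ ?(ltW r0)//; last by move=> w wr; exact: ckern.
  apply: eq_mean => [|w wr]; first exact: ltW.
  by rewrite /Q; have [_ h1 h2 _ _] := near_facts zr zz wr; field.
apply: H.
- by rewrite divr_gt0.
- move=> v vz w wr; have [vr _ _ _ _] := near_facts zr vz wr; exact: ckern.
- move=> v vz w wr; have [vr h1 h2 _ _] := near_facts zr vz wr.
  have ci u : w - u != 0 -> ccts (fun w => (w - u)^-1) w.
    by move=> h; apply: ccts_inv => //; apply: ccts_sub; [exact: ccts_id|exact: ccts_const].
  apply: ccts_mul; first exact: phi_cts.
  apply: ccts_mul; first by apply: ccts_mul; exact: ci.
  by apply: ccts_add; exact: ci.
- move=> v w vz wr; have [_ h1 h2 _ _] := near_facts zr vz wr.
  by rewrite /Q; field; rewrite h1 h2.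
- move=> v w vz wr; have [_ h1 h2 b1 b2] := near_facts zr vz wr.
  pose a := (w - v)^-1; pose b := (w - z)^-1.
  have -> : Q w v - Q w z = phi w * (a * b ^+ 2 * (a + 2 * b)) * (v - z).
    by rewrite /Q /a /b; field; rewrite h1 h2.
  have b3 : nm (a + 2 * b) <= 3 * B.
    apply: le_trans (nmD _ _) _; rewrite normcM.
    have -> : nm (2 : C) = 2 by have := nm_real (2 : R); rewrite rmorph_nat => ->; rewrite ger0_norm.
    move: b1 b2; rewrite -/a -/b -/B; lra.
  have -> : 3 * B ^+ 4 = B * B ^+ 2 * (3 * B) by ring.
  rewrite normcM ler_wpM2r ?nm_ge0// normcM ler_pM ?nm_ge0 ?hM// normcM.
  rewrite ler_pM ?nm_ge0// normcM ler_pM ?nm_ge0// nmX.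
  by rewrite ler_pXn2r ?nnegrE ?nm_ge0.
Qed.
End cauchy_int.

End cauchy_formula.

(** * Removable singularities, Cauchy estimates, order of a zero *)

Section local_theory.
Variable R : realType.
Local Notation C := R[i].
Local Notation nm := (@normc R).

Lemma near_point (a : C) (e : R) : 0 < e -> exists2 w, w != a & nm (w - a) < e.
Proof.
move=> e0; exists (a + (e / 2)%:C); last first.
  rewrite addrC addKr nm_real ger0_norm; lra.
by rewrite -subr_eq0 addrC addKr -nm_gt0 nm_real gtr0_norm divr_gt0.
Qed.

Lemma ccts_eq (F G : C -> C) a : (\forall w \near cnb a, w != a -> F w = G w) ->
  ccts F a -> ccts G a -> F a = G a.
Proof.
move=> FG hF hG; apply/eqP; rewrite -subr_eq0; apply/eqP; apply: nm_le_eps => e e0.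
have e2 : 0 < e / 2 by rewrite divr_gt0.
have [d d0 hd] := filterI FG (filterI (hF _ e2) (hG _ e2)).
have [w wa /hd[/(_ wa) E [h1 h2]]] := near_point a d0.
apply: le_trans (nm_distD (F w) _ _) _; rewrite nm_distC {2}E; lra.
Qed.

Lemma cder_unique (F : C -> C) a d e : cder F a d -> cder F a e -> d = e.
Proof.
move=> [psi h hp] [phi k kp].
rewrite -(clim_self hp) -(clim_self kp); apply: ccts_eq.
- apply: filterS2 h k => w; rewrite /= => -> /addrI E wa.
  by apply: (@mulIf _ (w - a)); rewrite ?subr_eq0// E.
- by rewrite /ccts (clim_self hp).
- by rewrite /ccts (clim_self kp).
Qed.

(** A total operator, so that it can be iterated; the value is 0 where [F] is not differentiable. *)
Definition dc (F : C -> C) (z : C) : C := xget 0 [set d | cder F z d].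

Lemma dcP F z : hol F z -> cder F z (dc F z).
Proof. by move=> [d h]; exact: (@xgetPex _ 0 [set d | cder F z d] (ex_intro _ d h)). Qed.

Lemma dcE F z d : cder F z d -> dc F z = d.
Proof. by move=> h; apply: (cder_unique _ h); apply: dcP; exists d. Qed.

Lemma hol_shift F (a z : C) : hol F (a + z) -> hol (fun u => F (a + u)) z.
Proof.
by move=> h; apply: (hol_comp (F := fun u => a + u)) => //; apply: holD;
  [exact: hol_cst|exact: hol_id].
Qed.

Lemma hol_unshift F (a z : C) : hol F (z - a) -> hol (fun u => F (u - a)) z.
Proof.
by move=> h; apply: (hol_comp (F := fun u => u - a)) => //; apply: holB;
  [exact: hol_id|exact: hol_cst].
Qed.

(** The factor [u] compensates the division by [u] hidden in [mean], so that [cauchy_int] of this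
    density is the usual Cauchy integral around [a]. *)
Definition ckernel (h : C -> C) (a : C) (u : C) := h (a + u) * u.

Lemma ckernel_cts h (a : C) r : (forall w, nm (w - a) = r -> hol h w) ->
  forall u, nm u = r -> ccts (ckernel h a) u.
Proof.
move=> hh u ur; apply: ccts_mul; last exact: ccts_id.
by apply: hol_ccts; apply: hol_shift; apply: hh; rewrite addrC addKr.
Qed.

Lemma cauchy_int_punctured h (a : C) (r M : R) w : 0 < nm (w - a) < r ->
  (forall w, 0 < nm (w - a) <= r -> hol h w) ->
  (forall w, 0 < nm (w - a) <= r -> nm (h w) <= M) ->
  h w = cauchy_int (ckernel h a) r 1 (w - a).
Proof.
move=> wr hh hM.
have E u : a + u - a = u by rewrite addrC addKr.
have := @cauchy_punctured R (fun u => h (a + u)) r M (w - a) wr.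
rewrite subrKC => -> //.
- rewrite /cauchy_int; apply: eq_mean.
    by case/andP: wr => h1 h2; rewrite ltW// (lt_trans h1).
  by move=> u _; rewrite expr1 /ckernel mulrA.
- by move=> u ur; apply: hol_shift; apply: hh; rewrite E.
- by move=> u ur; apply: hM; rewrite E.
Qed.

Lemma hol_cauchy_int (phi : C -> C) r (a z : C) : 0 < r ->
  (forall w, nm w = r -> ccts phi w) -> nm (z - a) < r ->
  cder (fun w => cauchy_int phi r 1 (w - a)) z (cauchy_int phi r 2 (z - a)).
Proof.
move=> r0 hp zr.
have h1 := cder_cauchy_int1 r0 hp zr.
have h2 : cder (fun w => w - a) z 1.
  by have := cderB (cder_id z) (cder_cst a z); rewrite subr0.
by have := cder_comp h2 h1; rewrite mulr1.
Qed.

Lemma hol_cauchy_int2 (phi : C -> C) r (a z : C) : 0 < r ->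
  (forall w, nm w = r -> ccts phi w) -> nm (z - a) < r ->
  hol (fun w => cauchy_int phi r 2 (w - a)) z.
Proof.
move=> r0 hp zr; apply: hol_unshift; eexists; exact: cder_cauchy_int2.
Qed.

(** The extension is the Cauchy integral of [h], which represents [h] off [a] by [cauchy_punctured]
    and is differentiable at [a] as well. *)
Lemma removable_singularity h (a : C) (s M : R) : 0 < s ->
  (forall w, 0 < nm (w - a) < s -> hol h w) ->
  (forall w, 0 < nm (w - a) < s -> nm (h w) <= M) ->
  exists2 H, forall w, w != a -> H w = h w &
    forall w, nm (w - a) < s -> hol H w.
Proof.
move=> s0 hh hM; pose r := s / 2.
have r0 : 0 < r by rewrite divr_gt0.
have rs : r < s by rewrite /r; lra.
pose H w := if w == a then cauchy_int (ckernel h a) r 1 (w - a) else h w.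
have HE w : w != a -> H w = h w by rewrite /H => /negbTE ->.
exists H => // w ws; have [->|wa] := eqVneq w a; last first.
  apply: (@hol_near _ h); first by apply: filterS (cnb_neq wa) => v /HE.
  by apply: hh; rewrite nm_gt0 subr_eq0 wa.
apply: (@hol_near _ (fun w => cauchy_int (ckernel h a) r 1 (w - a))).
  exists r => // v vr; have [->|va] := eqVneq v a; first by rewrite /H eqxx.
  rewrite HE//; symmetry; apply: (@cauchy_int_punctured _ _ _ M).
  - by rewrite nm_gt0 subr_eq0 va.
  - by move=> u /andP[u1 u2]; apply: hh; rewrite u1 (le_lt_trans u2).
  - by move=> u /andP[u1 u2]; apply: hM; rewrite u1 (le_lt_trans u2).
eexists; apply: hol_cauchy_int => //; last by rewrite subrr normc0.
by apply: ckernel_cts => u ur; apply: hh; rewrite ur r0.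
Qed.

(** Continuity at [a] gives boundedness nearby, hence a holomorphic extension, and forces the
    extension to take the value [h a]. *)
Lemma hol_of_ccts h (a : C) : (\forall w \near cnb a, w != a -> hol h w) ->
  ccts h a -> hol h a.
Proof.
move=> hh hc; have [s s0 hs] := filterI hh (hc _ ltr01).
have gt0 w : 0 < nm (w - a) -> w != a by rewrite nm_gt0 subr_eq0.
have [||H HE Hh] := @removable_singularity h a s (nm (h a) + 1) s0.
- by move=> w /andP[/gt0 w1 /hs[+ _]]; exact.
- move=> w /andP[_ /hs[_ /ltW]]; have := nmD (h a) (h w - h a).
  rewrite subrKC; lra.
have Ha : hol H a by apply: Hh; rewrite subrr normc0.
apply: hol_near Ha; exists s => // w _; have [->|/HE//] := eqVneq w a.
apply: ccts_eq => //; last by apply: hol_ccts; apply: Hh; rewrite subrr normc0.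
by exists s => // v _ /HE.
Qed.

Lemma cauchy_repr h (a : C) r : 0 < r -> (forall w, nm (w - a) <= r -> hol h w) ->
  forall w, nm (w - a) < r -> h w = cauchy_int (ckernel h a) r 1 (w - a).
Proof.
move=> r0 hh.
have cb : exists2 M, 0 <= M & forall w, nm (w - a) <= r -> nm (h w) <= M.
  have [|M M0 hM] := @annulus_bounded R (fun u => h (a + u)) 0 r (lexx 0) (ltW r0).
    move=> z /andP[_ zr]; apply: hol_ccts; apply: hol_shift; apply: hh.
    by rewrite addrC addKr.
  exists M => // w wr; have := hM (w - a); rewrite subrKC; apply.
  by rewrite nm_ge0.
have [M M0 hM] := cb.
have punct w : 0 < nm (w - a) < r -> h w = cauchy_int (ckernel h a) r 1 (w - a).
  move=> wr; apply: (@cauchy_int_punctured _ _ _ M) => //.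
  - by move=> u /andP[_]; exact: hh.
  - by move=> u /andP[_]; exact: hM.
move=> w wr; have [->|wa] := eqVneq w a; last first.
  by apply: punct; rewrite nm_gt0 subr_eq0 wa.
apply: (@ccts_eq h (fun w => cauchy_int (ckernel h a) r 1 (w - a))).
- exists r => // v vr va; apply: punct; by rewrite nm_gt0 subr_eq0 va.
- by apply: hol_ccts; apply: hh; rewrite subrr normc0 ltW.
- apply: hol_ccts; eexists; apply: hol_cauchy_int => //; last by rewrite subrr normc0.
  by apply: ckernel_cts => u ur; apply: hh; rewrite ur.
Qed.

Lemma cauchy_repr_dc h (a : C) r : 0 < r -> (forall w, nm (w - a) <= r -> hol h w) ->
  forall w, nm (w - a) < r -> dc h w = cauchy_int (ckernel h a) r 2 (w - a).
Proof.
move=> r0 hh w wr; apply: dcE.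
apply: (@cder_near _ (fun w => cauchy_int (ckernel h a) r 1 (w - a))).
  exists (r - nm (w - a)); first by rewrite subr_gt0.
  move=> v vw; symmetry; apply: cauchy_repr => //.
  by apply: le_lt_trans (nm_distD w _ _) _; rewrite -ltrBrDr.
apply: hol_cauchy_int => //.
by apply: ckernel_cts => u ur; apply: hh; rewrite ur.
Qed.

(** Near [a] the derivative is a Cauchy integral with exponent 2, which is itself differentiable. *)
Lemma hol_dc h (a : C) : (\forall w \near cnb a, hol h w) -> hol (dc h) a.
Proof.
move=> [s s0 hs]; have s20 : 0 < s / 2 by rewrite divr_gt0.
have hh w : nm (w - a) <= s / 2 -> hol h w by move=> w2; apply: hs; lra.
apply: (@hol_near _ (fun w => cauchy_int (ckernel h a) (s / 2) 2 (w - a))).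
  by exists (s / 2) => // w w2; rewrite (cauchy_repr_dc _ hh).
apply: hol_cauchy_int2 => //; last by rewrite subrr normc0.
by apply: ckernel_cts => u ur; apply: hh; rewrite ur.
Qed.

Lemma cauchy_estimate h (a : C) r M : 0 < r ->
  (forall w, nm (w - a) <= r -> hol h w) ->
  (forall w, nm (w - a) <= r -> nm (h w) <= M) -> nm (dc h a) <= 2 / r * M.
Proof.
move=> r0 hh hM; rewrite (cauchy_repr_dc r0 hh) ?subrr ?normc0//.
have E u : a + u - a = u by rewrite addrC addKr.
have -> : 2 / r * M = 2 * (M / r) by ring.
apply: mean_le; first exact: ltW.
  move=> w wr; apply: ccts_mul.
    by apply: (@ckernel_cts _ _ r) => // u ur; apply: hh; rewrite ur.
  apply: ccts_inv; first by rewrite subr0 expf_neq0// -nm_gt0 wr.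
  by apply: climX; apply: ccts_sub; [exact: ccts_id|exact: ccts_const].
move=> w wr; have w0 : w != 0 by rewrite -nm_gt0 wr.
rewrite /ckernel subr0 expr2 invfM mulrA mulfK// normcM normcV wr.
by rewrite ler_wpM2r ?invr_ge0 ?(ltW r0)//; apply: hM; rewrite E wr.
Qed.

(** Each differentiation spends a margin [s] of the radius and costs a factor [2 / s]. *)
Lemma cauchy_estimate_iter h (a : C) j (rho s M : R) : 0 <= rho -> 0 < s ->
  (forall w, nm (w - a) <= rho + j%:R * s -> \forall v \near cnb w, hol h v) ->
  (forall w, nm (w - a) <= rho + j%:R * s -> nm (h w) <= M) ->
  forall w, nm (w - a) <= rho ->
   (\forall v \near cnb w, hol (iter j dc h) v) /\
   nm (iter j dc h w) <= (2 / s) ^+ j * M.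
Proof.
elim: j rho => [|j ih] rho rho0 s0 hh hM w wr.
  by rewrite /= expr0 mul1r; split; [apply: hh|apply: hM]; rewrite mul0r addr0.
have E : rho + j.+1%:R * s = rho + s + j%:R * s by rewrite -natr1; ring.
rewrite E in hh hM.
have {}ih := ih (rho + s) (addr_ge0 rho0 (ltW s0)) s0 hh hM.
have in_big v : nm (v - w) <= s -> nm (v - a) <= rho + s.
  by move=> vw; apply: le_trans (nm_distD w _ _) _; rewrite addrC lerD.
split.
  rewrite /=; exists s => // v vw; apply: hol_dc.
  by have [+ _] := ih v (in_big v (ltW vw)).
rewrite /= exprS -mulrA; apply: cauchy_estimate => //.
- by move=> v vw; have [hv _] := ih v (in_big v vw); exact: cnb_self hv.
- by move=> v vw; have [_] := ih v (in_big v vw).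
Qed.

(** The quotient, with the derivative of [g] as its value at [a], is Caratheodory's slope function:
    it is continuous at [a], so [hol_of_ccts] applies. *)
Lemma hol_divide g (a : C) s : 0 < s -> (forall w, nm (w - a) < s -> hol g w) ->
  g a = 0 -> exists2 g1, forall w, nm (w - a) < s -> hol g1 w &
    forall w, nm (w - a) < s -> g w = (w - a) * g1 w.
Proof.
move=> s0 hg ga; have [d [psi hpsi psid]] : hol g a by apply: hg; rewrite subrr normc0.
pose g1 w := if w == a then d else g w / (w - a).
have g1E w : w != a -> g1 w = g w / (w - a) by rewrite /g1 => /negbTE ->.
have g1h w : nm (w - a) < s -> w != a -> hol g1 w.
  move=> ws wa; apply: (@hol_near _ (fun w => g w / (w - a))).
    by apply: filterS (cnb_neq wa) => v /g1E.
  apply: hol_div; [by rewrite subr_eq0|exact: hg|].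
  by apply: holB; [exact: hol_id|exact: hol_cst].
exists g1; last first.
  move=> w ws; have [->|wa] := eqVneq w a; first by rewrite ga subrr mul0r.
  by rewrite g1E// mulrC divfK// subr_eq0.
move=> w ws; have [->|wa] := eqVneq w a; last exact: g1h.
apply: hol_of_ccts; first by exists s => // v vs; exact: g1h.
rewrite /ccts {2}/g1 eqxx; apply: (clim_near _ psid).
apply: filterS hpsi => v E; rewrite /g1; have [->|va] := eqVneq v a.
  exact: clim_self psid.
by rewrite E ga add0r mulfK// subr_eq0.
Qed.

(** Factors [w - a] are divided out as long as possible, without power series. If this never stops,
    then [h] is divisible by every power, and Cauchy's formula for the cofactors forces [h] to
    vanish near [a]. *)
Lemma hol_zero_order h (a : C) : (\forall w \near cnb a, hol h w) ->
  (\forall w \near cnb a, h w = 0) \/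
  exists m g, [/\ \forall w \near cnb a, hol g w, g a != 0 &
    \forall w \near cnb a, h w = (w - a) ^+ m * g w].
Proof.
move=> [s s0 hs].
pose D m := exists2 g, forall w, nm (w - a) < s -> hol g w &
    forall w, nm (w - a) < s -> h w = (w - a) ^+ m * g w.
have D0 : D 0%N by exists h => // w _; rewrite expr0 mul1r.
have [Dall|/existsNP[n nDn]] := pselect (forall m, D m); last first.
  right; have [m [Dm nDS]] : exists m, D m /\ ~ D m.+1.
    elim: n nDn => [//|n ih] nDS; have [Dn|/ih//] := pselect (D n).
    by exists n.
  have [g gh gE] := Dm; exists m, g; split.
  - by exists s.
  - apply/eqP => ga; apply: nDS; have [g1 g1h g1E] := hol_divide s0 gh ga.
    exists g1 => // w ws; rewrite gE// g1E// exprSr; ring.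
  - by exists s.
left; pose r := s / 2; have r0 : 0 < r by rewrite divr_gt0.
have rs : r < s by rewrite /r; lra.
have [|M M0 hM] := @annulus_bounded R (fun u => h (a + u)) 0 r (lexx 0) (ltW r0).
  move=> z /andP[_ zr]; apply: hol_ccts; apply: hol_shift; apply: hs.
  by rewrite addrC addKr (le_lt_trans zr).
exists (r / 2); first by rewrite divr_gt0.
move=> w wr2; apply: nm_le_eps => e e0.
have M1 : 0 < 4 * M + 1 by rewrite ltr_wpDl// mulr_ge0.
have [m me] : exists m, 2^-1 ^+ m < e / (4 * M + 1) by apply: exists_half_lt; rewrite divr_gt0.
have [g gh gE] := Dall m.
have wr : nm (w - a) < r by apply: lt_trans wr2 _; lra.
(* On the circle of radius [r] the cofactor is at most [M / r ^+ m]. Since [w] is within [r / 2] of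
   [a], this yields a bound [4 * M * 2^-1 ^+ m] on [h w]. *)
have gb : nm (g w) <= 2 * (M / r ^+ m * 2).
  rewrite (@cauchy_repr g a r r0) //; last by move=> v vr; apply: gh; exact: le_lt_trans rs.
  apply: mean_le; first exact: ltW.
    move=> u ur; apply: ccts_mul.
      by apply: (@ckernel_cts _ _ r) => // v vr; apply: gh; rewrite vr.
    rewrite /= ; apply: ccts_inv.
      by rewrite expr1; apply: sub_neq0; rewrite ur lt_eqF.
    by apply: climX; apply: ccts_sub; [exact: ccts_id|exact: ccts_const].
  move=> u ur; rewrite expr1 /ckernel !normcM normcV ur -mulrA.
  have E : a + u - a = u by rewrite addrC addKr.
  have b1 : nm (g (a + u)) <= M / r ^+ m.
    have E2 : h (a + u) = u ^+ m * g (a + u).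
      by rewrite gE; [rewrite E|rewrite E ur].
    rewrite ler_pdivlMr ?exprn_gt0// mulrC.
    by have := hM u; rewrite E2 normcM nmX ur lexx (ltW r0); exact.
  have b2 : r / 2 <= nm (u - (w - a)).
    by apply: le_trans (nm_subl _ _); rewrite ur; lra.
  rewrite ler_pM ?nm_ge0//; first by rewrite divr_ge0 ?nm_ge0// ltW.
  rewrite ler_pdivrMr; last by apply: lt_le_trans b2; rewrite divr_gt0.
  lra.
rewrite gE ?(lt_trans wr)// normcM nmX.
apply: (@le_trans _ _ ((r / 2) ^+ m * (2 * (M / r ^+ m * 2)))).
  by rewrite ler_pM ?exprn_ge0 ?nm_ge0// lerXn2r ?nnegrE ?nm_ge0 ?ltW// divr_gt0.
have -> : (r / 2) ^+ m * (2 * (M / r ^+ m * 2)) = 4 * M * 2^-1 ^+ m.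
  rewrite exprMn; have rm : r ^+ m != 0 by rewrite expf_neq0// gt_eqF.
  by field.
have h0 : 0 < 2^-1 ^+ m :> R by rewrite exprn_gt0// invr_gt0.
move: me; rewrite ltr_pdivlMr// => me.
by apply: le_trans (ltW me); rewrite mulrC ler_wpM2l ?(ltW h0)// lerDl.
Qed.

End local_theory.

(** * Local form of meromorphic functions *)

Section meromorphic.
Variable R : realType.
Local Notation C := R[i].
Local Notation nm := (@normc R).

Definition hol_near_at (F : C -> C) (a : C) := \forall w \near cnb a, hol F w.

Lemma cnb_near (P : set C) a : cnb a P -> \forall w \near cnb a, cnb w P.
Proof.
move=> [d d0 h]; exists d => // w wd; exists (d - nm (w - a)); first by rewrite subr_gt0.
move=> v vw; apply: h; apply: le_lt_trans (nm_distD w _ _) _.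
by rewrite -ltrBrDr.
Qed.

Lemma hol_near_near F a : hol_near_at F a -> \forall w \near cnb a, hol_near_at F w.
Proof. exact: cnb_near. Qed.

Lemma hol_near_hol F a : hol_near_at F a -> hol F a.
Proof. exact: cnb_self. Qed.

Lemma hol_near_neq0 F a : hol_near_at F a -> F a != 0 ->
  \forall w \near cnb a, F w != 0.
Proof.
move=> /hol_near_hol /hol_ccts h Fa; have := h _; rewrite -nm_gt0 in Fa.
move=> /(_ _ Fa); apply: filterS => w; apply: contraTneq => ->.
by rewrite sub0r nmN ltxx.
Qed.

(** [F] has order [m] at [a], negative at a pole. The point [a] is left out because the value of [F]
    at a pole is arbitrary. *)
Definition mform (F : C -> C) (a : C) (m : int) := exists g, [/\ hol_near_at g a,
  g a != 0 & \forall w \near cnb a, w != a -> F w = (w - a) ^ m * g w].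

Lemma mformM F G a m n : mform F a m -> mform G a n ->
  mform (fun w => F w * G w) a (m + n).
Proof.
move=> [g [g1 g2 g3]] [h [h1 h2 h3]]; exists (fun w => g w * h w); split.
- by apply: filterS2 g1 h1 => w; exact: holM.
- exact: mulf_neq0.
- apply: filterS2 g3 h3 => w E1 E2 wa; rewrite E1// E2//.
  by rewrite expfzDr ?subr_eq0//; ring.
Qed.

Lemma mformV F a m : mform F a m -> mform (fun w => (F w)^-1) a (- m).
Proof.
move=> [g [g1 g2 g3]]; have g4 := hol_near_neq0 g1 g2.
exists (fun w => (g w)^-1); split.
- by apply: filterS2 g1 g4 => w h h0; exact: holV.
- by rewrite invr_eq0.
- by apply: filterS g3 => w E wa; rewrite E// invfM invr_expz.
Qed.

Lemma mform_hol F a : hol_near_at F a -> F a != 0 -> mform F a 0.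
Proof.
move=> h h0; exists F; split => //.
by apply: nearW => w _; rewrite expr0z mul1r.
Qed.

Lemma mform_near F G a m : (\forall w \near cnb a, w != a -> F w = G w) ->
  mform F a m -> mform G a m.
Proof.
move=> FG [g [g1 g2 g3]]; exists g; split => //.
by apply: filterS2 FG g3 => w E1 E2 wa; rewrite -E1// E2.
Qed.

Lemma mform_subX (a b : C) (n : int) :
  mform (fun w => (w - b) ^ n) a (if a == b then n else 0).
Proof.
have h1 c : hol_near_at (fun w => w - c) a.
  by apply: nearW => w; apply: holB; [exact: hol_id|exact: hol_cst].
have [->|ab] := eqVneq a b.
  exists (fun=> 1); split; [|exact: oner_neq0|].
    by apply: nearW => w; exact: hol_cst.
  by apply: nearW => w _; rewrite mulr1.
have pos (k : nat) : mform (fun w => (w - b) ^+ k) a 0.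
  apply: mform_hol; last by rewrite expf_neq0// subr_eq0.
  by apply: filterS (h1 b) => w; exact: holX.
case: n => n; first exact: pos.
by have := mformV (pos n.+1); rewrite oppr0.
Qed.

Lemma mform_prod (s : seq C) (n : C -> int) a : uniq s ->
  mform (fun w => \prod_(b <- s) (w - b) ^ n b) a (if a \in s then n a else 0).
Proof.
elim: s => [_|b s ih /= /andP[bs us]].
  under eq_fun do rewrite big_nil.
  rewrite in_nil; apply: mform_hol; [apply: nearW => w; exact: hol_cst|exact: (oner_neq0 C)].
under eq_fun do rewrite big_cons.
have := mformM (mform_subX a b (n b)) (ih us); congr mform.
rewrite inE; case: eqVneq => [->|ab] /=; first by rewrite (negbTE bs) addr0.
by rewrite add0r.
Qed.

Lemma clim_lim_X (a : C) (k : nat) (g : C -> C) : (0 < k)%N -> ccts g a ->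
  clim (cnb a) (fun w => (w - a) ^+ k * g w) 0.
Proof.
move=> k0 hg; rewrite -(mul0r (g a)); apply: climM => //.
have -> : (0 : C) = (a - a) ^+ k by rewrite subrr expr0n; case: k k0.
by apply: climX; apply: climB; [exact: clim_id|exact: clim_cst].
Qed.

(** If [m < n], cancelling [(w - a) ^ m] leaves [g = (w - a) ^+ k * h] with [k > 0] off [a], and
    continuity gives [g a = 0]. *)
Lemma mform_unique F a m n : mform F a m -> mform F a n -> m = n.
Proof.
wlog mn : m n / m <= n.
  move=> W; case: (leP m n) => [|/ltW] mn h1 h2; first exact: W.
  by apply/esym; exact: W.
move=> [g [g1 g2 g3]] [h [h1 h2 h3]].
have [->//|mn'] := eqVneq m n; exfalso.
have nm0 : 0 <= n - m by rewrite subr_ge0.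
pose k := `|n - m|%N; have kE : n = m + k%:Z by rewrite /k gez0_abs// subrKC.
have k0 : (0 < k)%N.
  by rewrite lt0n; apply: contra_neq mn' => k0; rewrite kE k0 addr0.
have ch := hol_ccts (hol_near_hol h1).
have : g a = 0.
  rewrite -(clim_self (clim_lim_X k0 ch)).
  apply: (@ccts_eq _ g (fun w => (w - a) ^+ k * h w)).
  - apply: filterS2 g3 h3 => w E1 E2 wa.
    have wa' : w - a != 0 by rewrite subr_eq0.
    have : (w - a) ^ m * g w = (w - a) ^ m * ((w - a) ^+ k * h w).
      rewrite -(E1 wa) (E2 wa) kE expfzDr//; exact: esym (mulrA _ _ _).
    by apply: mulfI; rewrite expfz_neq0.
  - exact: hol_ccts (hol_near_hol g1).
  - by rewrite /ccts (clim_self (clim_lim_X k0 ch)); exact: clim_lim_X.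
by move/eqP; rewrite (negbTE g2).
Qed.

(** This is the isolatedness of zeros and poles. *)
Lemma mform_off F a m : mform F a m ->
  \forall w \near cnb a, w != a -> mform F w 0.
Proof.
move=> [g [g1 g2 g3]].
have g4 := hol_near_neq0 g1 g2.
have g5 := cnb_near g3; have g6 := hol_near_near g1.
apply: filterS3 g4 g5 g6 => w gw E hg wa.
pose P w := (w - a) ^ m * g w.
have := mformM (mform_subX w a m) (mform_hol hg gw).
rewrite (negbTE wa) addr0; apply: mform_near.
by apply: filterS2 E (cnb_neq wa) => v Ev va _; rewrite Ev.
Qed.

(** The local regularisations of [F] agree by continuity, so their values are unique and a pointwise
    choice glues them into a single function. *)
Lemma mform0_regular F (D : set C) : (forall z, D z -> mform F z 0) ->
  exists G, forall z, D z -> [/\ hol_near_at G z, G z != 0 &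
    \forall w \near cnb z, w != z -> F w = G w].
Proof.
move=> hD.
pose wit z v := exists g, [/\ hol_near_at g z, g z = v &
    \forall w \near cnb z, w != z -> F w = g w].
have wit_unique z v1 v2 : wit z v1 -> wit z v2 -> v1 = v2.
  move=> [g [g1 <- g3]] [h [h1 <- h3]]; apply: ccts_eq.
  - by apply: filterS2 g3 h3 => w E1 E2 wz; rewrite -E1// -E2.
  - exact: hol_ccts (hol_near_hol g1).
  - exact: hol_ccts (hol_near_hol h1).
pose G z := xget 0 [set v | wit z v].
have GE z v : wit z v -> G z = v.
  by move=> wv; apply: (wit_unique z) => //; exact: (@xgetPex _ 0 [set v | wit z v] (ex_intro _ v wv)).
exists G => z /hD [g [g1 g2 g3]].
have g3' : \forall w \near cnb z, w != z -> F w = g w.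
  by apply: filterS g3 => w E wz; rewrite E// expr0z mul1r.
have Gg : \forall w \near cnb z, G w = g w.
  apply: filterS2 (cnb_near g3') (hol_near_near g1) => w E hg.
  apply: GE; exists g; split => //.
  have [->|wz] := eqVneq w z; first exact: g3'.
  by apply: filterS2 E (cnb_neq wz) => v Ev vz _; exact: Ev.
split.
- by apply: filterS2 (cnb_near Gg) g1 => w E; apply: hol_near; apply: filterS E => v ->.
- by rewrite (cnb_self Gg).
- by apply: filterS2 Gg g3' => w -> E.
Qed.

(** Bisection for properties of sets. Only unions of overlapping sets are required to preserve [P],
    so that connectedness arguments are covered along with compactness. *)
Lemma annulus_induction (P : set C -> Prop) (r1 r2 : R) : 0 <= r1 -> r1 <= r2 ->
  (forall A B, A `<=` B -> P B -> P A) ->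
  (forall A B, (A `&` B) !=set0 -> P A -> P B -> P (A `|` B)) ->
  (forall z, r1 <= nm z <= r2 -> exists2 e : R, 0 < e & P [set w | nm (w - z) < e]) ->
  P [set z | r1 <= nm z <= r2].
Proof.
move=> r10 r12 Psub Pcup Ploc; have ba : 0 <= r2 - r1 by rewrite subr_ge0.
have p0 := pi2_gt0 R.
pose cell (p q t : R) : set C := [set z | exists r s, [/\
  p <= r <= p + t * (r2 - r1), q <= s <= q + t * (2 * pi) & z = pol r s]].
have := @rectangle_induction R r1 0 (r2 - r1) (2 * pi) (fun p q t => P (cell p q t))
  ba (ltW p0).
rewrite /= !add0r subrKC => H.
apply: (Psub _ (cell r1 0 1)).
  move=> z /= zr; have [t tt zE] := polar_form z; exists (nm z), t.
  by rewrite !mul1r add0r subrKC.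
apply: H.
- move=> p q t t0 _ h1 h2 h3 h4.
  have hA : 0 <= t / 2 * (r2 - r1) by rewrite mulr_ge0// divr_ge0// ltW.
  have hB : 0 <= t / 2 * (2 * pi) by rewrite mulr_ge0 ?divr_ge0// ltW.
  have EA : p + t * (r2 - r1) = p + t / 2 * (r2 - r1) + t / 2 * (r2 - r1) by field.
  have EB : q + t * (2 * pi) = q + t / 2 * (2 * pi) + t / 2 * (2 * pi) by field.
  (* The common corner of the four quarters witnesses that they overlap. *)
  pose c := pol (p + t / 2 * (r2 - r1)) (q + t / 2 * (2 * pi)).
  have c1 : cell p q (t / 2) c.
    by exists (p + t / 2 * (r2 - r1)), (q + t / 2 * (2 * pi)); split=> //; lra.
  have c2 : cell (p + t / 2 * (r2 - r1)) q (t / 2) c.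
    by exists (p + t / 2 * (r2 - r1)), (q + t / 2 * (2 * pi)); split=> //; lra.
  have c3 : cell p (q + t / 2 * (2 * pi)) (t / 2) c.
    by exists (p + t / 2 * (r2 - r1)), (q + t / 2 * (2 * pi)); split=> //; lra.
  have c4 : cell (p + t / 2 * (r2 - r1)) (q + t / 2 * (2 * pi)) (t / 2) c.
    by exists (p + t / 2 * (r2 - r1)), (q + t / 2 * (2 * pi)); split=> //; lra.
  have u1 := Pcup _ _ (ex_intro _ c (conj c1 c2)) h1 h2.
  have u2 := Pcup _ _ (ex_intro _ c (conj c3 c4)) h3 h4.
  have u3 := Pcup _ _ (ex_intro _ c (conj (or_introl c1) (or_introl c3))) u1 u2.
  apply: (Psub _ _ _ u3) => z [r [s [/andP[r1' r2'] /andP[s1 s2] zE]]].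
  rewrite EA in r2'; rewrite EB in s2.
  have [c5|c5] := leP r (p + t / 2 * (r2 - r1)); have [c6|c6] := leP s (q + t / 2 * (2 * pi)).
  + by left; left; exists r, s; split => //; apply/andP; split; lra.
  + by right; left; exists r, s; split => //; apply/andP; split; lra.
  + by left; right; exists r, s; split => //; apply/andP; split; lra.
  + by right; right; exists r, s; split => //; apply/andP; split; lra.
move=> x y xx yy.
have x0 : 0 <= x by case/andP: xx => h _; exact: le_trans h.
have [|e e0 Pe] := Ploc (pol x y); first by rewrite nm_pol.
pose K := (r2 - r1) + x * (2 * (2 * pi)).
have K0 : 0 <= K by rewrite /K addr_ge0// mulr_ge0// mulr_ge0// ltW.
have K1 : 0 < K + 1 by rewrite ltr_wpDl.
exists (e / (K + 1)); first by rewrite divr_gt0.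
move=> p q t /andP[t0 td] _ /andP[x1 x2] /andP[y1 y2]; apply: (Psub _ _ _ Pe).
move=> _ [r [s [/andP[r1' r2'] /andP[s1 s2] ->]]] /=.
apply: le_lt_trans (nm_polB _ _ _ x0) _.
have a1 : `|r - x| <= t * (r2 - r1) by rewrite ler_norml; apply/andP; split; lra.
have a2 : `|s - y| <= t * (2 * pi) by rewrite ler_norml; apply/andP; split; lra.
have : t * K < e.
  move: td; rewrite ltr_pdivlMr//; apply: le_lt_trans.
  by apply: ler_wpM2l; [exact: ltW|rewrite lerDl].
apply: le_lt_trans; rewrite /K mulrDr lerD//.
have -> : t * (x * (2 * (2 * pi))) = x * (2 * (t * (2 * pi))) by ring.
by rewrite ler_wpM2l// ler_wpM2l.
Qed.

Section on_disc.
Variables (f : C -> C) (R0 : R).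
Hypothesis f_loc : forall a, 0 < nm a < R0 ->
  hol_near_at f a \/ exists2 m : nat, (0 < m)%N & mform f a (- m%:Z).
Hypothesis f_nz : ~ (forall z, 0 < nm z < R0 -> f z = 0).

Let vanishing a := \forall w \near cnb a, w != a -> f w = 0.

Lemma mform_not_vanishing a m : mform f a m -> ~ vanishing a.
Proof.
move=> [g [g1 g2 g3]] v; have g4 := hol_near_neq0 g1 g2.
have [d d0 h] := filterI g4 (filterI g3 v).
have [w wa /h [gw [E1 E2]]] := near_point a d0.
have : (w - a) ^ m * g w = 0 by rewrite -E1// E2.
by move/eqP; rewrite mulf_eq0 (negbTE gw) orbF expfz_eq0 subr_eq0 (negbTE wa) andbF.
Qed.

Let dichotomy a : 0 < nm a < R0 -> vanishing a \/ exists m, mform f a m.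
Proof.
move=> aD; case: (f_loc aD) => [ha|[m _ hm]]; last by right; exists (- m%:Z).
case: (hol_zero_order ha) => [h|[m [g [g1 g2 g3]]]].
  by left; apply: filterS h => w ->.
by right; exists m; exists g; split => //; apply: filterS g3 => w ->.
Qed.

Let vanishing_uniform (r1 r2 : R) : 0 < r1 -> r1 <= r2 -> r2 < R0 ->
  (forall z, r1 <= nm z <= r2 -> vanishing z) \/
  (forall z, r1 <= nm z <= r2 -> ~ vanishing z).
Proof.
move=> r10 r12 r2R.
apply: (@annulus_induction (fun A => (forall z, A z -> vanishing z) \/
  (forall z, A z -> ~ vanishing z)) r1 r2) => //.
- exact: ltW.
- by move=> A B AB [h|h]; [left|right] => z /AB; exact: h.
- move=> A B [c [Ac Bc]] [hA|hA] [hB|hB].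
  + by left => z [/hA|/hB].
  + by case: (hB c Bc); exact: hA.
  + by case: (hA c Ac); exact: hB.
  + by right => z [/hA|/hB].
- move=> z /andP[z1 z2].
  have zD : 0 < nm z < R0 by rewrite (lt_le_trans r10 z1) (le_lt_trans z2 r2R).
  case: (dichotomy zD) => [vz|[m hm]].
    have [d d0 hd] := cnb_near vz; exists d => //; left => w /hd wz.
    have [->//|wz'] := eqVneq w z.
    by apply: filterS2 wz (cnb_neq wz') => v Ev vz' _; exact: Ev.
  have [d d0 hd] := mform_off hm; exists d => //; right => w wd.
  have [->|wz] := eqVneq w z; first exact: mform_not_vanishing hm.
  exact: mform_not_vanishing (hd w wd wz).
Qed.

(** The identity theorem: vanishing near one point spreads over an annulus containing any other
    prescribed point, and would make [f] zero on the whole punctured disc. *)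
Lemma mform_ex a : 0 < nm a < R0 -> exists m, mform f a m.
Proof.
move=> aD; have [va|//] := dichotomy aD; exfalso; apply: f_nz => z zD.
have /andP[a0 aR] := aD; have /andP[z0 zR] := zD.
pose r1 := Num.min (nm a) (nm z); pose r2 := Num.max (nm a) (nm z).
have r10 : 0 < r1 by rewrite lt_min a0 z0.
have r2R : r2 < R0 by rewrite gt_max aR zR.
have ar : r1 <= nm a <= r2 by rewrite ge_min le_max !lexx.
have zr : r1 <= nm z <= r2 by rewrite ge_min le_max !lexx !orbT.
have r12 : r1 <= r2 by case/andP: ar; exact: le_trans.
have [h|h] := vanishing_uniform r10 r12 r2R; last by case: (h a).
have vz := h z zr; have [hz|[m m0 hm]] := f_loc zD.
  apply: (@ccts_eq _ f (fun=> 0)) => //.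
    exact: hol_ccts (hol_near_hol hz).
  exact: ccts_const.
by case: (mform_not_vanishing hm).
Qed.

Definition zord (a : C) : int := xget 0 [set m | mform f a m].

Lemma zordP a : 0 < nm a < R0 -> mform f a (zord a).
Proof. by move=> /mform_ex [m hm]; exact: (@xgetPex _ 0 [set m | mform f a m] (ex_intro _ m hm)). Qed.

Lemma zordE a m : 0 < nm a < R0 -> mform f a m -> zord a = m.
Proof. by move=> /zordP; exact: mform_unique. Qed.

Lemma zord_ge0_hol a : 0 < nm a < R0 -> 0 <= zord a -> hol_near_at f a.
Proof.
move=> aD; have [//|[m m0 hm]] := f_loc aD.
by rewrite (zordE aD hm) oppr_ge0; case: m m0 {hm}.
Qed.

(** [mform] ignores the value at [a]; it is [f_loc] that excludes a pole and makes [f] continuous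
    there, so that [f a] is the value of the regular factor. *)
Lemma zord0_neq0 a : 0 < nm a < R0 -> zord a = 0 -> hol_near_at f a /\ f a != 0.
Proof.
move=> aD a0; have hf : hol_near_at f a by apply: zord_ge0_hol => //; rewrite a0.
split => //; have [g [g1 g2 g3]] := zordP aD; rewrite a0 in g3.
suff -> : f a = g a by [].
apply: ccts_eq.
- by apply: filterS g3 => w E wa; rewrite E// expr0z mul1r.
- exact: hol_ccts (hol_near_hol hf).
- exact: hol_ccts (hol_near_hol g1).
Qed.

Lemma zord_finite (r1 r2 : R) : 0 < r1 -> r1 <= r2 -> r2 < R0 ->
  exists s : seq C, uniq s /\
    forall a, (a \in s) = [&& r1 <= nm a, nm a <= r2 & zord a != 0].
Proof.
move=> r10 r12 r2R.
have [|||s hs] := @annulus_induction (fun A => exists s : seq C,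
  forall a, A a -> zord a != 0 -> a \in s) r1 r2 (ltW r10) r12.
- by move=> A B AB [s h]; exists s => a /AB; exact: h.
- move=> A B _ [s h] [t k]; exists (s ++ t) => a; rewrite mem_cat.
  by move=> [/h H /H ->|/k H /H ->] //; rewrite orbT.
- move=> z /andP[z1 z2].
  have zD : 0 < nm z < R0 by rewrite (lt_le_trans r10 z1) (le_lt_trans z2 r2R).
  have zn : \forall w \near cnb z, 0 < nm w < R0.
    have d0 : 0 < Num.min (nm z) (R0 - nm z).
      by case/andP: zD => h1 h2; rewrite lt_min h1 subr_gt0.
    exists (Num.min (nm z) (R0 - nm z)) => // w; rewrite lt_min => /andP[w1 w2].
    have := nm_distB w z; rewrite ler_norml => /andP[h1 h2].
    by apply/andP; split; lra.
  have [d d0 hd] := filterI zn (mform_off (zordP zD)); exists d => //.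
  exists [:: z] => a /hd [aD ha] a0; rewrite inE; apply: contraNT a0 => az.
  by rewrite (zordE aD (ha az)).
exists (undup [seq a <- s | [&& r1 <= nm a, nm a <= r2 & zord a != 0]]).
split; first exact: undup_uniq.
move=> a; rewrite mem_undup mem_filter; case: (boolP [&& _, _ & _]) => //=.
by move=> /and3P[a1 a2 a3]; apply: hs => //=; rewrite a1.
Qed.

Definition zprod (s : seq C) (w : C) : C := \prod_(b <- s) (w - b) ^ zord b.

(** The quotient of [f] by [zprod] has order 0 at every point of the annulus, so [mform0_regular]
    fills its removable singularities. *)
Lemma zfactor (r1 r2 : R) (s : seq C) : 0 < r1 -> r2 < R0 -> uniq s ->
  (forall a, (a \in s) = [&& r1 <= nm a, nm a <= r2 & zord a != 0]) ->
  exists G, (forall z, r1 <= nm z <= r2 -> hol_near_at G z /\ G z != 0) /\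
    (forall z, r1 <= nm z <= r2 -> z \notin s ->
       [/\ hol_near_at f z, f z != 0 & f z = zprod s z * G z]).
Proof.
move=> r10 r2R us hs.
have inD z : r1 <= nm z <= r2 -> 0 < nm z < R0.
  by move=> /andP[z1 z2]; rewrite (lt_le_trans r10 z1) (le_lt_trans z2 r2R).
have [|G hG] := @mform0_regular (fun w => f w * (zprod s w)^-1) [set z | r1 <= nm z <= r2].
  move=> z /= zr; have := mformM (zordP (inD z zr)) (mformV (mform_prod zord z us)).
  rewrite hs; case/andP: (zr) => -> ->; case: eqVneq => [->|_] /=.
    by rewrite oppr0.
  by rewrite subrr.
exists G; split; first by move=> z /hG[].
move=> z zr zs; have [g1 g2 g3] := hG z zr.
have z0 : zord z = 0.
  by apply/eqP; move: zs; rewrite hs; case/andP: zr => -> -> /=; rewrite negbK.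
have [hf f0] := zord0_neq0 (inD z zr) z0; split => //.
have Qz : mform (zprod s) z 0 by have := mform_prod zord z us; rewrite (negbTE zs).
have Q0 : zprod s z != 0.
  rewrite prodf_seq_neq0; apply/allP => b bs /=; rewrite expfz_neq0// subr_eq0.
  by apply: contraNneq zs => ->.
have Qh : hol_near_at (zprod s) z.
  have : forall t, all (mem s) t -> hol_near_at (fun w => \prod_(b <- t) (w - b) ^ zord b) z.
    elim=> [_|b t ih /= /andP[bs ts]].
      by under eq_fun do rewrite big_nil; apply: nearW => w; exact: hol_cst.
    under eq_fun do rewrite big_cons.
    have zb : z - b != 0 by rewrite subr_eq0; apply: contraNneq zs => ->.
    have : \forall w \near cnb z, hol (fun w => (w - b) ^ zord b) w.
      have h1 w : hol (fun w => w - b) w by apply: holB; [exact: hol_id|exact: hol_cst].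
      have h2 : \forall w \near cnb z, w != b.
        by apply: cnb_neq; rewrite -subr_eq0.
      apply: filterS h2 => w wb; case: (zord b) => n; first exact: holX.
      apply: holV; last exact: holX.
      by rewrite expf_neq0// subr_eq0.
    by move/filterS2; apply; [move=> w; exact: holM|exact: ih].
  by apply; apply/allP.
have E : f z * (zprod s z)^-1 = G z.
  apply: (ccts_eq g3).
    apply: ccts_mul; first exact: hol_ccts (hol_near_hol hf).
    by apply: ccts_inv => //; exact: hol_ccts (hol_near_hol Qh).
  exact: hol_ccts (hol_near_hol g1).
by rewrite -E mulrCA mulfV// mulr1.
Qed.

End on_disc.
End meromorphic.

(** * Jensen's formula *)

Section log_means.
Variable R : realType.
Local Notation C := R[i].
Local Notation nm := (@normc R).
Local Notation mu := (@lebesgue_measure R).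

Definition rmean (u : C -> R) (r : R) : R :=
  (2 * pi)^-1 * rint 0 (2 * pi) (fun t => u (pol r t)).

(** Continuity of a real function through its complexification, so as to reuse the rules for
    [ccts]. *)
Definition rct (u : C -> R) (z : C) := ccts (fun w => (u w)%:C) z.

Lemma rct_cvg u z X (F : set_system X) {FF : Filter F} (g : X -> C) :
  rct u z -> clim F g z -> u (g x) @[x --> F] --> u z.
Proof. by move=> hu hg; exact: (clim_ReP (clim_comp hg hu)). Qed.

Lemma rct_comp (phi : R -> R) u z : {for u z, continuous phi} -> rct u z ->
  rct (fun w => phi (u w)) z.
Proof.
move=> hphi hu; apply: clim_real.
have h : u w @[w --> cnb z] --> u z by apply: (rct_cvg hu); exact: clim_id.
exact: (cvg_comp _ _ h hphi).
Qed.

Lemma rct_nm (F : C -> C) z : ccts F z -> rct (fun w => nm (F w)) z.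
Proof. by move=> hF; apply: clim_real; exact: clim_nm. Qed.

Lemma rct_ln (F : C -> C) z : ccts F z -> F z != 0 -> rct (fun w => ln (nm (F w))) z.
Proof.
move=> hF F0; apply: (@rct_comp (@ln R)); last exact: rct_nm.
by apply: continuous_ln; rewrite nm_gt0.
Qed.

Lemma rctD u v z : rct u z -> rct v z -> rct (fun w => u w + v w) z.
Proof.
move=> hu hv; rewrite /rct; under eq_fun do rewrite rmorphD; exact: ccts_add.
Qed.

Lemma rct_cst c z : rct (fun=> c) z.
Proof. exact: ccts_const. Qed.

Lemma rctZ c u z : rct u z -> rct (fun w => c * u w) z.
Proof.
move=> hu; rewrite /rct; under eq_fun do rewrite rmorphM.
by apply: ccts_mul => //; exact: ccts_const.
Qed.

Lemma rct_norm u z : rct u z -> rct (fun w => `|u w|) z.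
Proof. by apply: (@rct_comp Num.norm); exact: norm_continuous. Qed.

Lemma rct_sum (I : Type) (s : seq I) (u : I -> C -> R) z :
  (forall i, rct (u i) z) -> rct (fun w => \sum_(i <- s) u i w) z.
Proof.
move=> h; elim: s => [|i s ih].
  by under eq_fun do rewrite big_nil; exact: rct_cst.
by under eq_fun do rewrite big_cons; exact: rctD.
Qed.

Lemma rct_cts_on u (r : R) a b : 0 <= r -> (forall z, nm z = r -> rct u z) ->
  cts_on a b (fun t => u (pol r t)).
Proof.
move=> r0 h t tab; apply: rct_cvg; first by apply: h; exact: nm_pol.
exact: (pol_cts_t r tab).
Qed.

Lemma i2pi_ge0 : 0 <= (2 * pi)^-1 :> R.
Proof. by rewrite invr_ge0 ltW// pi2_gt0. Qed.

Lemma rmeanD u v (r : R) : 0 <= r -> (forall z, nm z = r -> rct u z) ->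
  (forall z, nm z = r -> rct v z) ->
  rmean (fun w => u w + v w) r = rmean u r + rmean v r.
Proof.
move=> r0 hu hv.
rewrite /rmean (rintD (rct_cts_on r0 hu) (rct_cts_on r0 hv)).
exact: mulrDr.
Qed.

Lemma rmeanZ c u (r : R) : 0 <= r -> (forall z, nm z = r -> rct u z) ->
  rmean (fun w => c * u w) r = c * rmean u r.
Proof.
move=> r0 hu; rewrite /rmean (rintZ c (rct_cts_on r0 hu)).
exact: mulrCA.
Qed.

Lemma rmean_cst c (r : R) : rmean (fun=> c) r = c.
Proof.
have p0 := pi2_gt0 R.
by rewrite /rmean rint_cst ?(ltW p0)// subr0 mulrCA mulVf ?gt_eqF// mulr1.
Qed.

Lemma eq_rmean u v (r : R) : 0 <= r -> (forall z, nm z = r -> u z = v z) ->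
  rmean u r = rmean v r.
Proof.
by move=> r0 h; congr (_ * _); apply: eq_rint => t _; apply: h; exact: nm_pol.
Qed.

Lemma rmean_le u v (r : R) : 0 <= r -> (forall z, nm z = r -> rct u z) ->
  (forall z, nm z = r -> rct v z) -> (forall z, nm z = r -> u z <= v z) ->
  rmean u r <= rmean v r.
Proof.
move=> r0 hu hv h; apply: ler_wpM2l; first exact: i2pi_ge0.
apply: rint_le; [exact: rct_cts_on|exact: rct_cts_on|move=> t _; apply: h; exact: nm_pol].
Qed.

Lemma rmean_ge0 u (r : R) : 0 <= r -> (forall z, nm z = r -> rct u z) ->
  (forall z, nm z = r -> 0 <= u z) -> 0 <= rmean u r.
Proof.
move=> r0 hu h; rewrite -(rmean_cst 0 r); apply: rmean_le => // z _; exact: rct_cst.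
Qed.

Lemma rmean_norm_le u (r M : R) : 0 <= r -> (forall z, nm z = r -> rct u z) ->
  (forall z, nm z = r -> `|u z| <= M) -> `|rmean u r| <= M.
Proof.
move=> r0 hu h; rewrite ler_norml; apply/andP; split.
  rewrite -(rmean_cst (- M) r); apply: rmean_le => // z; first by move=> _; exact: rct_cst.
  by move/h; rewrite ler_norml => /andP[].
rewrite -[leRHS](rmean_cst M r); apply: rmean_le => // z; first by move=> _; exact: rct_cst.
by move/h; rewrite ler_norml => /andP[].
Qed.

Lemma rmean_sum (I : Type) (s : seq I) (u : I -> C -> R) (r : R) : 0 <= r ->
  (forall i z, nm z = r -> rct (u i) z) ->
  rmean (fun w => \sum_(i <- s) u i w) r = \sum_(i <- s) rmean (u i) r.
Proof.
move=> r0 h; elim: s => [|i s ih].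
  by under eq_fun do rewrite big_nil; rewrite big_nil rmean_cst.
under eq_fun do rewrite big_cons; rewrite big_cons -ih rmeanD// => z zr; first exact: h.
by apply: rct_sum => j; exact: h.
Qed.

Lemma ln_nmE (z : C) : z != 0 ->
  ln (nm z) = 2^-1 * ln (complex.Re z ^+ 2 + complex.Im z ^+ 2).
Proof.
by move=> z0; rewrite -nm_sqr lnXn ?nm_gt0// -[ln _ *+ 2]mulr_natl mulKf.
Qed.

(** Writing [ln |g|] as half the logarithm of the sum of two squares avoids choosing a branch of the
    complex logarithm. *)
Lemma is_derive_ln_nm (g : R -> C) t d : g t != 0 -> rder g t d ->
  is_derive t 1 (fun s => ln (nm (g s))) (complex.Re (d / g t)).
Proof.
move=> g0 hg.
have gn : \forall s \near t, g s != 0 by exact: (clim_neq0 g0 (rder_lim hg)).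
have h1 := rder_Re hg; have h2 := rder_Im hg.
have n0 : 0 < complex.Re (g t) ^+ 2 + complex.Im (g t) ^+ 2.
  by rewrite -nm_sqr exprn_gt0// nm_gt0.
pose q s := complex.Re (g s) ^+ 2 + complex.Im (g s) ^+ 2.
have hq : is_derive t 1 q (2 * complex.Re (g t) * complex.Re d +
    2 * complex.Im (g t) * complex.Im d).
  have k1 := is_deriveX 2 h1; have k2 := is_deriveX 2 h2.
  apply: (is_derive_eq (is_deriveD k1 k2)).
  by rewrite /GRing.scale /= !expr1.
have hl := @is_derive1_comp R (@ln R) q t _ _ (is_derive1_ln n0) hq.
have hf := is_deriveZ (2^-1) hl.
have hf' : is_derive t 1 (fun s => 2^-1 * ln (q s)) (complex.Re (d / g t)).
  apply: (is_derive_eq hf).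
  rewrite /GRing.scale /= -/(q t) /q; case: (g t) g0 n0 {hq hl hf q} => a b g0 /= n0.
  case: d {hg h1 h2} => p q' /=.
  by field; exact: lt0r_neq0.
apply: near_eq_is_derive hf'.
by apply: filterS gn => s gs; rewrite ln_nmE.
Qed.

Lemma rint_param_derive (f df : R -> R -> R) (a b u v M : R) :
  (forall x, u < x < v -> cts_on a b (f x)) ->
  (forall x y, u < x < v -> a <= y <= b -> is_derive x 1 (f ^~ y) (df x y)) ->
  (forall x y, u < x < v -> a <= y <= b -> `|df x y| <= M) ->
  forall x, u < x < v ->
    is_derive x 1 (fun x => rint a b (f x)) (rint a b (df x)).
Proof.
move=> h1 h2 h3 x xuv.
have dE y z : u < y < v -> a <= z <= b -> partial1of2 f y z = df y z.
  by move=> yuv zab; rewrite partial1of2E; have [_ ->] := h2 y z yuv zab.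
have xI : (`]u, v[%classic : set R) x by rewrite /= in_itv.
have intf y : (`]u, v[%classic : set R) y -> mu.-integrable `[a, b] (EFin \o f y).
  by rewrite /= in_itv /= => yuv; apply: cts_integrable; exact: h1.
have derf y z : (`]u, v[%classic : set R) y -> (`[a, b]%classic : set R) z ->
    derivable (f ^~ z) y 1.
  by rewrite /= !in_itv /= => yuv zab; have [] := h2 y z yuv zab.
have ub y z : (`]u, v[%classic : set R) y -> (`[a, b]%classic : set R) z ->
    `|partial1of2 f y z| <= `|M|.
  rewrite /= !in_itv /= => yuv zab; rewrite dE//.
  by apply: le_trans (h3 _ _ yuv zab) _; exact: ler_norm.
have intM : mu.-integrable `[a, b] (EFin \o (fun=> `|M| : R)).
  by apply: cts_integrable; exact: cts_cst.
have D := @derivable_under_integral R _ (measurableTypeR R) mu f `[a, b]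
  (measurable_itv _) x u v xI intf derf (fun=> `|M|) (fun=> normr_ge0 _) intM ub.
have E := @differentiation_under_integral R _ (measurableTypeR R) mu f `[a, b]
  (measurable_itv _) x u v xI intf derf (fun=> `|M|) (fun=> normr_ge0 _) intM ub.
apply: DeriveDef; first exact: D.
rewrite -derive1E E; apply: eq_Rintegral => y; rewrite inE /= in_itv /= => yab.
exact: dE.
Qed.

End log_means.

Section jensen.
Variable R : realType.
Local Notation C := R[i].
Local Notation nm := (@normc R).

Transparent mean.
Lemma meanE (F : C -> C) (r : R) :
  mean F r = ((2 * pi)^-1)%:C * cint 0 (2 * pi) (fun t => F (pol r t)).
Proof. by []. Qed.

Lemma Re_mean (F : C -> C) (r : R) :
  complex.Re (mean F r) = rmean (fun w => complex.Re (F w)) r.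
Proof.
by rewrite /rmean meanE /cint mulcE !mul0r subr0.
Qed.

Lemma dlog_hol (G : C -> C) z : hol_near_at G z -> G z != 0 ->
  hol (fun w => w * dc G w / G w) z.
Proof.
move=> h G0; apply: hol_div => //; last exact: hol_near_hol.
by apply: holM; [exact: hol_id|exact: hol_dc].
Qed.

(** Differentiating under the integral sign, the derivative of the mean of [ln |G|] at radius [x] is
    [1 / x] times the real part of the mean of [w * G' / G]. The latter is the same on all circles,
    because the function is holomorphic. *)
Lemma rmean_ln_linear (G : C -> C) (a b r1 r2 : R) : 0 < a -> a < r1 -> r1 <= r2 ->
  r2 < b -> (forall z, a <= nm z <= b -> hol_near_at G z /\ G z != 0) ->
  rmean (fun w => ln (nm (G w))) r2 - rmean (fun w => ln (nm (G w))) r1 =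
  complex.Re (mean (fun w => w * dc G w / G w) r1) * (ln r2 - ln r1).
Proof.
move=> a0 ar1 r12 r2b hG.
pose L w := w * dc G w / G w; set c := complex.Re (mean _ r1).
have ab : a <= b by rewrite ltW// (lt_le_trans ar1)// (le_trans r12)// ltW.
have hL z : a <= nm z <= b -> hol L z by move=> /hG[h1 h2]; exact: dlog_hol.
have [M M0 hM] := annulus_bounded (ltW a0) ab (fun z zr => hol_ccts (hL z zr)).
have inab (x : R) t : a < x < b -> [/\ 0 < x, x != 0, pol x t != 0 & a <= nm (pol x t) <= b].
  move=> /andP[ax xb]; have x0 := lt_trans a0 ax.
  have n : nm (pol x t) = x by rewrite nm_pol// ltW.
  by split; [|rewrite gt_eqF|rewrite -nm_gt0 n|rewrite n !ltW].
pose f (x t : R) := ln (nm (G (pol x t))).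
pose df (x t : R) := complex.Re (L (pol x t)) / x.
have mc (x : R) : a < x < b -> complex.Re (mean L x) = c.
  move=> /andP[ax xb].
  have [xr|rx] := leP x r1; rewrite /c -/L.
    rewrite (mean_hol _ xr)//; first exact: lt_trans ax.
    move=> z /andP[z1 z2]; apply: hL; rewrite (le_trans (ltW ax) z1)/=.
    by rewrite (le_trans z2)// (le_trans r12)// ltW.
  rewrite -(mean_hol _ (ltW rx))//; first exact: lt_trans ar1.
  move=> z /andP[z1 z2]; apply: hL; rewrite (le_trans (ltW ar1) z1)/=.
  by rewrite (le_trans z2)// ltW.
have D (x : R) : a < x < b ->
    is_derive x 1 (fun x => rint 0 (2 * pi) (f x)) (rint 0 (2 * pi) (df x)).
  apply: (@rint_param_derive R f df _ _ a b (M / a)).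
  - move=> y yab t tt; have [y0 _ _ pr] := inab y t yab.
    have [h1 h2] := hG _ pr.
    apply: (@rct_cvg _ (fun w => ln (nm (G w)))); last exact: (pol_cts_t y tt).
    by apply: rct_ln => //; exact: hol_ccts (hol_near_hol h1).
  - move=> y t yab tt; have [y0 y1 p1 pr] := inab y t yab.
    have [h1 h2] := hG _ pr.
    have := is_derive_ln_nm h2 (rder_comp (rder_pol_r y t) (dcP (hol_near_hol h1))).
    move=> h; apply: (is_derive_eq h); rewrite /df /L /pol.
    have -> : y%:C * cis t * dc G (y%:C * cis t) / G (y%:C * cis t) =
       dc G (y%:C * cis t) * cis t / G (y%:C * cis t) * y%:C by ring.
    rewrite -/(pol y t); case: (_ / _) => p q /=.
    by rewrite mulr0 subr0 mulfK.
  - move=> y t yab tt; have [y0 y1 p1 pr] := inab y t yab.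
    rewrite /df normrM normfV (gtr0_norm y0) ler_pM ?invr_ge0 ?(ltW y0)//.
      by apply: le_trans (Re_le_nm _) _; exact: hM.
    by rewrite lef_pV2 ?posrE// ltW//; case/andP: yab.
have cdf (x : R) : a < x < b -> rint 0 (2 * pi) (df x) = (2 * pi) * (c * x^-1).
  move=> xab; have [x0 x1 _ _] := inab x 0 xab.
  have -> : rint 0 (2 * pi) (df x) = x^-1 * rint 0 (2 * pi) (fun t => complex.Re (L (pol x t))).
    rewrite -rintZ; first by apply: eq_rint => t _; rewrite /df mulrC.
    apply: (@ccts_Re _ _ _ (fun t => L (pol x t))); apply: circle_cts; first exact: ltW.
    move=> z zx; apply: hol_ccts; apply: hL; rewrite zx.
    by case/andP: xab => h1 h2; rewrite !ltW.
  rewrite -(mc x xab) Re_mean /rmean.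
  have P0 : 2 * pi != 0 :> R by rewrite gt_eqF// pi2_gt0.
  move: (2 * pi) P0 => P P0; move: (rint _ _ _) => I.
  by field; rewrite x1 P0.
have sub x : r1 <= x <= r2 -> a < x < b.
  by move=> /andP[x1 x2]; rewrite (lt_le_trans ar1 x1) (le_lt_trans x2 r2b).
have ctsV : cts_on r1 r2 (fun x => c * x^-1).
  move=> x xr; have [x0 x1 _ _] := inab x 0 (sub x xr).
  by apply: cvgM; [exact: cvg_cst|exact: inv_continuous].
have ctsV2 : cts_on r1 r2 (fun x => 2 * pi * (c * x^-1)).
  by move=> x xr; apply: cvgM; [exact: cvg_cst|exact: ctsV].
have F1 := rint_FTC r12 (fun x xr => is_derive_eq (D x (sub x xr)) (cdf x (sub x xr))) ctsV2.
have D2 x : r1 <= x <= r2 -> is_derive x 1 (fun x => c * ln x) (c * x^-1).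
  move=> xr; have [x0 _ _ _] := inab x 0 (sub x xr).
  exact: (is_deriveZ c (is_derive1_ln x0)).
have F2 := rint_FTC r12 D2 ctsV.
have p0 := pi2_gt0 R.
rewrite rintZ// F2 in F1.
rewrite /rmean -mulrBr -F1 mulKf ?gt_eqF//.
by rewrite mulrBr.
Qed.

(** Both sides come from [ln (1 + x) <= x], applied to the modulus and to its inverse. *)
Lemma ln_nm_1B (z : C) : nm z <= 2^-1 -> `|ln (nm (1 - z))| <= 2 * nm z.
Proof.
move=> z2; have z0 := nm_ge0 z.
have h1 : 1 - nm z <= nm (1 - z) by have := nm_subl z 1; rewrite normc1.
have h2 : nm (1 - z) <= 1 + nm z by apply: le_trans (nmB _ _) _; rewrite normc1.
have p0 : 0 < nm (1 - z) by lra.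
rewrite ler_norml; apply/andP; split.
  have i0 : 0 < (nm (1 - z))^-1 by rewrite invr_gt0.
  have := le_ln1Dx (x := (nm (1 - z))^-1 - 1); rewrite subrKC lnV ?posrE//.
  have : (nm (1 - z))^-1 <= 1 + 2 * nm z.
    rewrite -[leLHS]mul1r ler_pdivrMr//.
    have : (1 + 2 * nm z) * (1 - nm z) <= (1 + 2 * nm z) * nm (1 - z).
      by apply: ler_wpM2l => //; lra.
    nra.
  move=> h3 h4.
  have : - ln (nm (1 - z)) <= (nm (1 - z))^-1 - 1 by apply: h4; lra.
  lra.
have := le_ln1Dx (x := nm (1 - z) - 1); rewrite subrKC => h.
have : ln (nm (1 - z)) <= nm (1 - z) - 1 by apply: h; lra.
lra.
Qed.

Lemma hol_near_sub (a z : C) : hol_near_at (fun w => w - a) z.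
Proof. by apply: nearW => w; apply: holB; [exact: hol_id|exact: hol_cst]. Qed.

Lemma rct_ln_sub (a z : C) : z != a -> rct (fun w => ln (nm (w - a))) z.
Proof.
move=> za; apply: rct_ln; last by rewrite subr_eq0.
by apply: hol_ccts; exact: (hol_near_hol (hol_near_sub a z)).
Qed.

Lemma dc_sub (a z : C) : dc (fun w => w - a) z = 1.
Proof.
by apply: dcE; have := cderB (cder_id z) (cder_cst a z); rewrite subr0.
Qed.

Lemma dlog_sub (a : C) (r : R) : 0 <= r ->
  mean (fun w => w * dc (fun w => w - a) w / (w - a)) r = mean (fun w => w / (w - a)) r.
Proof. by move=> r0; apply: eq_mean => // z _; rewrite dc_sub mulr1. Qed.

Lemma le_eps_eq (x y : R) : (forall e, 0 < e -> `|x - y| <= e) -> x = y.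
Proof.
move=> h; apply/eqP; rewrite -subr_eq0 -normr_eq0 eq_le normr_ge0 andbT.
by apply/ler_addgt0Pr => e e0; rewrite add0r h.
Qed.

(** By [mean_kernel_in] the slope in [ln r] is 0, so the circle may be shrunk until [w - a] is close
    to [- a]. *)
Lemma rmean_ln_sub_in (a : C) (r : R) : 0 < r -> r < nm a ->
  rmean (fun w => ln (nm (w - a))) r = ln (nm a).
Proof.
move=> r0 ra; apply: le_eps_eq => e e0.
have a0 : a != 0 by rewrite -nm_gt0 (lt_trans r0).
pose s := Num.min r (Num.min (nm a / 2) (e * nm a / 2)).
have na := lt_trans r0 ra.
have s0 : 0 < s by rewrite !lt_min r0 !divr_gt0// mulr_gt0.
have sr : s <= r by rewrite ge_min lexx.
have s2 : s <= nm a / 2 by rewrite !ge_min lexx orbT.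
have s3 : s <= e * nm a / 2 by rewrite !ge_min lexx !orbT.
have := @rmean_ln_linear (fun w => w - a) (s / 2) ((r + nm a) / 2) s r.
rewrite dlog_sub ?(ltW s0)// mean_kernel_in//; last by lra.
rewrite mul0r => /(_ _ _ sr) H.
have E : rmean (fun w => ln (nm (w - a))) r = rmean (fun w => ln (nm (w - a))) s.
  apply/eqP; rewrite -subr_eq0; apply/eqP; apply: H; [lra|lra|lra|].
  move=> z /andP[z1 z2]; split; first exact: hol_near_sub.
  by apply: sub_neq0; rewrite gt_eqF//; lra.
have za z : nm z = s -> z != a.
  by move=> zs; apply: contra_eq_neq zs => ->; rewrite gt_eqF//; lra.
rewrite E -(rmean_cst (ln (nm a)) s).
have -> : rmean (fun w => ln (nm (w - a))) s - rmean (fun=> ln (nm a)) s =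
    rmean (fun w => ln (nm (w - a)) + (-1) * ln (nm a)) s.
  rewrite rmeanD ?(ltW s0)//.
  - by rewrite !rmean_cst mulN1r.
  - by move=> z zs; apply: rct_ln_sub; exact: za.
  - by move=> z _; exact: rct_cst.
apply: rmean_norm_le; first exact: ltW.
  by move=> z zs; apply: rctD; [apply: rct_ln_sub; exact: za|exact: rct_cst].
move=> z zs; rewrite mulN1r -ln_div ?posrE ?nm_gt0// ?subr_eq0 ?za//.
have -> : nm (z - a) / nm a = nm (1 - z / a).
  rewrite -normcV -normcM -nmN; congr nm; by field.
have q : nm (z / a) = s / nm a by rewrite normcM normcV zs.
apply: le_trans (ln_nm_1B _) _; rewrite q.
  by rewrite ler_pdivrMr// mulrC.
rewrite mulrA ler_pdivrMr//; lra.
Qed.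

(** By [mean_kernel_out] the slope in [ln r] is 1, so the circle may be enlarged until [w - a] is
    relatively close to [w]. *)
Lemma rmean_ln_sub_out (a : C) (r : R) : nm a < r ->
  rmean (fun w => ln (nm (w - a))) r = ln r.
Proof.
move=> ar; apply: le_eps_eq => e e0.
have na := nm_ge0 a; have r0 : 0 < r by exact: le_lt_trans ar.
pose s := Num.max r (Num.max (2 * nm a) (2 * nm a / e)).
have rs : r <= s by rewrite le_max lexx.
have s2 : 2 * nm a <= s by rewrite !le_max lexx orbT.
have s3 : 2 * nm a / e <= s by rewrite !le_max lexx !orbT.
have s0 : 0 < s by exact: lt_le_trans rs.
have := @rmean_ln_linear (fun w => w - a) ((nm a + r) / 2) (s + 1) r s.
rewrite dlog_sub ?(ltW r0)// mean_kernel_out//.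
have -> : complex.Re (1 : C) = 1 by [].
rewrite mul1r => /(_ _ _ rs) H.
have E : rmean (fun w => ln (nm (w - a))) s - rmean (fun w => ln (nm (w - a))) r =
    ln s - ln r.
  apply: H; [lra|lra|lra|].
  move=> z /andP[z1 z2]; split; first exact: hol_near_sub.
  by apply: sub_neq0; rewrite lt_eqF//; lra.
have za z : nm z = s -> z != a.
  by move=> zs; apply: contra_eq_neq zs => ->; rewrite lt_eqF//; lra.
have -> : rmean (fun w => ln (nm (w - a))) r - ln r =
    rmean (fun w => ln (nm (w - a))) s - ln s by lra.
rewrite -[in X in _ - X](rmean_cst (ln s) s).
have -> : rmean (fun w => ln (nm (w - a))) s - rmean (fun=> ln s) s =
    rmean (fun w => ln (nm (w - a)) + (-1) * ln s) s.
  rewrite rmeanD ?(ltW s0)//.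
  - by rewrite !rmean_cst mulN1r.
  - by move=> z zs; apply: rct_ln_sub; exact: za.
  - by move=> z _; exact: rct_cst.
apply: rmean_norm_le; first exact: ltW.
  by move=> z zs; apply: rctD; [apply: rct_ln_sub; exact: za|exact: rct_cst].
move=> z zs; rewrite mulN1r -ln_div ?posrE ?nm_gt0// ?subr_eq0 ?za//.
have z0 : z != 0 by rewrite -nm_gt0 zs.
have -> : nm (z - a) / s = nm (1 - a / z).
  by rewrite -zs -normcV -normcM; congr nm; field.
have q : nm (a / z) = nm a / s by rewrite normcM normcV zs.
apply: le_trans (ln_nm_1B _) _; rewrite q.
  by rewrite ler_pdivrMr//; lra.
rewrite mulrA ler_pdivrMr//; move: s3; rewrite ler_pdivrMr//; lra.
Qed.

(** The circle through [a], where the logarithm is singular, is left out; [good] radii avoid it. *)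
Lemma rmean_ln_sub (a : C) (r : R) : 0 < r -> nm a != r ->
  rmean (fun w => ln (nm (w - a))) r = ln (Num.max r (nm a)).
Proof.
move=> r0; rewrite neq_lt => /orP[ar|ra].
  by rewrite max_l ?(ltW ar)// rmean_ln_sub_out.
by rewrite max_r ?(ltW ra)// rmean_ln_sub_in.
Qed.

End jensen.

(** * Counting with weights, logarithms of products *)

Section counting.
Variable R : realType.
Local Notation C := R[i].
Local Notation nm := (@normc R).

Definition cnt (w : C -> nat) (t u : R) : R :=
  \sum_(a \in [set a : C | t <= nm a <= u]) ((w a)%:R : R).

Lemma cntE (w : C -> nat) (s : seq C) (t u : R) : uniq s ->
  (forall a, t <= nm a <= u -> w a != 0%N -> a \in s) ->
  cnt w t u = \sum_(a <- s | t <= nm a <= u) ((w a)%:R : R).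
Proof.
move=> us hs; rewrite /cnt (fsbigE [seq a <- s | t <= nm a <= u]).
- rewrite big_filter_cond; apply: eq_bigl => a.
  by apply/andP/idP => [[]//|h]; split => //; exact: mem_set.
- exact: filter_uniq.
- by move=> a /=; rewrite mem_filter => /andP[].
- move=> a /= ta; rewrite mem_filter ta /= => as'; apply/eqP; rewrite pnatr_eq0.
  by apply: contraNT as'; exact: hs.
Qed.

Lemma avoid_seq (l : seq R) (u v : R) : u < v -> exists2 r, u < r < v & r \notin l.
Proof.
move=> uv.
have [u' [v' [h1 h2 h3 h4]]] : exists u' v', [/\ u <= u', u' < v', v' <= v &
    forall r, u' < r < v' -> r \notin l].
  elim: l => [|x l [u' [v' [h1 h2 h3 h4]]]]; first by exists u, v.
  have [xm|mx] := leP x ((u' + v') / 2).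
    exists ((u' + v') / 2), v'; split; [lra|lra|lra|].
    move=> r /andP[r1 r2]; rewrite inE negb_or gt_eqF/=; last exact: le_lt_trans xm r1.
    by apply: h4; apply/andP; split; lra.
  exists u', ((u' + v') / 2); split; [lra|lra|lra|].
  move=> r /andP[r1 r2]; rewrite inE negb_or lt_eqF/=; last exact: lt_trans mx.
  by apply: h4; apply/andP; split; lra.
exists ((u' + v') / 2); first by apply/andP; split; lra.
by apply: h4; apply/andP; split; lra.
Qed.

Lemma ln_nm_prod (I : Type) (s : seq I) (F : I -> C) : all (fun i => F i != 0) s ->
  ln (nm (\prod_(i <- s) F i)) = \sum_(i <- s) ln (nm (F i)).
Proof.
elim: s => [_|i s ih /= /andP[Fi Fs]]; first by rewrite !big_nil normc1 ln1.
rewrite !big_cons normcM lnM ?posrE ?nm_gt0// ?ih//.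
by elim: s {ih} Fs => [_|j s ih /= /andP[Fj Fs]]; rewrite ?big_nil ?oner_neq0// big_cons mulf_neq0// ih.
Qed.

Lemma ln_nm_expz (z : C) (n : int) : z != 0 -> ln (nm (z ^ n)) = n%:~R * ln (nm z).
Proof.
move=> z0; have z1 : 0 < nm z by rewrite nm_gt0.
case: n => n.
  by rewrite -exprnP nmX lnXn// -pmulrn mulr_natl.
rewrite NegzE -exprnN normcV nmX lnV ?posrE ?exprn_gt0// lnXn//.
by rewrite mulrNz mulNr -pmulrn mulr_natl.
Qed.

End counting.

(** * Jensen's formula in the presence of zeros and poles *)

Section jensen_inequality.
Variable R : realType.
Local Notation C := R[i].
Local Notation nm := (@normc R).
Variables (f : C -> C) (R0 : R).
Hypothesis f_loc : forall a, 0 < nm a < R0 ->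
  hol_near_at f a \/ exists2 m : nat, (0 < m)%N & mform f a (- m%:Z).
Hypothesis f_nz : ~ (forall z, 0 < nm z < R0 -> f z = 0).
Local Notation zord := (zord f).

Definition good (r : R) := forall a, nm a = r -> zord a = 0.
Definition zpos (a : C) : nat := if 0 <= zord a then `|zord a|%N else 0%N.
Definition zneg (a : C) : nat := if 0 <= zord a then 0%N else `|zord a|%N.

Lemma zordE_posneg a : (zord a)%:~R = (zpos a)%:R - (zneg a)%:R :> R.
Proof.
rewrite /zpos /zneg; case: (leP 0 (zord a)) => h.
  by rewrite subr0 -[in LHS](gez0_abs h).
rewrite sub0r; have -> : zord a = - (`|zord a|%:Z) by rewrite ltz0_abs// opprK.
by rewrite abszN absz_nat mulrNz.
Qed.

Lemma exists_good (u v : R) : 0 < u -> u < v -> v < R0 -> exists2 r, u < r < v & good r.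
Proof.
move=> u0 uv vR; have [s [_ hs]] := zord_finite f_loc f_nz u0 (ltW uv) vR.
have [r ruv rs] := avoid_seq (map nm s) uv; exists r => // a ar.
apply/eqP; apply: contraNT rs => a0; apply/mapP; exists a => //.
by rewrite hs a0 ar andbT; case/andP: ruv => /ltW -> /ltW ->.
Qed.

Lemma good_circle (r : R) z : 0 < r < R0 -> good r -> nm z = r ->
  hol_near_at f z /\ f z != 0.
Proof.
move=> rR gr zr; apply: (zord0_neq0 f_loc f_nz); first by rewrite zr.
exact: gr.
Qed.

Lemma rct_lnf (r : R) : 0 < r < R0 -> good r -> forall z, nm z = r ->
  rct (fun w => ln (nm (f w))) z.
Proof.
move=> rR gr z zr; have [h1 h2] := good_circle rR gr zr.
by apply: rct_ln => //; exact: hol_ccts (hol_near_hol h1).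
Qed.

Lemma zprod_ln (s : seq C) z : z \notin s ->
  ln (nm (zprod f s z)) = \sum_(b <- s) (zord b)%:~R * ln (nm (z - b)).
Proof.
move=> zs; have zb b : b \in s -> z - b != 0.
  by move=> bs; rewrite subr_eq0; apply: contraNneq zs => ->.
rewrite ln_nm_prod; last by apply/allP => b /zb h; rewrite expfz_neq0.
by apply: eq_big_seq => b /zb h; exact: ln_nm_expz.
Qed.

Lemma rmean_ln_factor (a b : R) (s : seq C) (G : C -> C) (r : R) : 0 < a ->
  b < R0 -> a <= r <= b -> good r ->
  (forall c, (c \in s) = [&& a <= nm c, nm c <= b & zord c != 0]) ->
  (forall z, a <= nm z <= b -> hol_near_at G z /\ G z != 0) ->
  (forall z, a <= nm z <= b -> z \notin s ->
       [/\ hol_near_at f z, f z != 0 & f z = zprod f s z * G z]) ->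
  rmean (fun w => ln (nm (f w))) r = rmean (fun w => ln (nm (G w))) r +
    \sum_(c <- s) (zord c)%:~R * ln (Num.max r (nm c)).
Proof.
move=> a0 bR ar gr hs hG hf.
have r0 : 0 < r by case/andP: ar => + _; exact: lt_le_trans.
have zs z : nm z = r -> z \notin s by move=> zr; rewrite hs gr// eqxx !andbF.
have cs c : c \in s -> nm c != r.
  by rewrite hs => /and3P[_ _]; apply: contra_neq => /gr.
have ct c : c \in s -> forall z, nm z = r -> rct (fun w => ln (nm (w - c))) z.
  move=> /cs cr z zr; apply: rct_ln_sub.
  by apply: contra_neq cr => <-.
have hG' z : nm z = r -> rct (fun w => ln (nm (G w))) z.
  move=> zr; have [|h1 h2] := hG z; first by rewrite zr.
  by apply: rct_ln => //; exact: hol_ccts (hol_near_hol h1).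
(* The default 0 makes every [u c] continuous on the circle, as [rmean_sum] asks for all indices. *)
pose u c w := if c \in s then (zord c)%:~R * ln (nm (w - c)) else 0.
have hu c z : nm z = r -> rct (u c) z.
  move=> zr; rewrite /u; have [cs'|cs'] := boolP (c \in s); last exact: rct_cst.
  by apply: rctZ; exact: ct.
have -> : rmean (fun w => ln (nm (f w))) r =
    rmean (fun w => ln (nm (G w)) + \sum_(c <- s) u c w) r.
  apply: eq_rmean; first exact: ltW.
  move=> z zr; have [|h1 h2 ->] := hf z _ (zs z zr); first by rewrite zr.
  have [|h3 h4] := hG z; first by rewrite zr.
  have h5 : zprod f s z != 0.
    rewrite prodf_seq_neq0; apply/allP => c c' /=; rewrite expfz_neq0// subr_eq0.
    by apply: contraNneq (zs z zr) => ->.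
  rewrite normcM lnM ?posrE ?nm_gt0// addrC zprod_ln; last exact: zs.
  by congr (_ + _); apply: eq_big_seq => c c'; rewrite /u c'.
have hS z : nm z = r -> rct (fun w => \sum_(c <- s) u c w) z.
  by move=> zr; apply: rct_sum => c; exact: hu.
rewrite (rmeanD (ltW r0) hG' hS) (rmean_sum s (ltW r0) hu); congr (_ + _).
apply: eq_big_seq => c c'; rewrite /u c' (rmeanZ _ (ltW r0) (ct c c')).
by rewrite (rmean_ln_sub r0 (cs c c')).
Qed.

(* The excess, at the radius [r], of [ln (max r l)] over the linear extrapolation
   in [ln r] of its values at the radii [r1 < r2]. *)
Definition excess (r1 r2 r l : R) : R :=
  ln (Num.max r l) - (ln (Num.max r1 l) +
    (ln r - ln r1) / (ln r2 - ln r1) * (ln (Num.max r2 l) - ln (Num.max r1 l))).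

Lemma excess_small r1 r2 r l : 0 < r -> r < r1 -> r1 < r2 -> l <= r ->
  excess r1 r2 r l = 0.
Proof.
move=> r0 rr1 r12 lr; have r10 := lt_trans r0 rr1; have r20 := lt_trans r10 r12.
have l1 := le_trans lr (ltW rr1); have l2 := le_trans l1 (ltW r12).
have h : ln r2 - ln r1 != 0 by rewrite subr_eq0 gt_eqF// ltr_ln.
by rewrite /excess !max_l//; field.
Qed.

Lemma excess_big r1 r2 r l : r < r1 -> r1 < r2 -> r2 <= l ->
  excess r1 r2 r l = 0.
Proof.
move=> rr1 r12 lr; rewrite /excess !max_r//; [ring|lra|lra].
Qed.

(** As a function of [ln l] the excess is a tent: it is zero up to [ln r], rises with slope 1 up to
    [ln r1], and falls linearly to zero at [ln r2]. *)
Lemma excess_bounds r1 r2 r l : 0 < r -> r < r1 -> r1 < r2 ->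
  0 <= excess r1 r2 r l <= ln r1 - ln r.
Proof.
move=> r0 rr1 r12; have r10 := lt_trans r0 rr1; have r20 := lt_trans r10 r12.
have s1 : ln r < ln r1 by rewrite ltr_ln.
have s2 : ln r1 < ln r2 by rewrite ltr_ln.
have [lr|rl] := leP l r; first by rewrite excess_small// lexx subr_ge0 ltW.
have [r2l|lr2] := leP r2 l; first by rewrite excess_big// lexx subr_ge0 ltW.
have l0 := lt_trans r0 rl.
have l1 : ln r < ln l by rewrite ltr_ln.
have l2 : ln l < ln r2 by rewrite ltr_ln.
rewrite /excess [Num.max r l]max_r ?(ltW rl)// [Num.max r2 l]max_l ?(ltW lr2)//.
have d0 : 0 < ln r2 - ln r1 by rewrite subr_gt0.
have [r1l|lr1] := leP r1 l.
  have l3 : ln r1 <= ln l by rewrite ler_ln.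
  have -> : ln l - (ln l + (ln r - ln r1) / (ln r2 - ln r1) * (ln r2 - ln l)) =
     (ln r1 - ln r) * ((ln r2 - ln l) / (ln r2 - ln r1)) by ring.
  apply/andP; split.
    by rewrite mulr_ge0 ?divr_ge0// subr_ge0 ltW.
  rewrite -[leRHS]mulr1; apply: ler_wpM2l; first by rewrite subr_ge0 ltW.
  by rewrite ler_pdivrMr// mul1r; lra.
have l3 : ln l < ln r1 by rewrite ltr_ln.
rewrite divfK ?gt_eqF//; apply/andP; split; lra.
Qed.

Lemma excess_mid r1 r2 r l : 0 < r -> r < r1 -> r1 < r2 -> r <= l <= r1 ->
  excess r1 r2 r l = ln l - ln r.
Proof.
move=> r0 rr1 r12 /andP[rl lr1]; have r10 := lt_trans r0 rr1; have r20 := lt_trans r10 r12.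
have h : ln r2 - ln r1 != 0 by rewrite subr_eq0 gt_eqF// ltr_ln.
have lr2 : l <= r2 by lra.
rewrite /excess [Num.max r l]max_r// [Num.max r1 l]max_l// [Num.max r2 l]max_l//.
by field.
Qed.

(** The mean of [ln |G|] is affine in [ln r], so it equals its extrapolation from the two reference
    circles and drops out; only the zeros and poles contribute. *)
Lemma jensen_excess (r1 r2 r : R) : 0 < r -> r < r1 -> r1 < r2 -> r2 < R0 ->
  good r -> good r1 -> good r2 ->
  let A x := rmean (fun w => ln (nm (f w))) x in
  exists s : seq C, [/\ uniq s,
    forall c, r <= nm c <= r2 -> zord c != 0 -> c \in s,
    forall c, c \in s -> 0 < nm c &
    A r - (A r1 + (ln r - ln r1) / (ln r2 - ln r1) * (A r2 - A r1)) =
    \sum_(c <- s) (zord c)%:~R * excess r1 r2 r (nm c)].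
Proof.
move=> r0 rr1 r12 r2R g0 g1 g2 A.
have r10 := lt_trans r0 rr1; have r20 := lt_trans r10 r12.
(* [rmean_ln_linear] wants the circles strictly inside the annulus where [G] is zero-free. *)
pose a := r / 2; pose b := (r2 + R0) / 2.
have a0 : 0 < a by rewrite divr_gt0.
have ar : a < r by rewrite /a; lra.
have bR : b < R0 by rewrite /b; lra.
have r2b : r2 < b by rewrite /b; lra.
have ab : a <= b by lra.
have [s [us hs]] := zord_finite f_loc f_nz a0 ab bR.
have [G [hG hf]] := zfactor f_loc f_nz a0 bR us hs.
exists s; split => //.
- by move=> c /andP[c1 c2] c0; rewrite hs c0 andbT; apply/andP; split; lra.
- by move=> c; rewrite hs => /and3P[+ _ _]; exact: lt_le_trans.
have F x : a <= x <= b -> good x -> A x = rmean (fun w => ln (nm (G w))) x +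
    \sum_(c <- s) (zord c)%:~R * ln (Num.max x (nm c)).
  by move=> xab gx; exact: (rmean_ln_factor a0 bR xab gx hs hG hf).
have ir : a <= r <= b by apply/andP; split; lra.
have ir1 : a <= r1 <= b by apply/andP; split; lra.
have ir2 : a <= r2 <= b by apply/andP; split; lra.
have L1 := rmean_ln_linear a0 ar (ltW rr1) (lt_trans r12 r2b) hG.
have L2 := rmean_ln_linear a0 ar (ltW (lt_trans rr1 r12)) r2b hG.
have h : ln r2 - ln r1 != 0 by rewrite subr_eq0 gt_eqF// ltr_ln.
rewrite (F r ir g0) (F r1 ir1 g1) (F r2 ir2 g2).
move: L1 L2; set g := rmean _ r; set g' := rmean _ r1; set g'' := rmean _ r2.
set c0 := complex.Re _ => L1 L2.
have -> : g' = g + c0 * (ln r1 - ln r) by lra.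
have -> : g'' = g + c0 * (ln r2 - ln r) by lra.
have -> : \sum_(c <- s) (zord c)%:~R * excess r1 r2 r (nm c) =
   \sum_(c <- s) (zord c)%:~R * ln (Num.max r (nm c)) -
   (\sum_(c <- s) (zord c)%:~R * ln (Num.max r1 (nm c)) +
    (ln r - ln r1) / (ln r2 - ln r1) *
     (\sum_(c <- s) (zord c)%:~R * ln (Num.max r2 (nm c)) -
      \sum_(c <- s) (zord c)%:~R * ln (Num.max r1 (nm c)))).
  rewrite -sumrB mulr_sumr -big_split /= -sumrB; apply: eq_bigr => c _.
  by rewrite /excess; ring.
move: (\sum_(c <- s) _ * ln (Num.max r _)) => S0.
move: (\sum_(c <- s) _ * ln (Num.max r1 _)) => S1.
move: (\sum_(c <- s) _ * ln (Num.max r2 _)) => S2.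
by field.
Qed.

End jensen_inequality.

(** * Upper bounds for the mean of [|ln |f||] and for the number of zeros *)

Section jensen_bound.
Variable R : realType.
Local Notation C := R[i].
Local Notation nm := (@normc R).
Variables (f : C -> C) (R0 : R).
Hypothesis f_loc : forall a, 0 < nm a < R0 ->
  hol_near_at f a \/ exists2 m : nat, (0 < m)%N & mform f a (- m%:Z).
Hypothesis f_nz : ~ (forall z, 0 < nm z < R0 -> f z = 0).
Local Notation zord := (zord f).

Lemma zpos_neq0 a : zpos f a != 0%N -> zord a != 0.
Proof. by apply: contra_neq => a0; rewrite /zpos a0. Qed.

Lemma zneg_neq0 a : zneg f a != 0%N -> zord a != 0.
Proof. by apply: contra_neq => a0; rewrite /zneg a0. Qed.

Lemma cnt_le (w : C -> nat) (t t' u u' : R) : (forall a, w a != 0%N -> zord a != 0) ->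
  0 < t' -> t' <= t -> t <= u -> u <= u' -> u' < R0 -> cnt w t u <= cnt w t' u'.
Proof.
move=> hw t0 tt tu uu uR.
have tu' : t' <= u' by apply: le_trans tt _; exact: le_trans uu.
have [s [us hs]] := zord_finite f_loc f_nz t0 tu' uR.
have hs' a : t' <= nm a <= u' -> w a != 0%N -> a \in s.
  by move=> /andP[a1 a2] /hw a0; rewrite hs a1 a2.
have sub a : t <= nm a <= u -> t' <= nm a <= u'.
  by move=> /andP[a1 a2]; rewrite (le_trans tt a1) (le_trans a2 uu).
rewrite (cntE us (fun a h => hs' a (sub a h))) (cntE us hs').
rewrite [leLHS]big_mkcond [leRHS]big_mkcond /=; apply: ler_sum => a _.
case: ifP => [/sub ->//|_]; case: ifP => // _; exact: ler0n.
Qed.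

Lemma rmean_logp (r : R) : 0 < r < R0 -> good f r ->
  2 * rmean (fun w => logp (nm (f w))) r =
  rmean (fun w => ln (nm (f w))) r + rmean (fun w => `|ln (nm (f w))|) r.
Proof.
move=> rR gr; have r0 : 0 <= r by case/andP: rR => /ltW.
have hl := rct_lnf f_loc f_nz rR gr.
have ha z (zr : nm z = r) := rct_norm (hl z zr).
rewrite -(rmeanD r0 hl ha).
have hS z : nm z = r -> rct (fun w => 2^-1 * (ln (nm (f w)) + `|ln (nm (f w))|)) z.
  by move=> zr; apply: rctZ; apply: rctD; [exact: hl|exact: ha].
have -> : rmean (fun w => logp (nm (f w))) r =
    rmean (fun w => 2^-1 * (ln (nm (f w)) + `|ln (nm (f w))|)) r.
  apply: eq_rmean => // z _; rewrite /logp; move: (ln _) => x.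
  by case: (leP 0 x) => x0; [rewrite ger0_norm//|rewrite ltr0_norm//]; lra.
rewrite rmeanZ//; last by move=> z zr; apply: rctD; [exact: hl|exact: ha].
by rewrite mulVKf.
Qed.

(** Since [|x| = 2 * logp - x] for [x = ln |f|], [jensen_excess] turns into one identity: the mean
    of [|ln |f||] plus the excess of the zeros equals twice the mean of the positive part, minus the
    extrapolated value, plus the excess of the poles. Both left-hand terms are nonnegative, so each
    is bounded by the right-hand side; a zero of modulus between [2 * r] and [r1] has excess at
    least [ln 2]. *)
Lemma jensen_bound (r1 r2 R' : R) : 0 < r1 -> r1 < r2 -> r2 <= R' -> R' < R0 ->
  good f r1 -> good f r2 -> exists2 K : R, 0 <= K & forall r, 0 < r -> r < r1 -> good f r ->
  let X := 2 * rmean (fun w => logp (nm (f w))) r +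
           (cnt (zneg f) r R' + K) * (1 + (ln r1 - ln r)) in
  rmean (fun w => `|ln (nm (f w))|) r <= X /\
  forall t, 2 * r <= t -> t <= r1 -> cnt (zpos f) t r1 * ln 2 <= X.
Proof.
move=> r10 r12 r2R' R'R g1 g2.
pose A x := rmean (fun w => ln (nm (f w))) x.
have d0 : 0 < ln r2 - ln r1 by rewrite subr_gt0 ltr_ln// posrE (lt_trans r10).
(* The extrapolation involves only the means over the reference circles, so it is at most
   [K * (1 + (ln r1 - ln r))]. *)
pose K := `|A r1| + (`|A r1| + `|A r2|) / (ln r2 - ln r1).
have K0 : 0 <= K by rewrite /K addr_ge0// divr_ge0 ?(ltW d0)// addr_ge0.
exists K => // r r0 rr1 gr X.
have r2R : r2 < R0 by exact: le_lt_trans R'R.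
have rR : 0 < r < R0 by rewrite r0/= (lt_trans rr1)// (lt_trans r12).
have [s [us hs hs0 E]] := jensen_excess f_loc f_nz r0 rr1 r12 r2R gr g1 g2.
have s1 : 0 < ln r1 - ln r by rewrite subr_gt0 ltr_ln.
set D := ln r1 - ln r in X s1 *.
have [zr1 rz1] : r <= r2 /\ r <= R' by split; lra.
have hN : \sum_(c <- s) (zneg f c)%:R * excess r1 r2 r (nm c) <= cnt (zneg f) r R' * D.
  apply: (@le_trans _ _ (cnt (zneg f) r r2 * D)); last first.
    by apply: ler_wpM2r; [exact: ltW|apply: cnt_le => //; exact: zneg_neq0].
  rewrite (cntE us (fun a h h' => hs a h (zneg_neq0 h'))) mulr_suml.
  rewrite [leRHS]big_mkcond /=; apply: ler_sum => c _.
  case: ifP => [_|].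
    by apply: ler_wpM2l; [exact: ler0n|have /andP[] := excess_bounds (nm c) r0 rr1 r12].
  move/negbT; rewrite negb_and -!ltNge => /orP[cr|rc].
    by rewrite excess_small ?mulr0// ltW.
  by rewrite excess_big ?mulr0// ltW.
have hP t : 2 * r <= t -> t <= r1 ->
    cnt (zpos f) t r1 * ln 2 <= \sum_(c <- s) (zpos f c)%:R * excess r1 r2 r (nm c).
  move=> rt tr1.
  have hst a : t <= nm a <= r1 -> zpos f a != 0%N -> a \in s.
    by move=> /andP[a1 a2] /zpos_neq0; apply: hs; apply/andP; split; lra.
  rewrite (cntE us hst) mulr_suml [leLHS]big_mkcond /=; apply: ler_sum => c _.
  case: ifP => [/andP[c1 c2]|_].
    have c0 : 0 < nm c by lra.
    apply: ler_wpM2l; first exact: ler0n.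
    rewrite excess_mid//; last by apply/andP; split; lra.
    by rewrite lerBrDr -lnM ?posrE// ler_ln ?posrE ?mulr_gt0// (le_trans rt).
  by apply: mulr_ge0; [exact: ler0n|have /andP[] := excess_bounds (nm c) r0 rr1 r12].
have hP0 : 0 <= \sum_(c <- s) (zpos f c)%:R * excess r1 r2 r (nm c).
  apply: sumr_ge0 => c _.
  by apply: mulr_ge0; [exact: ler0n|have /andP[] := excess_bounds (nm c) r0 rr1 r12].
have E2 : \sum_(c <- s) (zord c)%:~R * excess r1 r2 r (nm c) =
    \sum_(c <- s) (zpos f c)%:R * excess r1 r2 r (nm c) -
    \sum_(c <- s) (zneg f c)%:R * excess r1 r2 r (nm c).
  by rewrite -sumrB; apply: eq_bigr => c _; rewrite zordE_posneg mulrBl.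
have hE : `|A r1 + (ln r - ln r1) / (ln r2 - ln r1) * (A r2 - A r1)| <= K * (1 + D).
  apply: le_trans (ler_normD _ _) _.
  rewrite /K [leRHS]mulrDl; apply: lerD; first by rewrite ler_peMr//; lra.
  have i0 : 0 <= (ln r2 - ln r1)^-1 by rewrite invr_ge0 ltW.
  rewrite normrM normrM normfV (gtr0_norm d0) distrC (gtr0_norm s1).
  have h3 : `|A r2 - A r1| <= `|A r1| + `|A r2|.
    by have := ler_normB (A r2) (A r1); lra.
  have -> : (`|A r1| + `|A r2|) / (ln r2 - ln r1) * (1 + D) =
    (1 + D) / (ln r2 - ln r1) * (`|A r1| + `|A r2|) by ring.
  apply: ler_pM => //; first by rewrite mulr_ge0// ltW.
  by apply: ler_wpM2r => //; lra.
have ab := rmean_logp rR gr.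
have ha : 0 <= rmean (fun w => `|ln (nm (f w))|) r.
  apply: rmean_ge0; first exact: ltW.
    by move=> z zr; apply: rct_norm; exact: (rct_lnf f_loc f_nz rR gr zr).
  by move=> z _; exact: normr_ge0.
have c0 : 0 <= cnt (zneg f) r R'.
  rewrite /cnt; apply: fsumr_ge0 => a _; exact: ler0n.
move: hE; rewrite ler_norml => /andP[e1 e2].
move: E; rewrite E2 -/(A r) -/(A r1) -/(A r2) => E.
rewrite /X mulrDl mulrDr mulr1; rewrite -/(A r) in ab.
split; first by lra.
move=> t rt tr1; apply: le_trans (hP t rt tr1) _; lra.
Qed.

End jensen_bound.

(** * The logarithmic derivative *)

Section fourier.
Variable R : realType.
Local Notation C := R[i].
Local Notation nm := (@normc R).

Lemma mean_conj (F : C -> C) (r : R) : 0 <= r -> (forall z, nm z = r -> ccts F z) ->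
  mean (fun w => conjc (F w)) r = conjc (mean F r).
Proof.
move=> r0 hF; have hI := ccts_Im (circle_cts (a := 0) (b := 2 * pi) r0 hF).
rewrite !meanE /cint /=.
have -> : rint 0 (2 * pi) (fun t => complex.Re (conjc (F (pol r t)))) =
  rint 0 (2 * pi) (fun t => complex.Re (F (pol r t))).
  by apply: eq_rint => t _; case: (F _).
have -> : rint 0 (2 * pi) (fun t => complex.Im (conjc (F (pol r t)))) =
  - rint 0 (2 * pi) (fun t => complex.Im (F (pol r t))).
  rewrite -mulN1r -rintZ//; apply: eq_rint => t _; case: (F _) => x y /=.
  by rewrite mulN1r.
by rewrite !mulcE /=; congr (_ +i* _); ring.
Qed.

Lemma mean_nm_le (F : C -> C) (r : R) : 0 <= r -> (forall z, nm z = r -> ccts F z) ->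
  nm (mean F r) <= 2 * rmean (fun w => nm (F w)) r.
Proof.
move=> r0 hF; rewrite meanE normcM nm_real ger0_norm ?i2pi_ge0// /rmean mulrCA.
by apply: ler_wpM2l; [exact: i2pi_ge0|exact: cint_nm_le (circle_cts r0 hF)].
Qed.

Lemma ccts_conj (F : C -> C) z : ccts F z -> ccts (fun w => conjc (F w)) z.
Proof.
move=> h e /h; apply: filterS => w; congr (_ < _).
by rewrite -nm_conj rmorphB.
Qed.

Lemma inv_conj (w : C) (r : R) : 0 < r -> nm w = r -> w^-1 = conjc w * ((r ^+ 2)^-1)%:C.
Proof.
move=> r0 wr; have w0 : w != 0 by rewrite -nm_gt0 wr.
have r2 : (r ^+ 2)%:C != 0 :> C by rewrite -nm_gt0 nm_real normr_gt0 expf_neq0// gt_eqF.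
apply: (mulfI w0); rewrite mulfV// mulrA.
have -> : w * conjc w = (r ^+ 2)%:C.
  rewrite -wr nm_sqr; case: (w) => x y; rewrite /conjc mulcE; congr (_ +i* _) => /=; ring.
by rewrite -rmorphM mulfV// expf_neq0// gt_eqF.
Qed.

Section relation.
Variables (G : C -> C) (r : R).
Hypothesis r0 : 0 < r.
Hypothesis hG : forall z, nm z = r -> hol_near_at G z /\ G z != 0.

Let u (w : C) : R := ln (nm (G w)).
Let L (w : C) : C := w * dc G w / G w.

Let L_cts z : nm z = r -> ccts L z.
Proof. by move=> /hG[h1 h2]; apply: hol_ccts; exact: dlog_hol. Qed.

Let V_cts j z : nm z = r -> ccts (fun w => (u w)%:C * w^-1 ^+ j) z.
Proof.
move=> zr; have [h1 h2] := hG zr.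
apply: ccts_mul; first exact: rct_ln (hol_ccts (hol_near_hol h1)) h2.
apply: climX; apply: ccts_inv; last exact: ccts_id.
by rewrite -nm_gt0 zr.
Qed.

Let inv_cts j z : nm z = r -> ccts (fun w => w^-1 ^+ j) z.
Proof.
move=> zr; apply: climX; apply: ccts_inv; last exact: ccts_id.
by rewrite -nm_gt0 zr.
Qed.

(** Along the circle [ln |G|] has derivative the real part of ['i * L]. The function
    [u w * w^-1 ^+ j] is periodic in the angle, so its derivative has mean 0. *)
Let by_parts j :
  mean (fun w => (complex.Re ('i * L w))%:C * w^-1 ^+ j) r =
  'i * j%:R * mean (fun w => (u w)%:C * w^-1 ^+ j) r.
Proof.
pose dphi (w : C) := (complex.Re ('i * L w))%:C * w^-1 ^+ j -
  'i * j%:R * ((u w)%:C * w^-1 ^+ j).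
have Re_cts z : nm z = r -> ccts (fun w => (complex.Re ('i * L w))%:C * w^-1 ^+ j) z.
  move=> zr; apply: ccts_mul; last exact: inv_cts.
  apply: clim_real; apply: clim_ReP; apply: ccts_mul; first exact: ccts_const.
  exact: L_cts.
have d_cts z : nm z = r -> ccts dphi z.
  move=> zr; apply: ccts_sub; first exact: Re_cts.
  by apply: ccts_mul; [exact: ccts_const|exact: V_cts].
have D t : rder (fun t => (u (pol r t))%:C * (pol r t)^-1 ^+ j) t (dphi (pol r t)).
  have wr : nm (pol r t) = r by rewrite nm_pol// ltW.
  have w0 : pol r t != 0 by rewrite -nm_gt0 wr.
  have [h1 h2] := hG wr.
  have k1 := is_derive_ln_nm h2 (rder_comp (rder_pol_t r t) (dcP (hol_near_hol h1))).
  have k2 := rderX j (rderV w0 (rder_pol_t r t)).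
  have := rderM (rder_real k1) k2.
  congr (rder _ t _); rewrite /dphi /= -/(u _).
  have -> : dc G (pol r t) * ('i * pol r t) / G (pol r t) = 'i * L (pol r t).
    by rewrite /L; ring.
  have -> : - ('i * pol r t) / pol r t ^+ 2 = - 'i * (pol r t)^-1 by field.
  case: (j) => [|k] /=; first by rewrite !expr0 ?mulr0n; ring.
  by rewrite exprS; ring.
have F := cint_FTC (ltW (pi2_gt0 R)) (fun t _ => D t) (circle_cts (ltW r0) d_cts).
have E0 : mean dphi r = 0.
  rewrite meanE F.
  have -> : pol r (2 * pi) = pol r 0.
    by rewrite /pol /cis mulr_natl -[pi *+ 2]add0r cosD2pi sinD2pi.
  by rewrite subrr mulr0.
rewrite -(meanZ _ (ltW r0) (V_cts j)); apply/eqP; rewrite -subr_eq0; apply/eqP.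
rewrite -E0 /dphi meanB//; first exact: ltW.
by move=> z zr; apply: ccts_mul; [exact: ccts_const|exact: V_cts].
Qed.

(** Twice the real part of ['i * L] is ['i] times [L - conjc L], and on the circle [w^-1] is
    [conjc w / r ^+ 2], which converts the mean of [conjc L * w^-1 ^+ j] into the conjugate of the
    opposite coefficient. *)
Lemma fourier_relation j :
  mean (fun w => L w * w^-1 ^+ j) r -
    ((r ^+ 2)^-1 ^+ j)%:C * conjc (mean (fun w => L w * w ^+ j) r) =
  2 * j%:R * mean (fun w => (u w)%:C * w^-1 ^+ j) r.
Proof.
have Lj z : nm z = r -> ccts (fun w => L w * w ^+ j) z.
  by move=> zr; apply: ccts_mul; [exact: L_cts|apply: climX; exact: ccts_id].
have Lj' z : nm z = r -> ccts (fun w => L w * w^-1 ^+ j) z.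
  by move=> zr; apply: ccts_mul; [exact: L_cts|exact: inv_cts].
have Cj z : nm z = r -> ccts (fun w => ((r ^+ 2)^-1 ^+ j)%:C * conjc (L w * w ^+ j)) z.
  by move=> zr; apply: ccts_mul; [exact: ccts_const|apply: ccts_conj; exact: Lj].
rewrite -(mean_conj (ltW r0) Lj) -meanZ; [|exact: ltW|]; last first.
  by move=> z zr; apply: ccts_conj; exact: Lj.
rewrite -(meanB (ltW r0) Lj' Cj).
have i0 : ('i : C) != 0 by rewrite -nm_gt0 nm_i.
have Sj z (zr : nm z = r) := ccts_sub (Lj' z zr) (Cj z zr).
apply: (mulfI i0); rewrite -(meanZ 'i (ltW r0) Sj).
have -> : 'i * (2 * j%:R * mean (fun w => (u w)%:C * w^-1 ^+ j) r) =
   2 * ('i * j%:R * mean (fun w => (u w)%:C * w^-1 ^+ j) r) by ring.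
have Rj z : nm z = r -> ccts (fun w => (complex.Re ('i * L w))%:C * w^-1 ^+ j) z.
  move=> zr; apply: ccts_mul; last exact: inv_cts.
  apply: clim_real; apply: clim_ReP; apply: ccts_mul; first exact: ccts_const.
  exact: L_cts.
rewrite -by_parts -(meanZ 2 (ltW r0) Rj).
apply: eq_mean; first exact: ltW.
move=> w wr.
have -> : ((r ^+ 2)^-1 ^+ j)%:C * conjc (L w * w ^+ j) = conjc (L w) * w^-1 ^+ j.
  by rewrite (inv_conj r0 wr) rmorphM !rmorphXn exprMn /=; ring.
rewrite -mulrBl mulrA [in RHS]mulrA; congr (_ * _).
case: (L w) => x y; rewrite (_ : 2 = (2 : R)%:C); last by rewrite rmorph_nat.
by rewrite /conjc /= !mulcE; congr (_ +i* _) => /=; ring.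
Qed.

Lemma fourier_coef_le j : nm (mean (fun w => (u w)%:C * w^-1 ^+ j) r) <=
  2 * (rmean (fun w => `|u w|) r * r^-1 ^+ j).
Proof.
apply: le_trans (mean_nm_le (ltW r0) (V_cts j)) _.
rewrite ler_wpM2l// mulrC -rmeanZ; [|exact: ltW|]; last first.
  move=> z zr; have [h1 h2] := hG zr.
  by apply: rct_norm; exact: rct_ln (hol_ccts (hol_near_hol h1)) h2.
rewrite le_eqVlt; apply/orP; left; apply/eqP; apply: eq_rmean; first exact: ltW.
by move=> z zr; rewrite normcM nm_real nmX normcV zr mulrC.
Qed.

(** For [j = 0] the two coefficients coincide, and [fourier_relation] says that the mean equals its
    own conjugate. *)
Lemma Im_mean_dlog : complex.Im (mean L r) = 0.
Proof.
have := fourier_relation 0; rewrite mulr0 mul0r.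
have -> : mean (fun w => L w * w^-1 ^+ 0) r = mean L r.
  by apply: eq_mean; [exact: ltW|move=> w _; rewrite expr0 mulr1].
rewrite expr0 mul1r; case: (mean L r) => x y /= /(congr1 (@complex.Im R)) /=; lra.
Qed.
End relation.

Lemma sum_half_powers N : \sum_(j < N) (j.+1)%:R * (2^-1 : R) ^+ j.+1 <= 2.
Proof.
suff -> : \sum_(j < N) (j.+1)%:R * (2^-1 : R) ^+ j.+1 = 2 - (N%:R + 2) * 2^-1 ^+ N.
  by rewrite gerBl mulr_ge0 ?exprn_ge0 ?invr_ge0// addr_ge0.
elim: N => [|N ih]; first by rewrite big_ord0 expr0; ring.
rewrite big_ord_recr /= ih exprS -natr1.
by field.
Qed.

Lemma ln2_ge : 2^-1 <= ln 2 :> R.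
Proof.
have := @le_ln1Dx R (- 2^-1); have -> : 1 + - 2^-1 = 2^-1 :> R by field.
have l1 : -1 < - 2^-1 :> R by lra.
by move=> /(_ l1); rewrite lnV ?posrE// lerN2.
Qed.

Lemma geometric (x : C) N : x != 1 ->
  (1 - x)^-1 = \sum_(j < N) x ^+ j + x ^+ N / (1 - x).
Proof.
move=> x1; have d : 1 - x != 0 by rewrite subr_eq0 eq_sym.
elim: N => [|N ih]; first by rewrite big_ord0 expr0; field.
by rewrite big_ord_recr /= {1}ih exprS; field.
Qed.

End fourier.

(** * Iterated exponentials *)

Section order.
Variable R : realType.

Lemma iter_logp_ge0 n (x : R) : (0 < n)%N -> 0 <= iter_logp n x.
Proof. by case: n => // n _; rewrite /iter_logp /= /logp le_max lexx orbT. Qed.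

(** The truncation in [logp] is harmless: where it acts, the inner value is at most 1, and a
    nonpositive one is below any exponential. *)
Lemma iter_logp_le_exp n (x y : R) : iter_logp n x <= y -> x <= iter_exp n y.
Proof.
elim: n y => [//|n ih] y h; rewrite /iter_exp iterSr; apply: ih.
move: h; rewrite /iter_logp /= -/(iter_logp n x) /logp ge_max => /andP[h _]; case: (ltP 0 (iter_logp n x)) => x0.
  by rewrite -(lnK (x := iter_logp n x)) ?posrE// ler_expR.
exact: le_trans x0 (expR_ge0 _).
Qed.

(** The exponential of [- (sigma + delta) * ln r] is the negative power of [r]; it uses up one of
    the [n] exponentials. Positivity of the exponent holds because the quotients in the upper limit
    are nonnegative for [r < 1]. *)
Lemma iterated_order_growth (R' : R) n (f : R[i]^o -> R[i]^o) (sigma delta : R) :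
  (0 < n)%N -> iterated_order R' n f = sigma%:E -> 0 < delta ->
  0 < sigma + delta /\
  exists2 rho : R, 0 < rho & forall r, 0 < r -> r < rho ->
    T0 R' f r <= iter_exp n.-1 (expR (- (sigma + delta) * ln r)).
Proof.
move=> n0 ho d0; have : (iterated_order R' n f < (sigma + delta)%:E)%E.
  by rewrite ho lte_fin ltrDl.
rewrite /iterated_order /limf_esup => /ereal_inf_lt[_ [V [e /= e0 hV] <-] hs].
have hq (r : R) : 0 < r -> r < e -> iter_logp n (T0 R' f r) / - ln r < sigma + delta.
  move=> r0 re; rewrite -lte_fin; apply: le_lt_trans hs; apply: ereal_sup_ubound.
  by exists r => //; apply: hV => //=; rewrite sub0r normrN gtr0_norm.
have ln0 (r : R) : 0 < r -> r < 1 -> 0 < - ln r by move=> r0 r1; rewrite oppr_gt0 ln_lt0// r0.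
split.
  pose r := Num.min (e / 2) 2^-1.
  have [e2 h2] : 0 < e / 2 /\ e / 2 < e by split; lra.
  have r0 : 0 < r by rewrite lt_min e2 invr_gt0 ltr0n.
  have re : r < e by rewrite gt_min h2.
  have r1 : r < 1 by rewrite gt_min; apply/orP; right; lra.
  apply: le_lt_trans (hq r r0 re); apply: divr_ge0; first exact: iter_logp_ge0.
  exact: ltW (ln0 _ r0 r1).
exists (Num.min e 1) => [|r r0]; first by rewrite lt_min e0 ltr01.
rewrite lt_min => /andP[re r1]; have := hq r r0 re.
rewrite ltr_pdivrMr ?ln0// mulrN -mulNr => /ltW/iter_logp_le_exp.
by case: n n0 {ho hq hs hV} => // n _; rewrite /iter_exp iterSr.
Qed.
End order.

(** * Comparison of growth rates along the dyadic scale *)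

Section growth.
Variable R : realType.

Lemma iter_exp_ge n (x : R) : x <= iter_exp n x.
Proof.
elim: n => [//|n ih]; rewrite /iter_exp /= -/(iter_exp n x).
by apply: le_trans ih _; apply: le_trans (expR_ge1Dx _); lra.
Qed.

Lemma iter_exp_le n (x y : R) : x <= y -> iter_exp n x <= iter_exp n y.
Proof. by move=> xy; elim: n => [//|n ih]; rewrite /iter_exp /= ler_expR. Qed.

(** If [(|C| + 1) * U <= V] with [U >= 1], then [C * exp U <= exp (|C| + U) <= exp V]; so domination
    with every constant factor survives exponentiation. *)
Lemma iter_exp_dominated n (u v : nat -> R) : (forall m, 1 <= u m) ->
  (forall C : R, \forall m \near \oo, C * u m <= v m) ->
  forall C : R, \forall m \near \oo, C * iter_exp n (u m) <= iter_exp n (v m).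
Proof.
move=> u1 h; elim: n => [//|n ih] C; near=> m.
have E : (`|C| + 1) * iter_exp n (u m) <= iter_exp n (v m) by near: m; exact: ih.
have U1 : 1 <= iter_exp n (u m) by exact: le_trans (iter_exp_ge _ _).
have U2 : `|C| <= `|C| * iter_exp n (u m) by rewrite ler_peMr.
rewrite /iter_exp /= -/(iter_exp n (u m)) -/(iter_exp n (v m)).
apply: (@le_trans _ _ (expR `|C| * expR (iter_exp n (u m)))).
  apply: ler_wpM2r; first exact: expR_ge0.
  apply: le_trans (ler_norm _) _; apply: le_trans (expR_ge1Dx _); lra.
by rewrite -expRD ler_expR; lra.
Unshelve. all: end_near. Qed.

(** The shift by 7 reflects that [T0] is evaluated at radii down to [2 ^- m / 2 ^+ 7]. *)
Lemma expR_dominated (a b t t' : R) : 0 < t -> t < t' -> 0 < b -> forall C : R,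
  \forall m \near \oo, C * expR (t * ((m + 7)%:R * b)) <= expR (t' * (m%:R * b)).
Proof.
move=> t0 tt b0 C; have d0 : 0 < (t' - t) * b by rewrite mulr_gt0// subr_gt0.
near=> m.
have E : (`|C| + 7 * t * b) / ((t' - t) * b) <= m%:R by near: m; exact: nbhs_infty_ger.
rewrite ler_pdivrMr// in E.
apply: (@le_trans _ _ (expR `|C| * expR (t * ((m + 7)%:R * b)))).
  apply: ler_wpM2r; first exact: expR_ge0.
  apply: le_trans (ler_norm _) _; apply: le_trans (expR_ge1Dx _); lra.
rewrite -expRD ler_expR natrD; move: (m%:R) E => x E; nra.
Unshelve. all: end_near. Qed.

(** With at least one exponential, every factor on the left is at most the exponential of a constant
    times [U], the iterate with one exponential fewer. The product is thus at most [exp (C * U)],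
    and [iter_exp_dominated] absorbs [C]. *)
Lemma growth_comparison n k (t t' K A : R) : (0 < n)%N -> 0 < t -> t < t' -> 0 <= K -> 0 <= A ->
  \forall m \near \oo,
  expR 1 * (A * ((K + 8) * 2 ^+ m *
     iter_exp n (expR (t * ((m + 7)%:R * ln 2)))) ^+ 8) ^+ k
  <= iter_exp n (expR (t' * (m%:R * ln 2))) :> R.
Proof.
case: n => // n _ t0 tt K0 A0; have l0 : 0 < ln 2 :> R by rewrite ln_gt0// ltr1n.
pose u m : R := expR (t * ((m + 7)%:R * ln 2)).
have u1 m : 1 <= u m.
  by apply: le_trans (expR_ge1Dx _); rewrite lerDl !mulr_ge0// ltW.
(* [c1] is such that [m <= c1 * U], whence [2 ^+ m <= exp ((c1 + 1) * U)]; [a1] collects the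
   exponents of the three factors of the base. *)
pose c1 : R := (t * ln 2)^-1; pose a1 := K + 8 + (c1 + 1) + 1.
pose C := 1 + (A + a1 *+ 8) *+ k.
have dom := @iter_exp_dominated n u _ u1 (expR_dominated 0 t0 tt l0) C.
have iterS (x : R) : iter_exp n.+1 x = expR (iter_exp n x) by [].
near=> m.
have : C * iter_exp n (u m) <= iter_exp n (expR (t' * (m%:R * ln 2))).
  by near: m; exact: dom.
rewrite !iterS -/(u m); have := iter_exp_ge n (u m).
move: (iter_exp n (u m)) (iter_exp n (expR (t' * _))) => U V uU CU.
have U1 : 1 <= U by exact: le_trans (u1 m) uU.
apply: (@le_trans _ _ (expR (C * U))); last by rewrite ler_expR.
have le_exp (x : R) : 0 <= x -> x <= expR (x * U).
  move=> x0; apply: le_trans (expR_ge1Dx _).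
  have : x * 1 <= x * U by rewrite ler_wpM2l.
  lra.
have h1 : (2 : R) ^+ m <= expR ((c1 + 1) * U).
  have h2 : (2 : R) <= expR 1 by have := expR_ge1Dx (1 : R); lra.
  apply: (@le_trans _ _ (expR 1 ^+ m)); first by rewrite lerXn2r ?nnegrE ?expR_ge0.
  rewrite -expRM_natl ler_expR -mulr_natl mulr1 mulrDl mul1r.
  have : m%:R <= c1 * U.
    rewrite /c1 mulrC ler_pdivlMr ?mulr_gt0//; apply: le_trans uU.
    apply: le_trans (expR_ge1Dx _); rewrite natrD.
    have : 0 < t * ln 2 by rewrite mulr_gt0.
    move: (m%:R) => x; nra.
  lra.
have c0 : 0 <= c1 by rewrite invr_ge0 ltW// mulr_gt0.
have hW : (K + 8) * 2 ^+ m * expR U <= expR (a1 * U).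
  have -> : a1 * U = (K + 8) * U + (c1 + 1) * U + U by rewrite /a1; ring.
  rewrite !expRD ler_wpM2r ?expR_ge0//; apply: ler_pM => //; first lra.
  by apply: le_exp; lra.
have hW0 : 0 <= (K + 8) * 2 ^+ m * expR U.
  by rewrite !mulr_ge0 ?expR_ge0 ?exprn_ge0//; lra.
move: (_ * _ * expR U) hW hW0 => W hW hW0.
rewrite /C.
have hA : A <= expR (A * U) by exact: le_exp.
have hW8 : W ^+ 8 <= expR (8%:R * (a1 * U)).
  by rewrite expRM_natl lerXn2r ?nnegrE ?expR_ge0.
have hX : (A * W ^+ 8) ^+ k <= expR (k%:R * (A * U + 8%:R * (a1 * U))).
  rewrite expRM_natl lerXn2r ?nnegrE ?expR_ge0 ?mulr_ge0 ?exprn_ge0// expRD.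
  by apply: ler_pM => //; exact: exprn_ge0.
have X0 : 0 <= (A * W ^+ 8) ^+ k by rewrite exprn_ge0// mulr_ge0// exprn_ge0.
have -> : (1 + (A + a1 *+ 8) *+ k) * U = U + k%:R * (A * U + 8%:R * (a1 * U)).
  rewrite -[_ *+ k]mulr_natl -[_ *+ 8]mulr_natl; move: (k%:R) => x; ring.
by rewrite expRD; apply: ler_pM; rewrite ?expR_ge0 ?ler_expR.
Unshelve. all: end_near. Qed.
End growth.

(* [discriminate] weak-head normalises both sides of the equations between complex
   numbers of the context, which does not terminate in practice. *)
Ltac done ::=
  trivial; hnf; intros; solve
   [ do ![ solve [ trivial | simple refine (@sym_equal _ _ _ _); trivial ]
         | contradiction | split ]
   | match goal with H : ~ _ |- _ => solve [ case H; trivial ] end ].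

(** * The logarithmic derivative of a zero-free function on an annulus *)

Section log_derivative.
Variable R : realType.
Local Notation C := R[i].
Local Notation nm := (@normc R).

Lemma nm_nat (n : nat) : nm (n%:R : C) = n%:R.
Proof. by rewrite -(rmorph_nat (real_complex R)) nm_real ger0_norm. Qed.

(** The constant is [34 = 2 + 9 * 2 + 7 * 2]: central coefficient, positive and negative powers, the
    series [S] being at most 2. *)
Lemma sum_bound (c A D E1 E2 : C) (S M B h e : R) : nm c <= 2 * M ->
  nm A <= 9 * M * S -> nm D <= 7 * M * S -> M * S <= M * 2 ->
  nm E1 <= 2 * B * h -> nm E2 <= 2 * B * h -> 4 * B * h <= e ->
  nm (c + A + E2 + (D + E1)) <= 34 * M + e.
Proof.
move=> h1 h2 h3 h4 h5 h6 h7; apply: le_trans (nmD _ _) _.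
have := nmD (c + A) E2; have := nmD c A; have := nmD D E1; lra.
Qed.

Section annulus.
Variables (G : C -> C) (a b r1 r2 M : R).
Hypothesis a0 : 0 < a.
Hypothesis ar1 : a < r1.
Hypothesis r12 : 4 * r1 <= r2.
Hypothesis r2b : r2 < b.
Hypothesis hG : forall z, a <= nm z <= b -> hol_near_at G z /\ G z != 0.
Hypothesis M1 : rmean (fun w => `|ln (nm (G w))|) r1 <= M.
Hypothesis M2 : rmean (fun w => `|ln (nm (G w))|) r2 <= M.

Let L (w : C) : C := w * dc G w / G w.

Let r10 : 0 < r1. Proof. exact: lt_trans ar1. Qed.
Let r20 : 0 < r2. Proof. by apply: lt_le_trans r12; rewrite mulr_gt0. Qed.
Let r1r2 : r1 < r2. Proof. have := r10; have := r12; lra. Qed.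
Let ir1 z : nm z = r1 -> a <= nm z <= b.
Proof. by move=> ->; rewrite ltW//= ltW// (lt_trans r1r2). Qed.
Let ir2 z : nm z = r2 -> a <= nm z <= b.
Proof. by move=> ->; rewrite (ltW r2b) andbT ltW// (lt_trans ar1). Qed.

Let L_hol z : a <= nm z <= b -> hol L z.
Proof. by move=> /hG[h1 h2]; exact: dlog_hol. Qed.

Let p j := mean (fun w => L w * w^-1 ^+ j) r1.
Let q j := mean (fun w => L w * w ^+ j) r1.

Let p_r2 j : mean (fun w => L w * w^-1 ^+ j) r2 = p j.
Proof.
apply/esym; apply: mean_hol => //; first exact: ltW.
move=> z /andP[z1 z2]; have zr : a <= nm z <= b.
  by rewrite (le_trans (ltW ar1) z1) (le_trans z2 (ltW r2b)).
apply: holM; first exact: L_hol.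
apply: holX; apply: holV; last exact: hol_id.
by rewrite -nm_gt0 (lt_le_trans r10).
Qed.

Let q_r2 j : mean (fun w => L w * w ^+ j) r2 = q j.
Proof.
apply/esym; apply: mean_hol => //; first exact: ltW.
move=> z /andP[z1 z2]; have zr : a <= nm z <= b.
  by rewrite (le_trans (ltW ar1) z1) (le_trans z2 (ltW r2b)).
by apply: holM; [exact: L_hol|apply: holX; exact: hol_id].
Qed.

Let M0 : 0 <= M.
Proof.
apply: le_trans M1; apply: rmean_ge0; first exact: ltW.
  move=> z /ir1 /hG[h1 h2]; apply: rct_norm.
  exact: rct_ln (hol_ccts (hol_near_hol h1)) h2.
by move=> z _; exact: normr_ge0.
Qed.

Let coef_relation (r : R) j : 0 < r -> (forall z, nm z = r -> a <= nm z <= b) ->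
  rmean (fun w => `|ln (nm (G w))|) r <= M ->
  mean (fun w => L w * w^-1 ^+ j) r = p j -> mean (fun w => L w * w ^+ j) r = q j ->
  exists2 X : C, p j * (r ^+ j ^+ 2)%:C - conjc (q j) = X & nm X <= 4 * j%:R * M * r ^+ j.
Proof.
move=> r0 ir Mr Ep Eq; have hr z (zr : nm z = r) := hG (ir z zr).
have rel := fourier_relation r0 hr j; rewrite Ep Eq in rel.
set V := mean _ r in rel; have hV : nm V <= 2 * (M * r^-1 ^+ j).
  apply: le_trans (fourier_coef_le r0 hr j) _.
  apply: ler_wpM2l; first exact: ler0n.
  apply: ler_wpM2r; last exact: Mr.
  by rewrite exprn_ge0// invr_ge0 ltW.
have rj : r ^+ j != 0 by rewrite expf_neq0// gt_eqF.
clearbody V; exists (2 * j%:R * V * (r ^+ j ^+ 2)%:C).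
  rewrite -rel mulrBl; congr (_ - _).
  have K : (r ^+ 2)^-1 ^+ j * r ^+ j ^+ 2 = 1.
    by rewrite -exprM mulnC exprM -exprMn mulVf ?expr1n// expf_neq0// gt_eqF.
  by rewrite mulrAC -rmorphM K rmorph1 mul1r.
rewrite !normcM nm_nat nm_nat nm_real ger0_norm; last by rewrite !exprn_ge0// ltW.
have -> : 4 * j%:R * M * r ^+ j = 2 * j%:R * (2 * (M * r^-1 ^+ j)) * r ^+ j ^+ 2.
  by rewrite exprVn; field.
apply: ler_wpM2r; first by rewrite !exprn_ge0// ltW.
by apply: ler_wpM2l => //; rewrite mulr_ge0.
Qed.

Let pow_quarter j : (0 < j)%N -> r1 ^+ j <= r2 ^+ j / 4.
Proof.
case: j => [j0|j _]; first discriminate j0.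
have h : r1 <= r2 / 4 by rewrite ler_pdivlMr// mulrC.
rewrite !exprS [leRHS]mulrAC; apply: ler_pM => //; first exact: ltW.
  by rewrite exprn_ge0// ltW.
by rewrite lerXn2r ?nnegrE ?ltW.
Qed.

(** The relations on the two circles form a linear system in [p j] and [conjc (q j)]. Subtracting
    them eliminates [q j], and [4 * r1 <= r2] keeps the determinant [r2 ^+ j ^+ 2 - r1 ^+ j ^+ 2]
    comparable to its first term. The constants 9 and 7 are rounded up. *)
Let coef_bound j : (0 < j)%N ->
  nm (p j) * r2 ^+ j <= 9 * j%:R * M /\ nm (q j) <= 7 * j%:R * M * r1 ^+ j.
Proof.
move=> j0.
have [X1 E1 b1] := coef_relation r10 ir1 M1 (erefl (p j)) (erefl (q j)).
have [X2 E2 b2] := coef_relation r20 ir2 M2 (p_r2 j) (q_r2 j).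
move: (p j) (q j) E1 E2 => P Q E1 E2.
have xy := pow_quarter j0.
have x0 : 0 < r1 ^+ j by rewrite exprn_gt0.
have y0 : 0 < r2 ^+ j by rewrite exprn_gt0.
move: (r1 ^+ j) (r2 ^+ j) xy x0 y0 b1 b2 E1 E2 => x y xy x0 y0 b1 b2 E1 E2.
have J0 : 0 <= j%:R * M by rewrite mulr_ge0.
have h1 : nm P * (y ^+ 2 - x ^+ 2) <= 4 * (j%:R * M) * (x + y).
  have yx0 : 0 <= y ^+ 2 - x ^+ 2 by nra.
  have -> : nm P * (y ^+ 2 - x ^+ 2) = nm (X2 - X1).
    have -> : X2 - X1 = P * (y ^+ 2 - x ^+ 2)%:C by rewrite -E1 -E2 rmorphB; ring.
    by rewrite normcM nm_real ger0_norm.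
  apply: le_trans (nmB _ _) _; nra.
have P0 := nm_ge0 P.
have h2 : nm P * y <= 9 * (j%:R * M).
  have k1 : 15 / 16 * y ^+ 2 <= y ^+ 2 - x ^+ 2.
    have : x ^+ 2 <= (y / 4) ^+ 2 by rewrite ler_sqr ?nnegrE ?divr_ge0 ?(ltW x0) ?(ltW y0).
    by rewrite exprMn exprVn; lra.
  have k2 : nm P * (15 / 16 * y ^+ 2) <= 4 * (j%:R * M) * (x + y).
    by apply: le_trans h1; exact: ler_wpM2l.
  have k3 : 4 * (j%:R * M) * (x + y) <= 5 * (j%:R * M) * y.
    have : j%:R * M * x <= j%:R * M * (y / 4) by exact: ler_wpM2l.
    lra.
  have k4 : (nm P * (15 / 16) * y) * y <= (5 * (j%:R * M)) * y.
    apply: le_trans k3; apply: le_trans k2; rewrite le_eqVlt; apply/orP; left.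
    by apply/eqP; ring.
  rewrite ler_pM2r// in k4; lra.
split; first by rewrite -mulrA.
have -> : nm Q = nm (P * (x ^+ 2)%:C - X1).
  by rewrite -nm_conj -E1; congr nm; ring.
apply: le_trans (nmB _ _) _.
rewrite normcM nm_real ger0_norm ?sqr_ge0//.
have h3 : nm P * x ^+ 2 <= 9 / 4 * (j%:R * M) * x.
  have : nm P * x <= nm P * (y / 4) by exact: ler_wpM2l.
  by move=> h3; rewrite expr2 [leLHS]mulrA; apply: ler_wpM2r; [exact: ltW|lra].
have : 0 <= j%:R * M * x by rewrite mulr_ge0// ltW.
lra.
Qed.

(** For [j = 0] the Fourier relation only says that [p 0] is real. Its real part is the slope of the
    mean of [ln |G|] between the two circles, which are at least [ln 4 >= 1] apart in [ln r]. *)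
Let c0_bound : nm (p 0) <= 2 * M.
Proof.
have E : p 0 = mean L r1 by apply: eq_mean; [exact: ltW|move=> w _; rewrite expr0 mulr1].
have I0 : complex.Im (p 0) = 0.
  by rewrite E; apply: Im_mean_dlog => // z /ir1 /hG.
have := rmean_ln_linear a0 ar1 (ltW r1r2) r2b hG.
rewrite -/L -E => H.
have l2 := ln2_ge R.
have l4 : 1 <= ln r2 - ln r1.
  rewrite -ln_div ?posrE//.
  apply: (@le_trans _ _ (ln 4)).
    have -> : 4 = 2 ^+ 2 :> R by ring.
    by rewrite lnXn// mulr2n; lra.
  by rewrite ler_ln ?posrE ?divr_gt0// ler_pdivlMr.
have bd (r : R) : 0 < r -> (forall z, nm z = r -> a <= nm z <= b) ->
   rmean (fun w => `|ln (nm (G w))|) r <= M -> `|rmean (fun w => ln (nm (G w))) r| <= M.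
  move=> r0 ir Mr.
  have hc z : nm z = r -> rct (fun w => ln (nm (G w))) z.
    move=> /ir /hG[h1 h2]; exact: rct_ln (hol_ccts (hol_near_hol h1)) h2.
  apply: le_trans Mr; rewrite ler_norml; apply/andP; split.
    rewrite -mulN1r -rmeanZ; [|exact: ltW|by move=> z /hc; exact: rct_norm].
    apply: rmean_le => //; first exact: ltW.
      by move=> z /hc /rct_norm; exact: rctZ.
    by move=> z _; have := lerNnormlW (lexx `|ln (nm (G z))|); lra.
  apply: rmean_le => //; first exact: ltW.
    by move=> z /hc; exact: rct_norm.
  by move=> z _; exact: ler_norm.
have b1 := bd r1 r10 ir1 M1; have b2 := bd r2 r20 ir2 M2.
apply: le_trans (nm_le_ReIm _) _; rewrite I0 normr0 addr0.
apply: (@le_trans _ _ (`|complex.Re (p 0)| * (ln r2 - ln r1))).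
  by rewrite ler_peMr.
rewrite -[ln r2 - ln r1]ger0_norm; last by lra.
rewrite -normrM -H; apply: le_trans (ler_normB _ _) _; lra.
Qed.

Variable z : C.
Hypothesis z1 : 2 * r1 <= nm z.
Hypothesis z2 : 2 * nm z <= r2.

Let z0 : z != 0.
Proof. by rewrite -nm_gt0; apply: lt_le_trans z1; rewrite mulr_gt0. Qed.

(** The geometric series of the Cauchy kernel in [z / w], stopped at finite order with an explicit
    remainder in place of a Laurent series. *)
Let expansion_out N : exists2 E : C, mean (fun w => L w * (w / (w - z))) r2 =
   \sum_(j < N.+1) z ^+ j * p j + E &
   forall B, (forall w, nm w = r2 -> nm (L w) <= B) -> nm E <= 2 * B * 2^-1 ^+ N.
Proof.
have q2 w : nm w = r2 -> nm (z / w) <= 2^-1.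
  by move=> wr; rewrite normcM normcV wr ler_pdivrMr//; have := z2; lra.
have w0 w : nm w = r2 -> w != 0 by move=> wr; rewrite -nm_gt0 wr.
have n1 w : nm w = r2 -> 1 - z / w != 0.
  move=> wr; rewrite -nm_gt0; have := nm_subl (z / w) 1; have := q2 w wr.
  rewrite normc1; lra.
pose e (w : C) := L w * ((z / w) ^+ N.+1 / (1 - z / w)).
have c1 w : nm w = r2 -> ccts L w by move=> /ir2 /L_hol; exact: hol_ccts.
have ci w : nm w = r2 -> ccts (fun w => w^-1) w.
  by move=> wr; apply: ccts_inv; [exact: w0|exact: ccts_id].
have c2 w : nm w = r2 -> ccts e w.
  move=> wr; apply: ccts_mul; first exact: c1.
  have c3 : ccts (fun w => z / w) w by apply: ccts_mul; [exact: ccts_const|exact: ci].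
  apply: ccts_mul; first exact: climX.
  apply: ccts_inv; first exact: n1.
  by apply: ccts_sub => //; exact: ccts_const.
pose t (j : 'I_N.+1) (w : C) := z ^+ j * (L w * w^-1 ^+ j).
have c4 j w : nm w = r2 -> ccts (t j) w.
  move=> wr; apply: ccts_mul; first exact: ccts_const.
  by apply: ccts_mul; [exact: c1|apply: climX; exact: ci].
exists (mean e r2).
  have -> : \sum_(j < N.+1) z ^+ j * p j = mean (fun w => \sum_(j < N.+1) t j w) r2.
    rewrite mean_sum ?(ltW r20)//; apply: eq_bigr => j _.
    rewrite /t meanZ ?p_r2 ?(ltW r20)// => w wr.
    by apply: ccts_mul; [exact: c1|apply: climX; exact: ci].
  rewrite -meanD ?(ltW r20)//; last by move=> w wr; apply: clim_sum => j; exact: c4.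
  apply: eq_mean; first exact: ltW.
  move=> w wr; have -> : w / (w - z) = (1 - z / w)^-1.
    have h := n1 w wr; have h' := w0 w wr.
    have h2 : w - z != 0.
      have -> : w - z = w * (1 - z / w) by field.
      exact: mulf_neq0.
    by field; rewrite h2 h'.
  rewrite (@geometric _ _ N.+1); last by rewrite -subr_eq0 -opprB oppr_eq0 n1.
  rewrite mulrDr mulr_sumr; congr (_ + _); apply: eq_bigr => j _.
  by rewrite /t exprMn; ring.
move=> B hB; have -> : 2 * B * 2^-1 ^+ N = 2 * (B * (2^-1 ^+ N.+1 * 2)).
  by rewrite exprS; field.
apply: mean_le => //; first exact: ltW.
move=> w wr; rewrite (normcM (L w)); apply: ler_pM; [exact: nm_ge0|exact: nm_ge0|exact: hB|].
rewrite (normcM (_ ^+ _)) nmX normcV.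
apply: ler_pM; rewrite ?exprn_ge0 ?invr_ge0 ?nm_ge0//.
  by rewrite lerXn2r ?nnegrE ?nm_ge0 ?q2// invr_ge0.
rewrite -[2]invrK lef_pV2 ?posrE ?invr_gt0 ?nm_gt0 ?n1//.
by have := nm_subl (z / w) 1; have := q2 w wr; rewrite normc1; lra.
Qed.

(** On the inner circle the kernel is [1 - (1 - w / z)^-1]: the leading term of the geometric series
    cancels the 1, so the powers start at 1. *)
Let expansion_in N : exists2 E : C, mean (fun w => L w * (w / (w - z))) r1 =
   - (\sum_(j < N) z^-1 ^+ j.+1 * q j.+1 + E) &
   forall B, (forall w, nm w = r1 -> nm (L w) <= B) -> nm E <= 2 * B * 2^-1 ^+ N.
Proof.
have q2 w : nm w = r1 -> nm (w / z) <= 2^-1.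
  by move=> wr; rewrite normcM normcV wr ler_pdivrMr ?nm_gt0//; have := z1; lra.
have n1 w : nm w = r1 -> 1 - w / z != 0.
  move=> wr; rewrite -nm_gt0; have := nm_subl (w / z) 1; have := q2 w wr.
  rewrite normc1; lra.
pose e (w : C) := L w * ((w / z) ^+ N.+1 / (1 - w / z)).
have c1 w : nm w = r1 -> ccts L w by move=> /ir1 /L_hol; exact: hol_ccts.
have c2 w : nm w = r1 -> ccts e w.
  move=> wr; apply: ccts_mul; first exact: c1.
  have c3 : ccts (fun w => w / z) w by apply: ccts_mul; [exact: ccts_id|exact: ccts_const].
  apply: ccts_mul; first exact: climX.
  apply: ccts_inv; first exact: n1.
  by apply: ccts_sub => //; exact: ccts_const.
pose t (j : 'I_N) (w : C) := z^-1 ^+ j.+1 * (L w * w ^+ j.+1).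
have c4 j w : nm w = r1 -> ccts (t j) w.
  move=> wr; apply: ccts_mul; first exact: ccts_const.
  by apply: ccts_mul; [exact: c1|apply: climX; exact: ccts_id].
have c5 w : nm w = r1 -> ccts (fun w => \sum_(j < N) t j w) w.
  by move=> wr; apply: clim_sum => j; exact: c4.
exists (mean e r1).
  have -> : \sum_(j < N) z^-1 ^+ j.+1 * q j.+1 = mean (fun w => \sum_(j < N) t j w) r1.
    rewrite mean_sum ?(ltW r10)//; apply: eq_bigr => j _.
    rewrite /t meanZ ?(ltW r10)// => w wr.
    by apply: ccts_mul; [exact: c1|apply: climX; exact: ccts_id].
  rewrite -meanD ?(ltW r10)// -[RHS]mulN1r -meanZ ?(ltW r10)//; last first.
    by move=> w wr; apply: ccts_add; [exact: c5|exact: c2].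
  apply: eq_mean; first exact: ltW.
  move=> w wr; have h := n1 w wr.
  have E1 : w / (w - z) = 1 - (1 - w / z)^-1.
    have h2 : w - z != 0.
      have -> : w - z = - z * (1 - w / z) by field; exact: z0.
      by rewrite mulf_neq0// oppr_eq0.
    have h3 : z - w != 0 by rewrite -opprB oppr_eq0.
    by field; rewrite z0 h2 h3.
  rewrite E1 (@geometric _ _ N.+1); last by rewrite -subr_eq0 -opprB oppr_eq0 n1.
  rewrite big_ord_recl expr0 mulN1r /e.
  have -> : \sum_(j < N) t j w = L w * \sum_(j < N) (w / z) ^+ (lift ord0 j).
    by rewrite mulr_sumr; apply: eq_bigr => j _; rewrite /t exprMn /=; ring.
  ring.
move=> B hB; have -> : 2 * B * 2^-1 ^+ N = 2 * (B * (2^-1 ^+ N.+1 * 2)).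
  by rewrite exprS; field.
apply: mean_le => //; first exact: ltW.
move=> w wr; rewrite (normcM (L w)); apply: ler_pM; [exact: nm_ge0|exact: nm_ge0|exact: hB|].
rewrite (normcM (_ ^+ _)) nmX normcV.
apply: ler_pM; rewrite ?exprn_ge0 ?invr_ge0 ?nm_ge0//.
  by rewrite lerXn2r ?nnegrE ?nm_ge0 ?q2// invr_ge0.
rewrite -[2]invrK lef_pV2 ?posrE ?invr_gt0 ?nm_gt0 ?n1//.
by have := nm_subl (w / z) 1; have := q2 w wr; rewrite normc1; lra.
Qed.

(** Since [z] is a factor 2 away from both circles, the bound of order [j * M] on the [j]-th
    normalised coefficient meets [2^-1 ^+ j], and the series converges. *)
Lemma log_derivative_annulus : nm (z * dc G z / G z) <= 34 * M.
Proof.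
have ab : a <= b by rewrite ltW// (lt_trans ar1)// (lt_trans r1r2).
(* [B] depends on [G] and is not estimated; it only enters the remainders, which vanish as [N]
   grows. *)
have [B B0 hB] := annulus_bounded (ltW a0) ab (fun z zr => hol_ccts (L_hol zr)).
apply/ler_addgt0Pr => e e0.
have [N hN] : exists N, 2^-1 ^+ N < e / (4 * B + 1).
  by apply: exists_half_lt; rewrite divr_gt0// ltr_wpDl// mulr_ge0.
have zr : r1 < nm z < r2 by have := r10; have := z1; have := z2; move=> *; apply/andP; split; lra.
have Lr w : r1 <= nm w <= r2 -> hol L w.
  move=> /andP[w1 w2]; apply: L_hol.
  by rewrite (le_trans (ltW ar1) w1) (le_trans w2 (ltW r2b)).
have CA := cauchy_annulus r10 zr Lr.
have [E2 H2 b2] := expansion_out N; have [E1 H1 b1] := expansion_in N.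
rewrite H2 H1 opprK in CA.
have {}b2 := b2 B (fun w wr => hB w (ir2 wr)).
have {}b1 := b1 B (fun w wr => hB w (ir1 wr)).
rewrite -/(L z) CA big_ord_recl expr0 mul1r.
have nz : 0 < nm z by rewrite nm_gt0 z0.
have tp : nm (\sum_(j < N) z ^+ (lift ord0 j) * p (lift ord0 j)) <=
    9 * M * \sum_(j < N) (j.+1)%:R * (2^-1 : R) ^+ j.+1.
  apply: le_trans (nm_sum _ _ _) _; rewrite mulr_sumr; apply: ler_sum => j _.
  have -> : lift ord0 j = j.+1 :> nat by [].
  have [h _] := coef_bound (ltn0Sn j).
  rewrite normcM nmX.
  apply: (@le_trans _ _ ((r2 / 2) ^+ j.+1 * nm (p j.+1))).
    apply: ler_wpM2r; first exact: nm_ge0.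
    rewrite lerXn2r ?nnegrE ?nm_ge0 ?divr_ge0 ?(ltW r20)//.
    by rewrite ler_pdivlMr//; have := z2; lra.
  rewrite exprMn mulrAC (mulrC (r2 ^+ _)).
  have -> : 9 * M * ((j.+1)%:R * 2^-1 ^+ j.+1) = 9 * (j.+1)%:R * M * 2^-1 ^+ j.+1 by ring.
  by apply: ler_wpM2r => //; rewrite exprn_ge0// invr_ge0.
have tq : nm (\sum_(j < N) z^-1 ^+ j.+1 * q j.+1) <=
    7 * M * \sum_(j < N) (j.+1)%:R * (2^-1 : R) ^+ j.+1.
  apply: le_trans (nm_sum _ _ _) _; rewrite mulr_sumr; apply: ler_sum => j _.
  have [_ h] := coef_bound (ltn0Sn j).
  rewrite normcM nmX normcV.
  have hz : (nm z)^-1 <= 2^-1 / r1.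
    by rewrite -invfM lef_pV2 ?posrE ?mulr_gt0//; have := z1; lra.
  apply: (@le_trans _ _ ((2^-1 / r1) ^+ j.+1 * (7 * (j.+1)%:R * M * r1 ^+ j.+1))).
    apply: ler_pM => //; rewrite ?exprn_ge0 ?invr_ge0 ?nm_ge0//.
    by rewrite lerXn2r ?nnegrE ?invr_ge0 ?nm_ge0 ?divr_ge0 ?(ltW r10)// invr_ge0.
  have x0 : r1 ^+ j.+1 != 0 by rewrite expf_neq0// gt_eqF.
  rewrite exprMn [r1^-1 ^+ _]exprVn le_eqVlt; apply/orP; left; apply/eqP.
  by move: (2^-1 ^+ _) => h2; field; rewrite x0.
have S2 := sum_half_powers R N; set S := \sum_(j < N) _ in S2 tp tq.
have c0 := c0_bound.
have MS : M * S <= M * 2 by apply: ler_wpM2l => //; exact: M0.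
have eB : 4 * B * 2^-1 ^+ N <= e.
  have K : 0 < 4 * B + 1 by rewrite ltr_wpDl// mulr_ge0.
  move: hN; rewrite ltr_pdivlMr// => hN.
  apply: le_trans (ltW hN); rewrite [leRHS]mulrC; apply: ler_wpM2r; last by rewrite lerDl.
  by rewrite exprn_ge0// invr_ge0.
exact: (sum_bound c0 tp tq MS b1 b2 eB).
Qed.
End annulus.

End log_derivative.

(** * From the zero-free factor to [f' / f], and from there to the higher derivatives *)

Section kth_derivative.
Variable R : realType.
Local Notation C := R[i].
Local Notation nm := (@normc R).

Lemma ler_sum_seq (I : eqType) (r : seq I) (F G : I -> R) :
  (forall i, i \in r -> F i <= G i) -> \sum_(i <- r) F i <= \sum_(i <- r) G i.
Proof. by move=> h; rewrite big_seq [leRHS]big_seq; apply: ler_sum => i /h. Qed.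

Lemma cder_zprod (n : C -> int) (s : seq C) z : z \notin s ->
  cder (fun w => \prod_(b <- s) (w - b) ^ n b) z
    (\prod_(b <- s) (z - b) ^ n b * \sum_(b <- s) (n b)%:~R / (z - b)).
Proof.
elim: s => [_|b s ih].
  rewrite !big_nil mulr0; under eq_fun do rewrite big_nil; exact: cder_cst.
rewrite inE negb_or => /andP[zb zs]; rewrite !big_cons.
under eq_fun do rewrite big_cons.
have zb0 : z - b != 0 by rewrite subr_eq0.
have h1 : cder (fun w => w - b) z 1.
  by have := cderB (cder_id z) (cder_cst b z); rewrite subr0.
have h2 : cder (fun w => (w - b) ^ n b) z ((z - b) ^ n b * ((n b)%:~R / (z - b))).
  case: (n b) => m.
    have := cderX m h1; congr (cder _ z _); case: m => [|m] /=; first by rewrite !mul0r mulr0.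
    rewrite -exprnP exprSr mulr1 -pmulrn.
    by move: (m.+1%:R) => q; field.
  have hp : (z - b) ^+ m.+1 != 0 by rewrite expf_neq0.
  have := @cderV _ (fun w => (w - b) ^+ m.+1) z _ hp (cderX m.+1 h1); congr (cder _ z _).
  rewrite NegzE mulrNz -exprnN -pmulrn /= expr2 [(z - b) ^+ m.+1]exprS.
  have hm : (z - b) ^+ m != 0 by rewrite expf_neq0.
  by move: (m.+1%:R) => q; field; rewrite zb0 hm.
have := cderM h2 (ih zs); congr (cder _ z _).
by rewrite mulrDr; ring.
Qed.

Section first.
Variables (f : C -> C) (R0 : R).
Hypothesis f_loc : forall a, 0 < nm a < R0 ->
  hol_near_at f a \/ exists2 m : nat, (0 < m)%N & mform f a (- m%:Z).
Hypothesis f_nz : ~ (forall z, 0 < nm z < R0 -> f z = 0).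
Local Notation zord := (zord f).

Lemma nm_zord c : nm ((zord c)%:~R : C) = (zpos f c)%:R + (zneg f c)%:R.
Proof.
rewrite /zpos /zneg; case: (leP 0 (zord c)) => h.
  by rewrite addr0 -[in LHS](gez0_abs h) -pmulrn nm_nat.
rewrite add0r -(nm_nat _ `|zord c|%N) -nmN -mulrNz; congr nm.
by rewrite -[in LHS](ltz0_abs h) -pmulrn.
Qed.

Section bounds.
Variables (a b r1 r2 Mf N : R).
Hypothesis a0 : 0 < a.
Hypothesis ar1 : a < r1.
Hypothesis r12 : 4 * r1 <= r2.
Hypothesis r2b : r2 < b.
Hypothesis b2 : b <= 2^-1.
Hypothesis bR : b < R0.
Hypothesis g1 : good f r1.
Hypothesis g2 : good f r2.
Hypothesis M1 : rmean (fun w => `|ln (nm (f w))|) r1 <= Mf.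
Hypothesis M2 : rmean (fun w => `|ln (nm (f w))|) r2 <= Mf.
Hypothesis hN : cnt (zpos f) a b + cnt (zneg f) a b <= N.

Let r1_le1 : r1 <= 1.
Proof.
have h : 2^-1 <= 1 :> R by lra.
have r10 : 0 < r1 := lt_trans a0 ar1.
apply: le_trans h; apply: le_trans b2.
by have := r12; have := r2b; lra.
Qed.

(** As [b <= 2^-1], all distances [|z - c|] are at most 1, so the absolute values of their
    logarithms are the opposites of these logarithms. Their means are then known exactly from
    [rmean_ln_sub], each being at most [- ln r1]. *)
Lemma rmean_factor_le (s : seq C) (G : C -> C) (r : R) : uniq s ->
  (forall c, (c \in s) = [&& a <= nm c, nm c <= b & zord c != 0]) ->
  (forall z, a <= nm z <= b -> hol_near_at G z /\ G z != 0) ->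
  (forall z, a <= nm z <= b -> z \notin s ->
       [/\ hol_near_at f z, f z != 0 & f z = zprod f s z * G z]) ->
  r1 <= r <= r2 -> good f r -> rmean (fun w => `|ln (nm (f w))|) r <= Mf ->
  rmean (fun w => `|ln (nm (G w))|) r <= Mf + N * (- ln r1).
Proof.
move=> us hs hG hf /andP[rr1 rr2] gr Mr.
have r10 : 0 < r1 by exact: lt_trans ar1.
have r0 : 0 < r by exact: lt_le_trans rr1.
have ir z : nm z = r -> a <= nm z <= b.
  by move=> ->; rewrite (le_trans (ltW ar1) rr1) (le_trans rr2 (ltW r2b)).
have rR : 0 < r < R0 by rewrite r0 (le_lt_trans rr2 (lt_trans r2b bR)).
have zs z : nm z = r -> z \notin s by move=> zr; rewrite hs gr// eqxx !andbF.
have cs c : c \in s -> nm c != r.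
  by rewrite hs => /and3P[_ _]; apply: contra_neq => /gr.
have ct c : c \in s -> forall z, nm z = r -> rct (fun w => ln (nm (w - c))) z.
  move=> /cs cr z zr; apply: rct_ln_sub.
  by apply: contra_neq cr => <-.
pose u c w := if c \in s then - ((zpos f c)%:R + (zneg f c)%:R) * ln (nm (w - c)) else 0.
have hu c z : nm z = r -> rct (u c) z.
  move=> zr; rewrite /u; have [c'|c'] := boolP (c \in s); last exact: rct_cst.
  by apply: rctZ; exact: ct.
have hc z : nm z = r -> rct (fun w => `|ln (nm (f w))|) z.
  by move=> zr; apply: rct_norm; exact: (rct_lnf f_loc f_nz rR gr zr).
have hS z : nm z = r -> rct (fun w => \sum_(c <- s) u c w) z.
  by move=> zr; apply: rct_sum => c; exact: hu.
apply: (@le_trans _ _ (rmean (fun w => `|ln (nm (f w))| + \sum_(c <- s) u c w) r)).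
  apply: rmean_le; first exact: ltW.
  - move=> z /ir /hG[h1 h2]; apply: rct_norm.
    exact: rct_ln (hol_ccts (hol_near_hol h1)) h2.
  - by move=> z zr; apply: rctD; [exact: hc|exact: hS].
  move=> z zr; have [h1 h2 h3] := hf z (ir z zr) (zs z zr).
  have [_ h4] := hG z (ir z zr).
  have h5 : zprod f s z != 0.
    by apply: contraNneq h2 => h5; rewrite h3 h5 mul0r.
  have E : ln (nm (G z)) = ln (nm (f z)) - \sum_(c <- s) (zord c)%:~R * ln (nm (z - c)).
    rewrite h3 normcM lnM ?posrE ?nm_gt0//.
    by rewrite (zprod_ln f (zs z zr)) addrAC subrr add0r.
  rewrite E; apply: le_trans (ler_normB _ _) _; rewrite lerD2l.
  apply: le_trans (ler_norm_sum _ _ _) _; apply: ler_sum_seq => c c'.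
  rewrite /u c' normrM mulNr -mulrN.
  have zc : nm (z - c) <= 1.
    apply: le_trans (nmB _ _) _; rewrite zr.
    have rb : r <= b := le_trans rr2 (ltW r2b).
    have -> : 1 = 2^-1 + 2^-1 :> R by field.
    move: c'; rewrite hs => /and3P[_ cb _].
    by apply: lerD; [exact: le_trans rb b2|exact: le_trans cb b2].
  have lc : ln (nm (z - c)) <= 0 by exact: ln_le0.
  rewrite (ler0_norm lc); apply: ler_wpM2r; first by rewrite oppr_ge0.
  rewrite zordE_posneg; apply: le_trans (ler_normB _ _) _.
  by rewrite !ger0_norm// ler0n.
rewrite (rmeanD (ltW r0) hc hS); apply: lerD => //.
rewrite (rmean_sum s (ltW r0) hu).
have l1 : 0 <= - ln r1 by rewrite oppr_ge0; exact: ln_le0.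
apply: (@le_trans _ _ (\sum_(c <- s) ((zpos f c)%:R + (zneg f c)%:R) * (- ln r1))).
  apply: ler_sum_seq => c c'; rewrite /u c' (rmeanZ _ (ltW r0) (ct c c')).
  rewrite (rmean_ln_sub r0 (cs c c')) mulNr -mulrN; apply: ler_wpM2l.
    by rewrite addr_ge0// ler0n.
  rewrite lerN2 ler_ln ?posrE//; first by rewrite le_max rr1.
  by rewrite lt_max r0.
rewrite -mulr_suml; apply: ler_wpM2r => //; apply: le_trans hN.
have hp c : a <= nm c <= b -> zpos f c != 0%N -> c \in s.
  by move=> /andP[c1 c2] /zpos_neq0 h; rewrite hs c1 c2.
have hn c : a <= nm c <= b -> zneg f c != 0%N -> c \in s.
  by move=> /andP[c1 c2] /zneg_neq0 h; rewrite hs c1 c2.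
rewrite (cntE us hp) (cntE us hn) -big_split /= [leRHS]big_mkcond /=.
apply: ler_sum_seq => c; rewrite hs => /and3P[c1 c2 _].
by rewrite c1 c2.
Qed.

(** The logarithmic derivative of [f] is that of [G] plus the sum of [zord c / (z - c)]; the latter
    is at most [N / dl]. *)
Lemma first_log_derivative (z : C) (dl : R) : 2 * r1 <= nm z -> 2 * nm z <= r2 ->
  0 < dl -> (forall c, a <= nm c <= b -> zord c != 0 -> dl <= nm (z - c)) ->
  [/\ hol_near_at f z, f z != 0 &
   nm (dc f z) <= (34 * (Mf + N * (- ln r1)) / nm z + N / dl) * nm (f z)].
Proof.
move=> z1 z2 dl0 hdl.
have r10 : 0 < r1 by exact: lt_trans ar1.
have [k1 k2 k3 k4] := And4 a0 ar1 r12 r2b.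
have ab : a <= b by lra.
have [s [us hs]] := zord_finite f_loc f_nz a0 ab bR.
have [G [hG hf]] := zfactor f_loc f_nz a0 bR us hs.
have zab : a <= nm z <= b by apply/andP; split; lra.
have zs : z \notin s.
  rewrite hs; case/andP: (zab) => -> -> /=; rewrite negbK; apply: contraT => h.
  by have := hdl z zab h; rewrite subrr normc0; lra.
have [h1 h2 h3] := hf z zab zs; split => //.
have [h4 h5] := hG z zab.
have B1 : rmean (fun w => `|ln (nm (G w))|) r1 <= Mf + N * (- ln r1).
  by apply: (rmean_factor_le us hs hG hf) => //; apply/andP; split; lra.
have B2 : rmean (fun w => `|ln (nm (G w))|) r2 <= Mf + N * (- ln r1).
  by apply: (rmean_factor_le us hs hG hf) => //; apply/andP; split; lra.
have LG := log_derivative_annulus a0 ar1 r12 r2b hG B1 B2 z1 z2.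
have nz : 0 < nm z by lra.
have z0 : z != 0 by rewrite -nm_gt0.
have near_f : \forall w \near cnb z, zprod f s w * G w = f w.
  have : \forall w \near cnb z, a <= nm w <= b.
    exists (Num.min (nm z - a) (b - nm z)); first by rewrite lt_min !subr_gt0; apply/andP; split; lra.
    move=> w; rewrite lt_min => /andP[w1 w2].
    have := nm_distB w z; rewrite ler_norml => /andP[w3 w4].
    by apply/andP; split; lra.
  have : \forall w \near cnb z, w \notin s.
    exists dl => // w wd; apply: contraL wd; rewrite hs -leNgt => /and3P[w1 w2 w3].
    by rewrite nm_distC; apply: hdl => //; rewrite w1.
  by apply: filterS2 => w w1 w2; have [_ _ ->] := hf w w2 w1.
have D := cder_near near_f (cderM (cder_zprod zord zs) (dcP (hol_near_hol h4))).
rewrite (dcE D) -/(zprod f s z).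
set S := \sum_(c <- s) _.
have -> : zprod f s z * S * G z + zprod f s z * dc G z =
   f z * (S + z * dc G z / G z / z).
  by rewrite h3; field; rewrite z0 h5.
rewrite normcM [leRHS]mulrC; apply: ler_wpM2l; first exact: nm_ge0.
rewrite [leRHS]addrC; apply: le_trans (nmD _ _) _; apply: lerD.
  apply: le_trans (nm_sum _ _ _) _.
  apply: (@le_trans _ _ (\sum_(c <- s) ((zpos f c)%:R + (zneg f c)%:R) / dl)).
    apply: ler_sum_seq => c; rewrite hs => /and3P[c1 c2 c3].
    rewrite normcM normcV nm_zord; apply: ler_wpM2l.
      by rewrite addr_ge0// ler0n.
    have hc : dl <= nm (z - c) by apply: hdl => //; rewrite c1.
    by rewrite lef_pV2 ?posrE//; exact: lt_le_trans hc.
  rewrite -mulr_suml; apply: ler_wpM2r; first by rewrite invr_ge0 ltW.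
  apply: le_trans hN.
  have hp c : a <= nm c <= b -> zpos f c != 0%N -> c \in s.
    by move=> /andP[c1 c2] /zpos_neq0 h; rewrite hs c1 c2.
  have hn c : a <= nm c <= b -> zneg f c != 0%N -> c \in s.
    by move=> /andP[c1 c2] /zneg_neq0 h; rewrite hs c1 c2.
  rewrite (cntE us hp) (cntE us hn) -big_split /= [leRHS]big_mkcond /=.
  apply: ler_sum_seq => c; rewrite hs => /and3P[c1 c2 _].
  by rewrite c1 c2.
rewrite normcM normcV; apply: ler_wpM2r; first by rewrite invr_ge0 ltW.
exact: LG.
Qed.
End bounds.
End first.

(** Integrate the derivative of [ln |f|] along the segment from [z] to [w]: it is at most
    [K * eta <= 1]. *)
Lemma log_growth (f : C -> C) (z w : C) (K eta : R) : 0 <= K ->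
  (forall v, nm (v - z) <= eta -> [/\ hol_near_at f v, f v != 0 &
    nm (dc f v) <= K * nm (f v)]) ->
  K * eta <= 1 -> nm (w - z) <= eta -> nm (f w) <= expR 1 * nm (f z).
Proof.
move=> K0 hf Ke wz.
pose g (t : R) : C := z + t%:C * (w - z).
have gt (t : R) : 0 <= t <= 1 -> nm (g t - z) <= eta.
  move=> /andP[t0 t1]; rewrite /g addrC addKr normcM nm_real ger0_norm//.
  by apply: le_trans wz; rewrite ler_piMl// nm_ge0.
have Dg t : rder g t (w - z).
  have := rderD (rder_cst z t) (rderM (rder_id t) (rder_cst (w - z) t)).
  by congr (rder _ t _); rewrite mulr0 mul1r add0r addr0.
pose h (t : R) := complex.Re (dc f (g t) * (w - z) / f (g t)).
have D (t : R) : 0 <= t <= 1 -> is_derive t 1 (fun s => ln (nm (f (g s)))) (h t).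
  move=> /gt /hf [h1 h2 _]; apply: is_derive_ln_nm => //.
  exact: (rder_comp (Dg t) (dcP (hol_near_hol h1))).
have hc : cts_on 0 1 h.
  apply: (@ccts_Re _ _ _ (fun t => dc f (g t) * (w - z) / f (g t))) => t /gt /hf [h1 h2 _].
  have gl := rder_lim (Dg t).
  apply: climM.
    apply: climM; last exact: clim_cst.
    exact: (clim_comp gl (hol_ccts (hol_dc h1))).
  apply: climV => //; exact: (clim_comp gl (hol_ccts (hol_near_hol h1))).
have E := rint_FTC ler01 D hc.
have B : `|rint 0 1 h| <= 1 * (1 - 0).
  apply: rint_norm_le => // t tt; apply: le_trans (Re_le_nm _) _.
  have [h1 h2 h3] := hf _ (gt t tt).
  rewrite normcM normcV normcM ler_pdivrMr ?nm_gt0// mul1r.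
  apply: (@le_trans _ _ (K * nm (f (g t)) * eta)).
    by apply: ler_pM => //; exact: nm_ge0.
  by rewrite mulrAC ler_piMl// nm_ge0.
have g1 : g 1 = w by rewrite /g mul1r subrKC.
have g0 : g 0 = z by rewrite /g mul0r addr0.
rewrite E g1 g0 subr0 mulr1 in B.
have [_ fw _] := hf w wz.
have [_ fz _] : [/\ hol_near_at f z, f z != 0 & nm (dc f z) <= K * nm (f z)].
  by apply: hf; rewrite subrr normc0; apply: le_trans wz; exact: nm_ge0.
have [p1 p2] : 0 < nm (f w) /\ 0 < nm (f z) by rewrite !nm_gt0.
rewrite -(lnK p1) -(lnK p2) -expRD ler_expR.
by move: B; rewrite ler_norml => /andP[_]; lra.
Qed.

(** By [log_growth], [f] stays within a factor [e] of [|f z|] on the disc of radius [eta]; this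
    radius is shared equally among [k] Cauchy estimates. *)
Lemma kth_derivative_bound (f : C -> C) (z : C) (K eta : R) k : (0 < k)%N -> 0 <= K ->
  0 < eta -> (forall v, nm (v - z) <= eta -> [/\ hol_near_at f v, f v != 0 &
    nm (dc f v) <= K * nm (f v)]) -> K * eta <= 1 ->
  hol_near_at (iter k (@dc R) f) z /\
  nm (iter k (@dc R) f z) <= (2 * k%:R / eta) ^+ k * (expR 1 * nm (f z)).
Proof.
move=> k0 K0 e0 hf Ke.
have kn : k%:R != 0 :> R by rewrite pnatr_eq0 -lt0n.
have E : 0 + k%:R * (eta / k%:R) = eta by field.
have := @cauchy_estimate_iter R f z k 0 (eta / k%:R) (expR 1 * nm (f z)) (lexx 0).
rewrite E divr_gt0 ?ltr0n// => /(_ isT) H.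
have H1 w : nm (w - z) <= eta -> \forall v \near cnb w, hol f v by move=> /hf[].
have H2 w : nm (w - z) <= eta -> nm (f w) <= expR 1 * nm (f z).
  by move=> wz; exact: (log_growth K0 hf Ke wz).
have zz : nm (z - z) <= 0 by rewrite subrr normc0.
have [h1 h2] := H H1 H2 z zz.
have <- : 2 / (eta / k%:R) = 2 * k%:R / eta by rewrite invf_div mulrA.
by split; [exact: h1|exact: h2].
Qed.

End kth_derivative.

(** * Complex derivatives of the analysis library *)

Section bridge.
Variable R : realType.
Local Notation C := R[i].
Local Notation nm := (@normc R).
Implicit Types (f : R[i]^o -> R[i]^o) (a z : R[i]^o).

Lemma norm_nm (z : C) : `|z| = (nm z)%:C.
Proof. by []. Qed.

(** A positive element of [R[i]] has zero imaginary part, so its real part can serve as the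
    radius. *)
Lemma nbhs_cnb (a : R[i]^o) (P : set C) : nbhs a P <-> cnb a P.
Proof.
split=> [/nbhs_ballP[e e0 h]|[d d0 h]].
  have e1 : (0 : C) < e := e0.
  move: e1; rewrite ltcE /= => /andP[/eqP ei er].
  exists (complex.Re e) => // w wa; apply: h; rewrite -ball_normE /=.
  have wa' : nm (a - w) < complex.Re e by rewrite nm_distC.
  by rewrite [`|_|]norm_nm ltcE /= ei eqxx.
apply/nbhs_ballP; exists (d%:C : C) => [|w] /=; first by rewrite ltcR.
by rewrite -ball_normE /= [`|_|]norm_nm ltcR => wa; apply: h; rewrite nm_distC.
Qed.

Lemma dnbhs_cnb (a : R[i]^o) (P : set C) :
  (\forall w \near a^', P w) <-> \forall w \near cnb a, w != a -> P w.
Proof. exact: (nbhs_cnb a (fun w => w != a -> P w)). Qed.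

Lemma cvg_clim (X : Type) (F : set_system X) {FF : Filter F} (g : X -> R[i]^o) (l : R[i]^o) :
  (g x @[x --> F] --> l) <-> clim F g l.
Proof.
split=> [/cvgrPdist_lt h e e0|h].
  have e1 : (0 : C) < e%:C by rewrite ltcR.
  have := h _ e1; apply: filterS => x; rewrite [`|_|]norm_nm ltcR => xe.
  by rewrite nm_distC.
apply/cvgrPdist_lt => e e0; have e1 : (0 : C) < e := e0.
move: e1; rewrite ltcE /= => /andP[/eqP ei er].
have := h _ er; apply: filterS => x xe; have xe' : nm (l - g x) < complex.Re e by rewrite nm_distC.
by rewrite [`|_|]norm_nm ltcE /= ei eqxx.
Qed.

Lemma clim_dnbhs (a : R[i]^o) (g : C -> C) (l : C) :
  clim (cnb a) g l -> clim (a^') g l.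
Proof. by move=> h e /h; move=> he; apply/dnbhs_cnb; apply: filterS he => w. Qed.

Lemma clim_dnbhs0 (a : R[i]^o) (g : C -> C) (l : C) :
  clim (cnb a) g l -> clim ((0 : R[i]^o)^') (fun h => g (h + a)) l.
Proof.
move=> h e /h[d d0 hd]; apply/dnbhs_cnb; exists d => // w; rewrite subr0 => wd _.
by apply: hd; rewrite addrK.
Qed.

Lemma cder_derive f z d : cder f z d -> derivable f z 1 /\ derive1 f z = d.
Proof.
move=> [psi h hp].
have H : (fun u => u^-1 *: ((f \o shift z) (u *: (1 : R[i]^o)) - f z)) u @[u --> (0 : R[i]^o)^'] --> (d : R[i]^o).
  apply/cvg_clim; apply: clim_near (clim_dnbhs0 hp).
  apply/dnbhs_cnb; case: h => e e0 h; exists e => // w; rewrite subr0 => we w0.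
  rewrite /= [w *: 1]mulr1 [f _]h ?addrK// addrAC subrr add0r.
  by rewrite [_ *: _]mulrC mulfK.
split; first by apply/cvg_ex; exists d.
by rewrite derive1E; apply: cvg_lim.
Qed.

Lemma derivable_cder f z : derivable f z 1 -> cder f z (derive1 f z).
Proof.
move=> h; have : (fun u => u^-1 *: ((f \o shift z) (u *: (1 : R[i]^o)) - f z)) u @[u --> (0 : R[i]^o)^'] --> 'D_1 f z by exact: h.
rewrite -derive1E => /cvg_clim; move: (derive1 f z) => d H.
exists (fun w => if w == z then d else (w - z)^-1 * (f w - f z)).
  apply: nearW => w; case: eqP => [->|/eqP wz]; first by rewrite subrr mulr0 addr0.
  by rewrite mulrAC mulVf ?subr_eq0// mul1r addrC subrK.
move=> e e0; have /dnbhs_cnb[s s0 hs] := H _ e0; exists s => // w ws.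
case: eqP => [_|/eqP wz]; first by rewrite subrr normc0.
have := hs (w - z); rewrite subr0 subr_eq0 => /(_ ws wz).
by rewrite /= [_ *: 1]mulr1 subrK.
Qed.

Lemma derivable_hol f z : derivable f z 1 <-> hol f z.
Proof. by split=> [/derivable_cder ?|[d /cder_derive[]//]]; exists (derive1 f z). Qed.

Lemma holomorphic_atE f a : holomorphic_at f a <-> hol_near_at f a.
Proof.
split=> [/nbhs_cnb|h]; first by apply: filterS => w /derivable_hol.
by apply/nbhs_cnb; apply: filterS h => w /derivable_hol.
Qed.

Lemma hol_near_dc (F : C -> C) (a : C) : hol_near_at F a -> hol_near_at (dc F) a.
Proof. by move=> /hol_near_near; apply: filterS => w; exact: hol_dc. Qed.

Lemma derive1n_dc f a k : hol_near_at f a ->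
  \forall w \near cnb a, derive1n k f w = iter k (@dc R) f w.
Proof.
move=> hf; elim: k => [|k ih]; first exact: nearW.
have hk : hol_near_at (iter k (@dc R) f) a.
  by elim: k {ih} => [//|k ih]; exact: hol_near_dc.
apply: filterS2 (cnb_near ih) (hol_near_near hk) => w E /hol_near_hol/dcP H.
rewrite derive1nS /=; apply: (proj2 (cder_derive _)); apply: cder_near H.
by apply: filterS E => v ->.
Qed.

Lemma meromorphic_value_hol f k z : hol_near_at f z -> f z != 0 ->
  hol_near_at (iter k (@dc R) f) z ->
  meromorphic_value (fun w => derive1n k f w / f w) z (iter k (@dc R) f z / f z).
Proof.
move=> hf fz hk; apply/cvg_clim.
apply: (clim_near (f := fun w => iter k (@dc R) f w / f w)).
  by apply/dnbhs_cnb; apply: filterS (derive1n_dc k hf) => w -> _.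
apply: clim_dnbhs; apply: climM; first exact: hol_ccts (hol_near_hol hk).
by apply: climV => //; exact: hol_ccts (hol_near_hol hf).
Qed.

(** Given its limit [c] as value at [a], the function [(w - a) ^+ m * f w] is continuous at [a] and
    holomorphic around it, hence holomorphic at [a] too. *)
Lemma has_pole_mform f a m : has_pole_of_order f a m <-> (0 < m)%N /\ mform f a (- m%:Z).
Proof.
split=> [[m0 /dnbhs_cnb hf [c c0 /cvg_clim hc]]|[m0 [g [g1 g2 g3]]]].
  split => //; pose H w := if w == a then c else (w - a) ^+ m * f w.
  have Ha : H a = c by rewrite /H eqxx.
  have Hn w : w != a -> H w = (w - a) ^+ m * f w by rewrite /H => /negbTE ->.
  have Hc : ccts H a.
    rewrite /ccts Ha => e e0; have /dnbhs_cnb := hc _ e0; apply: filterS => w.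
    case: (eqVneq w a) => [-> _|wa]; first by rewrite Ha subrr normc0.
    by move=> /(_ isT); rewrite Hn.
  have Hh : \forall w \near cnb a, w != a -> hol H w.
    apply: filterS hf => w hw wa; have [d hd] := (derivable_hol f w).1 (hw wa).
    have wa' : 0 < nm (w - a) by rewrite nm_gt0 subr_eq0.
    have h1 : cder (fun w => w - a) w 1.
      by have := cderB (cder_id w) (cder_cst a w); rewrite subr0.
    eexists; apply: cder_near (cderM (cderX m h1) hd).
    exists (nm (w - a)) => // v va; rewrite Hn//; apply: contraTneq va => ->.
    by rewrite nm_distC ltxx.
  have Ha' := hol_of_ccts Hh Hc.
  exists H; split; rewrite ?Ha//.
    apply: filterS Hh => w; case: (eqVneq w a) => [-> _//|wa]; exact.
  apply: nearW => w wa; rewrite Hn//.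
  rewrite -exprnN mulrA mulVf ?mul1r// expf_neq0// subr_eq0//.
split => //.
  apply/dnbhs_cnb; apply: filterS2 (cnb_near g3) g1 => w g4 [d hd] wa.
  apply/derivable_hol.
  have wa' : 0 < nm (w - a) by rewrite nm_gt0 subr_eq0.
  have h1 : cder (fun w => w - a) w 1.
    by have := cderB (cder_id w) (cder_cst a w); rewrite subr0.
  have wm : (w - a) ^+ m != 0 by rewrite expf_neq0// subr_eq0.
  have h2 := @cderV _ (fun w => (w - a) ^+ m) w _ wm (cderX m h1).
  eexists; apply: cder_near (cderM h2 hd).
  case: g4 => e e0 g4; exists (Num.min e (nm (w - a))) => [|v]; first by rewrite lt_min e0.
  rewrite lt_min => /andP[ve va]; rewrite (g4 v)// ?exprnN//.
  by apply: contraTneq va => ->; rewrite nm_distC ltxx.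
exists (g a) => //; apply/cvg_clim.
apply: (clim_near (f := g)); last exact: clim_dnbhs (hol_ccts (hol_near_hol g1)).
apply/dnbhs_cnb; apply: filterS g3 => w gw wa; rewrite gw//.
by rewrite -exprnN mulrA divff ?mul1r// expf_neq0// subr_eq0.
Qed.
End bridge.

(** * The characteristic of the statement in terms of orders *)

Section counting_bridge.
Variable R : realType.
Local Notation C := R[i].
Local Notation nm := (@normc R).
Local Notation mu := (@lebesgue_measure R).
Variables (f : R[i]^o -> R[i]^o) (R0 : R).
Hypothesis f_mero : meromorphic_on (punctured_disc R0) f.

Lemma f_locP a : 0 < nm a < R0 ->
  hol_near_at f a \/ exists2 m : nat, (0 < m)%N & mform f a (- m%:Z).
Proof.
move=> /f_mero[/holomorphic_atE|[m /has_pole_mform[m0 h]]]; [by left|right].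
by exists m.
Qed.

Hypothesis f_nz : ~ (forall z, 0 < nm z < R0 -> f z = 0).

Lemma pole_multiplicityE a : 0 < nm a < R0 -> pole_multiplicity f a = zneg f a.
Proof.
move=> aR; have hz := zordP f_locP f_nz aR.
rewrite /pole_multiplicity /zneg; case: (leP 0 (zord f a)) => h.
  apply: xgetPN => m /has_pole_mform[m0 hm].
  have := zordE f_locP f_nz aR hm => E; rewrite E in h.
  by have := m0; rewrite ltnNge => /negP[]; rewrite -lez_nat -oppr_ge0.
apply: xget_unique => [|m /has_pole_mform[m0 hm]].
  apply/has_pole_mform; split; first by rewrite absz_gt0 lt_eqF.
  by rewrite ltz0_abs// opprK.
by rewrite (zordE f_locP f_nz aR hm) abszN absz_nat.
Qed.

Lemma pole_countE (R' t : R) : 0 < t -> R' < R0 -> pole_count R' f t = cnt (zneg f) t R'.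
Proof.
move=> t0 RR; apply: eq_fsbigr => a; rewrite inE /= => /andP[ta aR].
by rewrite pole_multiplicityE// (lt_le_trans t0 ta) (le_lt_trans aR RR).
Qed.

Lemma m0E r : m0 f r = rmean (fun w => logp (nm (f w))) r.
Proof. by rewrite /m0 /rmean; congr (_ * _); apply: eq_Rintegral => t _; rewrite polarE. Qed.

Lemma m0_ge0 r : 0 <= m0 f r.
Proof.
rewrite /m0 mulr_ge0 ?invr_ge0 ?mulr_ge0 ?pi_ge0// Rintegral_ge0// => t _.
by rewrite /logp le_max lexx orbT.
Qed.

Lemma cnt_ge0 (w : C -> nat) (t u : R) : 0 <= cnt w t u.
Proof. by apply: fsumr_ge0 => a _; exact: ler0n. Qed.

Lemma N0_ge0 (R' r : R) : 0 < r -> R' < R0 -> 0 <= N0 R' f r.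
Proof.
move=> r0 RR; rewrite /N0 Rintegral_ge0// => t /=; rewrite in_itv /= => /andP[rt tR].
have t0 : 0 < t by exact: lt_le_trans rt.
by rewrite pole_countE// divr_ge0 ?cnt_ge0// ltW.
Qed.

(** On [[r, 2 * r]], an interval of length [r], the integrand of [N0] is at least the count from
    [2 * r] on divided by [2 * r]. *)
Lemma cnt_le_N0 (R' r : R) : 0 < r -> 2 * r <= R' -> R' < R0 ->
  cnt (zneg f) (2 * r) R' <= 2 * N0 R' f r.
Proof.
move=> r0 rR RR.
have rR' : r <= R' by lra.
have [s [us hs]] := zord_finite f_locP f_nz r0 rR' RR.
have hN t : r <= t -> cnt (zneg f) t R' = \sum_(c <- s | t <= nm c <= R') (zneg f c)%:R.
  move=> rt; apply: cntE => // c /andP[tc cR] /zneg_neq0 zc.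
  by rewrite hs zc cR (le_trans rt tc).
(* Writing the integrand with finitely many indicator functions makes it visibly measurable and
   bounded, hence integrable. *)
pose g (t : R) := (\sum_(c <- s) (zneg f c)%:R * \1_(`]-oo, nm c]) t) * t^-1 : R.
have gE t : r <= t -> t <= R' -> pole_count R' f t / t = g t.
  move=> rt tR; have t0 : 0 < t by exact: lt_le_trans rt.
  rewrite pole_countE// hN// /g; congr (_ / _); rewrite big_mkcond /= [LHS]big_seq [RHS]big_seq.
  apply: eq_bigr => c; rewrite hs => /and3P[_ cR _]; rewrite cR andbT indicE.
  by rewrite mem_setE in_itv /=; case: (t <= nm c); rewrite ?mulr1 ?mulr0.
have g0 t : r <= t -> 0 <= g t.
  move=> rt; rewrite mulr_ge0// ?invr_ge0 ?(ltW (lt_le_trans r0 rt))//.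
  by apply: sumr_ge0 => c _; rewrite mulr_ge0// indicE ler0n.
have mg : measurable_fun `[r, R'] g.
  apply: measurable_funM.
    apply: measurable_sum => c; apply: measurable_funM; first exact: measurable_cst.
    exact: measurable_indic.
  apply: subspace_continuous_measurable_fun => //.
  apply: cts_within => t /andP[rt _].
  by apply: cvgV; [rewrite gt_eqF// (lt_le_trans r0 rt)|exact: cvg_id].
have ig : mu.-integrable `[r, R'] (EFin \o g).
  apply: measurable_bounded_integrable => //.
    by rewrite /= lebesgue_measure_itv /=; case: ifP => // _; rewrite -EFinB ltry.
  exists ((\sum_(c <- s) (zneg f c)%:R) / r); split; first exact: num_real.
  move=> M hM t /=; rewrite in_itv /= => /andP[rt tR].
  have t0 : 0 < t by exact: lt_le_trans rt.
  rewrite ger0_norm ?g0//; apply: le_trans (ltW hM); apply: ler_pM.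
  - by apply: sumr_ge0 => c _; rewrite mulr_ge0// indicE ler0n.
  - by rewrite invr_ge0 ltW.
  - by apply: ler_sum => c _; rewrite ler_piMr// indicE; case: (_ \in _).
  - by rewrite lef_pV2 ?posrE.
have E : (\int[mu]_(t in `[r, R']) (g t)%:E = (N0 R' f r)%:E)%E.
  rewrite -(fineK (integrable_fin_num _ ig))//; congr (_%:E).
  by apply: esym; apply: eq_Rintegral => t; rewrite inE /= in_itv /= => /andP[]; exact: gE.
pose c0 := cnt (zneg f) (2 * r) R' / (2 * r).
have c00 : 0 <= c0 by rewrite divr_ge0 ?cnt_ge0//; lra.
suff : ((c0 * r)%:E <= (N0 R' f r)%:E)%E.
  rewrite lee_fin /c0 => h.
  have -> : cnt (zneg f) (2 * r) R' = 2 * (cnt (zneg f) (2 * r) R' / (2 * r) * r).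
    by field; rewrite gt_eqF.
  by rewrite ler_pM2l.
have I : (\int[mu]_(t in `[r, (2 * r)%R]) (cst c0%:E) t = (c0 * r)%R%:E)%E.
  rewrite integral_cst// /= lebesgue_measure_itv /= lte_fin ifT; last by lra.
  by rewrite -EFinB -EFinM; congr (_ * _)%:E; lra.
have sub : `[r, 2 * r] `<=` `[r, R'].
  by move=> t /=; rewrite !in_itv /= => /andP[-> h]; exact: le_trans rR.
rewrite -E -I; apply: (@le_trans _ _ (\int[mu]_(t in `[r, (2 * r)%R]) (g t)%:E)%E).
  apply: ge0_le_integral => //.
  - apply/measurable_EFinP; exact: (measurable_funS _ sub mg).
  - move=> t /=; rewrite in_itv /= => /andP[rt t2].
    have t0 : 0 < t by exact: lt_le_trans rt.
    have tR : t <= R' by exact: le_trans rR.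
    rewrite lee_fin /c0 -gE// pole_countE//; apply: ler_pM.
    + exact: cnt_ge0.
    + by rewrite invr_ge0; lra.
    + by apply: (cnt_le f_locP f_nz) => // c; exact: zneg_neq0.
    + by rewrite lef_pV2 ?posrE//; lra.
apply: ge0_subset_integral => //; first exact/measurable_EFinP.
by move=> t /=; rewrite in_itv /= lee_fin => /andP[rt _]; exact: g0.
Qed.
End counting_bridge.

(** * Estimates on dyadic annuli *)

Section annulus_estimate.
Variable R : realType.
Local Notation C := R[i].
Local Notation nm := (@normc R).
Variables (f : C -> C) (R0 : R).
Hypothesis f_loc : forall a, 0 < nm a < R0 ->
  hol_near_at f a \/ exists2 m : nat, (0 < m)%N & mform f a (- m%:Z).
Hypothesis f_nz : ~ (forall z, 0 < nm z < R0 -> f z = 0).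

(** The bound of [first_log_derivative] with all its ingredients expressed by [W]: [l] stands for
    [- ln p1], [x] for the inverse modulus, and the distance to the zeros and poles is at least
    [W ^- 4 / 2]. *)
Lemma W_power_bound (W l x : R) : 8 <= W -> 0 <= l -> l <= W -> 0 <= x -> x <= W ->
  34 * (2 * W ^+ 2 + 5 * W ^+ 2 * l) * x + 5 * W ^+ 2 / (W ^- 4 / 2) <= W ^+ 8.
Proof.
move=> W8 l0 lW x0 xW; have W0 : 0 < W by lra.
have -> : 5 * W ^+ 2 / (W ^- 4 / 2) = 10 * W ^+ 6 by field; rewrite gt_eqF.
have W2 : 8 * 8 <= W * W by apply: ler_pM.
have W3 : 8 * 8 * 8 <= W * W * W by apply: ler_pM.
have h1 : 34 * (2 * W ^+ 2 + 5 * W ^+ 2 * l) * x <= 34 * (7 * W ^+ 3) * W.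
  have h : 5 * W ^+ 2 * l <= 5 * W ^+ 2 * W by rewrite ler_wpM2l// mulr_ge0// sqr_ge0.
  have h' : W ^+ 2 * 1 <= W ^+ 2 * W by rewrite ler_wpM2l ?sqr_ge0//; lra.
  have -> : W ^+ 3 = W ^+ 2 * W by rewrite exprSr.
  have h2 := sqr_ge0 W.
  have h0 : 0 <= 5 * W ^+ 2 * l by rewrite mulr_ge0// mulr_ge0.
  by apply: ler_pM => //; lra.
have h2 : (34 * 7) * W ^+ 4 <= W ^+ 3 * W ^+ 4.
  by rewrite ler_wpM2r ?exprn_ge0 ?(ltW W0)//; rewrite !exprS expr0; lra.
have h3 : 8 * W ^+ 6 <= W * W ^+ 6 by rewrite ler_wpM2r ?exprn_ge0 ?(ltW W0).
have h4 : 8 * W ^+ 7 <= W * W ^+ 7 by rewrite ler_wpM2r ?exprn_ge0 ?(ltW W0).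
have h5 : 0 <= W ^+ 6 by rewrite exprn_ge0// ltW.
rewrite -exprS in h3; rewrite -exprS in h4; rewrite -exprD in h2.
have E : W ^+ 3 * W = W ^+ 4 by rewrite -exprSr.
have h6 : 34 * (7 * W ^+ 3) * W = (34 * 7) * W ^+ 4 by rewrite -E; ring.
rewrite h6 in h1; lra.
Qed.

(** The target annulus is [q / 2 <= |z| <= q]. The hypotheses are the conclusion of [jensen_bound]
    and bounds derived from [T0] over a wider range of radii; a single [W] dominates every quantity
    involved. *)
Lemma annulus_estimate (q W B K L r1 R' : R) :
  0 < q -> 16 * q <= 1 -> 8 * q <= r1 -> r1 <= 1 -> r1 < R' -> R' < R0 ->
  0 <= B -> 0 <= K ->
  (forall r, 0 < r -> r < r1 -> good f r ->
    let X := 2 * rmean (fun w => logp (nm (f w))) r +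
           (cnt (zneg f) r R' + K) * (1 + (ln r1 - ln r)) in
    rmean (fun w => `|ln (nm (f w))|) r <= X /\
    forall t, 2 * r <= t -> t <= r1 -> cnt (zpos f) t r1 * ln 2 <= X) ->
  (forall r, q / 64 <= r -> r <= 8 * q ->
    rmean (fun w => logp (nm (f w))) r <= B /\ cnt (zneg f) r R' <= 2 * B) ->
  1 - ln (q / 64) <= L -> L <= W -> 8 <= W -> 4 / q <= W -> 2 * B <= W ->
  2 * B + K <= W ->
  exists s : seq C, [/\ forall c, c \in s -> q / 16 <= nm c <= 8 * q,
    (size s)%:R <= 5 * W ^+ 2 &
    forall k z, (0 < k)%N -> q / 2 <= nm z <= q ->
      (forall c, c \in s -> W ^- 4 <= nm (z - c)) ->
      [/\ hol_near_at f z, f z != 0, hol_near_at (iter k (@dc R) f) z &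
       nm (iter k (@dc R) f z) <= (2 * k%:R * W ^+ 8) ^+ k * (expR 1 * nm (f z))]].
Proof.
move=> q0 q16 q8 r1_1 r1R RR B0 K0 hJ hT hL LW W8 qW BW KW.
have hX (r : R) : q / 64 <= r -> r <= 8 * q -> r < r1 ->
  2 * rmean (fun w => logp (nm (f w))) r +
  (cnt (zneg f) r R' + K) * (1 + (ln r1 - ln r)) <= 2 * W ^+ 2.
  move=> qr rq rr1; have r0 : 0 < r by apply: lt_le_trans qr; rewrite divr_gt0.
  have [h1 h2] := hT r qr rq; have h3 : 0 <= cnt (zneg f) r R' by apply: fsumr_ge0 => a _.
  have l1 : ln r1 <= 0 by rewrite ln_le0.
  have l2 : ln (q / 64) <= ln r by rewrite ler_ln ?posrE// divr_gt0.
  have l3 : ln r <= ln r1 by rewrite ler_ln ?posrE//; lra.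
  move: (rmean _ _) (cnt _ _ _) (ln _) (ln r1) (ln r) h1 h2 h3 l1 l2 l3 hL
    => X1 X2 l64 lr1 lr h1 h2 h3 l1 l2 l3 hL.
  have : (X2 + K) * (1 + (lr1 - lr)) <= W * W by apply: ler_pM; lra.
  have : 8 * W <= W * W by rewrite ler_wpM2r//; lra.
  rewrite expr2; lra.
(* Jensen's bound at [r] counts zeros from [2 * r <= q / 16] on. The circles [p1] and [p2] carry the
   estimate of [G' / G]; they lie a factor 2 away from all points near the target annulus, inside
   the annulus from [q / 16] to [8 * q]. *)
have ex1 : exists2 r, q / 64 < r < q / 32 & good f r.
  by apply: (exists_good f_loc f_nz); lra.
have ex2 : exists2 r, q / 16 < r < q / 8 & good f r.
  by apply: (exists_good f_loc f_nz); lra.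
have ex3 : exists2 r, 4 * q < r < 8 * q & good f r.
  by apply: (exists_good f_loc f_nz); lra.
case: ex1 ex2 ex3 => r /andP[rq1 rq2] gr [p1 /andP[p1a p1b] g1] [p2 /andP[p2a p2b] g2].
have hq : 0 < q / 64 by rewrite divr_gt0.
have [||_ hr] := hJ r _ _ gr; [lra|lra|].
have [||M1 _] := hJ p1 _ _ g1; [lra|lra|].
have [||M2 _] := hJ p2 _ _ g2; [lra|lra|].
have {}M1 : rmean (fun w => `|ln (nm (f w))|) p1 <= 2 * W ^+ 2.
  by apply: le_trans M1 (hX p1 _ _ _); clear -R f_loc f_nz q0 q8 p1a p1b; lra.
have {}M2 : rmean (fun w => `|ln (nm (f w))|) p2 <= 2 * W ^+ 2.
  by apply: le_trans M2 (hX p2 _ _ _); clear -R f_loc f_nz q0 q8 p2a p2b; lra.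
have W2 : 2 * B <= W ^+ 2.
  by apply: le_trans BW _; rewrite expr2 ler_peMl//; lra.
(* The zeros account for [4 * W ^+ 2], because [ln 2 >= 2^-1], and the poles for [W ^+ 2]. *)
have hN : cnt (zpos f) (q / 16) (8 * q) + cnt (zneg f) (q / 16) (8 * q) <= 5 * W ^+ 2.
  have h1 : cnt (zpos f) (q / 16) (8 * q) <= cnt (zpos f) (q / 16) r1.
    apply: (cnt_le f_loc f_nz) => [a| | | | |]; [exact: zpos_neq0|clear -R f_loc f_nz q0 q8 r1R RR; lra..].
  have h2 : cnt (zneg f) (q / 16) (8 * q) <= cnt (zneg f) (q / 16) R'.
    apply: (cnt_le f_loc f_nz) => [a| | | | |]; [exact: zneg_neq0|clear -R f_loc f_nz q0 q8 r1R RR; lra..].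
  have [||_ h3] := hT (q / 16); [clear -R f_loc f_nz q0; lra|clear -R f_loc f_nz q0; lra|].
  have h4 := le_trans (hr (q / 16) _ _) (hX r _ _ _).
  have h5 : 0 <= cnt (zpos f) (q / 16) r1 by apply: fsumr_ge0 => a _.
  have h6 : cnt (zpos f) (q / 16) r1 * 2^-1 <= cnt (zpos f) (q / 16) r1 * ln 2.
    by rewrite ler_wpM2l// ln2_ge.
  have {}h4 : cnt (zpos f) (q / 16) r1 * ln 2 <= 2 * W ^+ 2.
    by apply: h4; clear -R f_loc f_nz q0 q8 rq1 rq2; lra.
  lra.
have q16_0 : 0 < q / 16 by rewrite divr_gt0.
have [||s [us hs]] := zord_finite f_loc f_nz q16_0 (r2 := 8 * q).
- by clear -R f_loc f_nz q0; lra.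
- by clear -R f_loc f_nz q8 r1R RR; lra.
have W0 : 0 < W by lra.
have Wn n : 0 < W ^+ n by exact: exprn_gt0.
exists s; split.
- by move=> c; rewrite hs => /and3P[-> ->].
- have hc w : (forall a, w a != 0%N -> zord f a != 0) ->
      cnt w (q / 16) (8 * q) = \sum_(c <- s) (w c)%:R.
    move=> hw; rewrite (cntE us) => [|a /andP[h1 h2] /hw h3]; last by rewrite hs h1 h2.
    rewrite big_mkcond [LHS]big_seq [RHS]big_seq; apply: eq_bigr => c.
    by rewrite hs => /and3P[-> -> _].
  apply: le_trans hN; rewrite (hc _ (@zpos_neq0 _ f)) (hc _ (@zneg_neq0 _ f)).
  rewrite -big_split /= -sum1_size natr_sum; apply: ler_sum_seq => c.
  rewrite hs => /and3P[_ _ zc]; rewrite -natrD ler_nat /zpos /zneg.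
  by case: ifP => _; rewrite ?addn0 ?add0n absz_gt0.
move=> k z k0 /andP[z1 z2] hz.
have d0 : 0 < W ^- 4 by rewrite invr_gt0.
have e0 : 0 < W ^- 8 by rewrite invr_gt0.
have W1 n : 1 <= W ^+ n by rewrite exprn_ege1//; lra.
have eW n : W ^- n.+1 <= W^-1.
  by rewrite lef_pV2 ?posrE// exprS ler_peMr// ltW.
have ed : W ^- 8 <= W ^- 4 / 2.
  have -> : W ^- 8 = W ^- 4 * W ^- 4 by rewrite -invfM -exprD.
  rewrite ler_wpM2l//; first exact: ltW.
  apply: le_trans (eW 3) _; rewrite lef_pV2 ?posrE//; lra.
have eq : W ^- 8 <= q / 4.
  apply: le_trans (eW 7) _.
  rewrite -[q / 4]invrK invf_div lef_pV2 ?posrE ?divr_gt0//.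
(* The radius is the inverse of the bound [W ^+ 8] on [f' / f], as [kth_derivative_bound] wants; it
   is also small enough to preserve half of the distance [W ^- 4] to the zeros and poles. *)
have hv v : nm (v - z) <= W ^- 8 ->
    [/\ hol_near_at f v, f v != 0 & nm (dc f v) <= W ^+ 8 * nm (f v)].
  move=> vz.
  have v1 : nm z <= nm v + nm (v - z).
    by rewrite -[X in nm X <= _](subKr v z) ; exact: nmB.
  have v2 : nm v <= nm z + nm (v - z).
    by rewrite -[X in nm X <= _](subrK z v) addrC; exact: nmD.
  have dv c : q / 16 <= nm c <= 8 * q -> zord f c != 0 -> W ^- 4 / 2 <= nm (v - c).
    move=> /andP[c1 c2] zc; have cs : c \in s by rewrite hs c1 c2.
    have := hz c cs; have := nm_distD v z c; rewrite (nm_distC z v).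
    by clear -R f_loc f_nz vz ed; lra.
  have [|||||||||h1 h2 h3] := @first_log_derivative _ f R0 f_loc f_nz (q / 16) (8 * q)
    p1 p2 (2 * W ^+ 2) (5 * W ^+ 2) _ _ _ _ _ _ g1 g2 M1 M2 hN v (W ^- 4 / 2) _ _ _ dv.
  all: try by clear -R f_loc f_nz q0 q16 q8 p1a p1b p2a p2b z1 z2 v1 v2 vz eq r1R RR d0; lra.
  split => //; apply: le_trans h3 _; apply: ler_wpM2r; first exact: nm_ge0.
  have v0 : 0 < nm v by clear -R f_loc f_nz q0 z1 v1 vz eq; lra.
  have vW : (nm v)^-1 <= W.
    apply: le_trans qW; rewrite -invf_div lef_pV2 ?posrE ?divr_gt0//.
    by clear -R f_loc f_nz z1 v1 vz eq; lra.
  have lp : - ln p1 <= W.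
    have : ln (q / 64) <= ln p1 by rewrite ler_ln ?posrE//; clear -R f_loc f_nz q0 p1a; lra.
    by clear -R f_loc f_nz hL LW => h; lra.
  have lp0 : 0 <= - ln p1 by rewrite oppr_ge0 ln_le0//; clear -R f_loc f_nz p1b q16 q0; lra.
  by apply: W_power_bound => //; rewrite invr_ge0 ltW.
have We : W ^+ 8 * W ^- 8 <= 1 by rewrite divff// gt_eqF.
have [hk hk'] := kth_derivative_bound k0 (ltW (Wn 8)) e0 hv We.
have h0 : nm (z - z) <= W ^- 8 by rewrite subrr normc0 ltW.
have [h1 h2 _] := hv z h0; split => //; rewrite invrK in hk'; exact: hk'.
Qed.
End annulus_estimate.

(** * Choice of the scales on the annulus of outer radius [2 ^- m] *)

Section dyadic_estimate.
Variable R : realType.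
Local Notation C := R[i].
Local Notation nm := (@normc R).

Lemma near_pow2_le (e : R) : 0 < e -> \forall m \near \oo, 2 ^- m <= e.
Proof.
move=> e0; near=> m; rewrite -[e]invrK lef_pV2 ?posrE ?invr_gt0 ?exprn_gt0//.
apply: (@le_trans _ _ m%:R); first by near: m; exact: nbhs_infty_ger.
by rewrite -natrX ler_nat ltnW// ltn_expl.
Unshelve. all: end_near. Qed.

Lemma ln2_le1 : ln 2 <= 1 :> R.
Proof.
rewrite -[leRHS](expRK 1) ler_ln ?posrE ?expR_gt0//.
by have := expR_ge1Dx (1 : R); lra.
Qed.

Lemma ln_pow2 m j : ln (2 ^- m / 2 ^+ j) = - (m + j)%:R * ln 2 :> R.
Proof. by rewrite -invfM -exprD addnC lnV ?posrE ?exprn_gt0// lnXn// mulNr mulr_natl addnC. Qed.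

Lemma scale_bounds (W q K B : R) m : q = 2 ^- m -> W = (K + 8) * 2 ^+ m * B -> 0 <= K ->
  1 <= B -> [/\ (m + 8)%:R <= W, 8 <= W, 4 / q <= W, 2 * B <= W & 2 * B + K <= W].
Proof.
move=> -> -> K0 B1.
have h2 : m%:R + 1 <= 2 ^+ m :> R by rewrite natr1 -natrX ler_nat ltn_expl.
have m0 : 0 <= m%:R :> R by exact: ler0n.
rewrite invrK natrD; move: (m%:R) (2 ^+ m) m0 h2 => x y x0 xy.
have y1 : 1 <= y by lra.
have h : 1 * 1 <= y * B by apply: ler_pM; lra.
have h' : y * 1 <= y * B by rewrite ler_wpM2l//; lra.
have h3 : 1 * B <= y * B by rewrite ler_wpM2r//; lra.
have h4 : K * 1 <= K * (y * B) by rewrite ler_wpM2l//; lra.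
rewrite -[(K + 8) * y * B]mulrA mulrDl; split; lra.
Qed.

Lemma dyadic_estimate (R0 R' : R) n k (f : R[i]^o -> R[i]^o) (sigma eps : R) :
  0 < R' -> R' < R0 -> (2 <= n)%N -> (0 < k)%N -> 0 < eps ->
  meromorphic_on (punctured_disc R0) f ->
  (~ exists c : R[i]^o, forall z, punctured_disc R0 z -> f z = c) ->
  iterated_order R' n f = sigma%:E ->
  exists N (s : nat -> seq C) (dl : nat -> R), forall m, (N <= m)%N ->
    [/\ 0 < dl m, dl m <= 2 ^- m / 32,
       forall c, c \in s m -> 2 ^- m / 16 <= nm c <= 8 * 2 ^- m,
       (size (s m))%:R * dl m <= 2 ^- m * 2 ^- m &
       forall z, 2 ^- m / 2 <= nm z <= 2 ^- m ->
         (forall c, c \in s m -> dl m <= nm (z - c)) ->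
         exists2 v : R[i]^o,
           meromorphic_value (fun w => derive1n k f w / f w) z v &
           cabs v <= iter_exp n.-1 (1 / (cabs z `^ (sigma + eps)))].
Proof.
move=> R'0 RR n2 k0 e0 mero nonc ord.
have f_loc := f_locP mero.
have f_nz : ~ (forall z, 0 < nm z < R0 -> f z = 0) by move=> h; apply: nonc; exists 0.
have n0 : (0 < n)%N by exact: leq_trans n2.
have p0 : (0 < n.-1)%N by rewrite -ltnS prednK.
have e2 : 0 < eps / 2 by rewrite divr_gt0.
have [t0 [rho rho0 hT]] := iterated_order_growth n0 ord e2.
set t := sigma + eps / 2 in t0 hT.
have tt : t < sigma + eps by rewrite /t; lra.
(* The reference radii are taken below both 1, for the sign of their logarithms, and [R']. *)
pose M := Num.min 1 R'.
have [M0 [M1 MR]] : 0 < M /\ M <= 1 /\ M <= R'.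
  by rewrite lt_min ltr01 R'0 !ge_min !lexx orbT.
have [r1 /andP[r1a r1b] g1] : exists2 r, M / 4 < r < M / 2 & good f r.
  by apply: (exists_good f_loc f_nz); lra.
have [r2 /andP[r2a r2b] g2] : exists2 r, M / 2 < r < M & good f r.
  by apply: (exists_good f_loc f_nz); lra.
have [|||K K0 hJ] := jensen_bound f_loc f_nz _ _ _ RR g1 g2 (r1 := r1) (r2 := r2); [lra..|].
have A0 : 0 <= 2 * k%:R :> R by rewrite mulr_ge0// ler0n.
have hG := growth_comparison k p0 t0 tt K0 A0.
have r10 : 0 < r1 by lra.
have near_q : \forall m \near \oo, (2 ^- m <= r1 / 8 /\ 2 ^- m <= rho / 16) /\
    (2 ^- m <= 16^-1 :> R /\
  expR 1 * (2 * k%:R * ((K + 8) * 2 ^+ m *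
     iter_exp n.-1 (expR (t * ((m + 7)%:R * ln 2)))) ^+ 8) ^+ k
  <= iter_exp n.-1 (expR ((sigma + eps) * (m%:R * ln 2)))).
  near=> m; (split; split); last by near: m; exact: hG.
  - by near: m; apply: near_pow2_le; lra.
  - by near: m; apply: near_pow2_le; lra.
  - by near: m; apply: near_pow2_le; lra.
case: near_q => N _ hN.
suff /choice[sd h] : forall m, exists sd : seq C * R, (N <= m)%N ->
    [/\ 0 < sd.2, sd.2 <= 2 ^- m / 32,
       forall c, c \in sd.1 -> 2 ^- m / 16 <= nm c <= 8 * 2 ^- m,
       (size sd.1)%:R * sd.2 <= 2 ^- m * 2 ^- m &
       forall z, 2 ^- m / 2 <= nm z <= 2 ^- m ->
         (forall c, c \in sd.1 -> sd.2 <= nm (z - c)) ->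
         exists2 v : R[i]^o,
           meromorphic_value (fun w => derive1n k f w / f w) z v &
           cabs v <= iter_exp n.-1 (1 / (cabs z `^ (sigma + eps)))].
  by exists N, (fun m => (sd m).1), (fun m => (sd m).2).
move=> m; case: (leqP N m) => [Nm|]; last first.
  by exists ([::], 0) => F; discriminate F.
have [[q1 q2] [q3 hg]] := hN m Nm; clear hN hG.
pose B := iter_exp n.-1 (expR (t * ((m + 7)%:R * ln 2))).
pose W := (K + 8) * 2 ^+ m * B.
pose q : R := 2 ^- m.
rewrite -/q in q1 q2 q3 *; rewrite -/B -/W in hg.
have q0 : 0 < q by rewrite invr_gt0 exprn_gt0.
have l0 : 0 < ln 2 :> R by rewrite ln_gt0// ltr1n.
have B1 : 1 <= B.
  apply: le_trans (iter_exp_ge _ _); apply: le_trans (expR_ge1Dx _).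
  by rewrite lerDl mulr_ge0 ?(ltW t0)// mulr_ge0 ?ler0n// ltW.
have [W1 W2 W3 W4 W5] := scale_bounds (erefl q) (erefl W) K0 B1.
(* Radii go down to [q / 64], and bounding the count of poles by [N0] halves them once more. *)
have hB r : q / 2 ^+ 7 <= r -> r < rho -> T0 R' f r <= B.
  move=> qr rr; have r0 : 0 < r by apply: lt_le_trans qr; rewrite divr_gt0// exprn_gt0.
  apply: le_trans (hT r r0 rr) _; apply: iter_exp_le; rewrite ler_expR mulNr -mulrN.
  rewrite ler_wpM2l ?(ltW t0)// lerNl -mulNr -ln_pow2 ler_ln ?posrE//.
have p6 : 2 ^+ 6 = 64 :> R by rewrite -natrX.
have p7 : 2 ^+ 7 = 128 :> R by rewrite -natrX.
have hT' r : q / 64 <= r -> r <= 8 * q ->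
    rmean (fun w => logp (nm (f w))) r <= B /\ cnt (zneg f) r R' <= 2 * B.
  move=> qr rq; have r0 : 0 < r by apply: lt_le_trans qr; rewrite divr_gt0.
  have h1 := hB r _ _; have h2 := hB (r / 2) _ _.
  have n1 := N0_ge0 mero f_nz r0 RR; have r20 : 0 < r / 2 by rewrite divr_gt0.
  have n2' := m0_ge0 f (r / 2).
  have h3 := cnt_le_N0 mero f_nz r20 (R' := R') _ RR.
  rewrite [2 * (r / 2)]mulrC divfK ?pnatr_eq0// in h3.
  rewrite /T0 p7 in h1 h2; rewrite -m0E; split; first by have := h1; lra.
  have {}h2 : m0 f (r / 2) + N0 R' f (r / 2) <= B by apply: h2; lra.
  have {}h3 : cnt (zneg f) r R' <= 2 * N0 R' f (r / 2) by apply: h3; lra.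
  lra.
have hL : 1 - ln (q / 64) <= (m + 8)%:R.
  rewrite -p6 ln_pow2 mulNr opprK.
  have : (m + 6)%:R * ln 2 <= (m + 6)%:R * 1 :> R by rewrite ler_wpM2l ?ln2_le1.
  rewrite !natrD; lra.
have [|||||s [s1 s2 s3]] := annulus_estimate f_loc f_nz q0 _ _ _ _ RR _ K0 hJ hT' hL W1 W2 W3 W4 W5;
  [lra..|].
have W0 : 0 < W by lra.
have Wq : W^-1 <= q / 4.
  by rewrite -[q / 4]invrK invf_div lef_pV2 ?posrE ?divr_gt0.
have V0 : 0 < W^-1 by rewrite invr_gt0.
(* With at most [5 * W ^+ 2] discs, the radii add up to at most [5 * W ^- 2], which is below [q * q]
   since [W^-1 <= q / 4]. *)
exists (s, W ^- 4) => _; split => //=.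
- by rewrite invr_gt0 exprn_gt0.
- rewrite -exprVn exprS mulrC.
  have h : W^-1 ^+ 3 <= 8^-1.
    rewrite exprVn lef_pV2 ?posrE ?exprn_gt0//; apply: le_trans W2 _.
    by rewrite exprS ler_peMr ?(ltW W0)// exprn_ege1//; lra.
  apply: (@le_trans _ _ (8^-1 * (q / 4))); last lra.
  by apply: ler_pM; rewrite ?exprn_ge0// ltW.
- apply: (@le_trans _ _ (5 * W ^+ 2 * W ^- 4)).
    by rewrite ler_wpM2r// invr_ge0 exprn_ge0// ltW.
  have -> : 5 * W ^+ 2 * W ^- 4 = 5 * (W^-1 * W^-1) by field; rewrite gt_eqF.
  have : W^-1 * W^-1 <= (q / 4) * (q / 4) by apply: ler_pM => //; exact: ltW.
  have := mulr_ge0 (ltW q0) (ltW q0); lra.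
move=> z hz hc; have [z1 z2 z3 z4] := s3 k z k0 hz hc.
eexists; first exact: meromorphic_value_hol z1 z2 z3.
have z0 : 0 < nm z by case/andP: hz; lra.
have fz : 0 < nm (f z) by rewrite nm_gt0.
rewrite -[leLHS]/(nm (iter k (@dc R) f z / f z)) -[cabs z]/(nm z).
rewrite normcM normcV ler_pdivrMr//; apply: le_trans z4 _.
rewrite mulrCA mulrA ler_wpM2r ?nm_ge0//; apply: le_trans hg _.
(* As [|z| <= 2 ^- m] and [sigma + eps] is positive, the power of [1 / |z|] is at least that of
   [2 ^+ m]. *)
apply: iter_exp_le; rewrite div1r /powR gt_eqF// -expRN ler_expR -mulrN.
rewrite ler_wpM2l//; first lra.
rewrite -lnV ?posrE// mulr_natl -lnXn// ler_ln ?posrE ?invr_gt0 ?exprn_gt0//.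
case/andP: hz => _ h; rewrite -[leLHS]invrK lef_pV2 ?posrE ?invr_gt0 ?exprn_gt0//.
Unshelve. all: end_near. 
Qed.
End dyadic_estimate.

(** * Exceptional sets *)

Section exceptional_sets.
Variable R : realType.
Local Notation C := R[i].
Local Notation nm := (@normc R).
Local Notation mu := (@lebesgue_measure R).

Lemma dyadic_level N (r : R) : 0 < r -> r < 2 ^- N ->
  exists2 m, (N <= m)%N & 2 ^- m / 2 <= r <= 2 ^- m.
Proof.
move=> r0 rN; have half m : 2 ^- m / 2 = 2 ^- m.+1 :> R by rewrite -invfM -exprSr.
have [n rn] : exists n, 2 ^- n <= r.
  exists (Num.bound r^-1); rewrite -[leRHS]invrK lef_pV2 ?posrE ?invr_gt0 ?exprn_gt0//.
  apply: ltW; apply: lt_trans (archi_boundP _) _; first by rewrite invr_ge0 ltW.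
  by rewrite -natrX ltr_nat ltn_expl.
elim: n rn => [|n ih] rn.
  have /= h := le_lt_trans rn rN; exfalso; move: h; apply/negP; rewrite -leNgt.
  by rewrite lef_pV2 ?posrE ?exprn_gt0// expr0 exprn_ege1// ler1n.
case: (leP (2 ^- n) r) => [//|nr]; exists n; last by rewrite half rn ltW.
rewrite leqNgt; apply/negP => nN; have h := lt_le_trans rN (_ : 2 ^- N <= 2 ^- n.+1).
have /negP[] : ~~ (r < r) by rewrite ltxx.
apply: lt_le_trans rn; apply: h.
by rewrite lef_pV2 ?posrE ?exprn_gt0// ler_eXn2l// ltr1n.
Qed.

Lemma series_pow2_lty (a : R) (u : nat -> \bar R) : 0 <= a -> (forall m, 0 <= u m)%E ->
  (forall m, u m <= (a * 2 ^- m)%:E)%E -> (\sum_(m <oo) u m < +oo)%E.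
Proof.
move=> a0 u0 h; apply: (@le_lt_trans _ _ (2 * a)%:E); last exact: ltry.
have a20 : 0 <= 2 * a by rewrite mulr_ge0.
apply: le_trans (epsilon_trick0 xpredT a20); apply: lee_nneseries => // m _.
apply: le_trans (h m) _; rewrite lee_fin natrX exprS invfM.
by rewrite mulrACA divff ?pnatr_eq0// mul1r.
Qed.

Lemma measure_bigsetU_le (I : Type) (s : seq I) (A : I -> set R) (e : R) :
  (forall c, measurable (A c)) -> (forall c, mu (A c) <= e%:E)%E ->
  (mu (\big[setU/set0]_(c <- s) A c) <= ((size s)%:R * e)%:E)%E.
Proof.
move=> mA hA; elim: s => [|c s ih]; first by rewrite big_nil measure0 mul0r.
rewrite big_cons.
have mB : measurable (\big[setU/set0]_(c <- s) A c) by exact: bigsetU_measurable.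
apply: le_trans (measureU2 mu (mA c) mB) _.
by rewrite /= -nat1r mulrDl mul1r EFinD; apply: leeD.
Qed.

Lemma measure_ball_itv (x d : R) : 0 <= d ->
  (mu (`](x - d)%R, (x + d)%R[%classic) <= (2 * d)%:E)%E.
Proof.
move=> d0; rewrite lebesgue_measure_itv /=; case: ifP => _; rewrite -?EFinB lee_fin; lra.
Qed.

Variables (s : nat -> seq C) (dl : nat -> R) (N : nat).
Hypothesis dl0 : forall m, 0 < dl m.
Hypothesis dl_le : forall m, dl m <= 2 ^- m / 32.
Hypothesis s_ann : forall m c, c \in s m -> 2 ^- m / 16 <= nm c <= 8 * 2 ^- m.
Hypothesis s_size : forall m, (size (s m))%:R * dl m <= 2 ^- m * 2 ^- m.
Variable G : C -> Prop.
Hypothesis hG : forall m z, (N <= m)%N -> 2 ^- m / 2 <= nm z <= 2 ^- m ->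
  (forall c, c \in s m -> dl m <= nm (z - c)) -> G z.

Lemma radial_exceptional_set (R' : R) : 0 < R' -> exists E : set R,
  [/\ measurable E, E `<=` `]0, R'[,
    (\int[mu]_(t in `]0%R, R'[) (\1_E t / t)%:E < +oo)%E &
    forall z : C, (`]0, R'[ `\` E) (nm z) -> G z].
Proof.
move=> R'0.
pose F m := \big[setU/set0]_(c <- s m) (`]nm c - dl m, nm c + dl m[%classic : set R).
have mF m : measurable (F m) by apply: bigsetU_measurable.
pose E := `]0, R'[ `&` (`[2 ^- N, +oo[ `|` \bigcup_m F m).
have mE : measurable E.
  by apply: measurableI => //; apply: measurableU => //; exact: bigcup_measurable.
exists E; split => //; first by move=> t [].
  (* On [F m] one has [t > |c| - dl m >= 2 ^- m / 16 - 2 ^- m / 32 = 2 ^- m / 32], hence the bound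
     [32 * 2 ^+ m] for [1 / t]. *)
  pose g m (t : R) : \bar R := (32 * 2 ^+ m * \1_(F m) t)%:E.
  have g0 m t : (0 <= g m t)%E by rewrite lee_fin mulr_ge0 ?mulr_ge0 ?exprn_ge0 ?indicE.
  have mg m : measurable_fun `]0, R'[ (g m).
    apply/measurable_EFinP; apply: measurable_funM; first exact: measurable_cst.
    exact: measurable_indic.
  have mS : measurable_fun `]0, R'[ (fun t => \sum_(m <oo) g m t)%E.
    exact: ge0_emeasurable_sum.
  apply: (@le_lt_trans _ _ (\int[mu]_(t in `]0%R, R'[) ((2 ^+ N)%:E + \sum_(m <oo) g m t))%E).
    apply: ge0_le_integral => //.
    - move=> t /=; rewrite in_itv /= => /andP[t0 _].
      by rewrite lee_fin divr_ge0// ?indicE// ltW.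
    - apply/measurable_EFinP; apply: measurable_funM; first exact: measurable_indic.
      apply: subspace_continuous_measurable_fun => //.
      apply: continuous_in_subspaceT => t; rewrite inE /= in_itv /= => /andP[t0 _].
      by apply: cvgV; [rewrite gt_eqF|exact: cvg_id].
    - by apply: emeasurable_funD => //; exact: measurable_cst.
    move=> t /=; rewrite in_itv /= => /andP[t0 tR].
    have S0 : (0 <= \sum_(m <oo) g m t)%E by apply: nneseries_ge0.
    have [|nE] := pselect (E t); last first.
      rewrite indicE memNset// mul0r; apply: adde_ge0 => //.
    move=> Et; rewrite indicE mem_set// mul1r; case: Et => _ [|[m _ Fm]].
      rewrite /= in_itv /= andbT => Nt; apply: (@le_trans _ _ (2 ^+ N)%:E); last by rewrite leeDl.
      by rewrite lee_fin -[leRHS]invrK lef_pV2 ?posrE ?invr_gt0 ?exprn_gt0.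
    apply: (@le_trans _ _ (g m t)).
      rewrite /g indicE mem_set// mulr1 lee_fin.
      move: Fm; rewrite /F -bigcup_seq => -[c /= cs]; rewrite in_itv /= => /andP[tc _].
      have /andP[c1 _] := s_ann cs; have := dl_le m => d1.
      have q0 : 0 < 2 ^- m :> R by rewrite invr_gt0 exprn_gt0.
      have -> : 32 * 2 ^+ m = (2 ^- m / 32)^-1 :> R by rewrite invf_div invrK.
      by rewrite lef_pV2 ?posrE ?divr_gt0//; lra.
    rewrite (nneseriesD1 (n := m))//; apply: le_trans (leeDr _ _); last by rewrite lee_fin exprn_ge0.
    by rewrite leeDl// nneseries_ge0.
  rewrite ge0_integralD//; last by move=> t _; apply: nneseries_ge0.
  apply: lte_add_pinfty.
    rewrite integral_cst//= lebesgue_measure_itv /=; case: ifP => _; last by rewrite mule0.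
    by rewrite -EFinB -EFinM ltry.
  rewrite integral_nneseries//; apply: (@series_pow2_lty 64) => // m.
    by apply: integral_ge0.
  rewrite /g; under eq_integral do rewrite EFinM.
  rewrite ge0_integralZl_EFin//; last first.
    apply/measurable_EFinP; by apply: measurable_indic; exact: mF.
  rewrite integral_indic//; last exact: mF.
  apply: (@le_trans _ _ ((32 * 2 ^+ m)%:E * mu (F m))%E).
    apply: lee_wpmul2l; first by rewrite lee_fin mulr_ge0// exprn_ge0.
    apply: le_measure; [rewrite inE|rewrite inE; exact: mF|exact: subIsetl].
    by apply: measurableI; [exact: mF|exact: measurable_itv].
  apply: (@le_trans _ _ ((32 * 2 ^+ m)%:E * ((size (s m))%:R * (2 * dl m))%:E)%E).
    apply: lee_wpmul2l; first by rewrite lee_fin mulr_ge0// exprn_ge0.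
    by apply: measure_bigsetU_le => // c; apply: measure_ball_itv; rewrite ltW.
  rewrite -EFinM lee_fin.
  have -> : 64 * 2 ^- m = 32 * 2 ^+ m * (2 * (2 ^- m * 2 ^- m)) :> R.
    by field; rewrite expf_neq0 ?pnatr_eq0.
  rewrite ler_wpM2l ?mulr_ge0 ?exprn_ge0// mulrCA ler_wpM2l//.
move=> z [/= zR nE]; have zR' := zR; move: zR; rewrite in_itv /= => /andP[z0 _].
have zN : nm z < 2 ^- N.
  rewrite ltNge; apply/negP => h; apply: nE; split => //; left.
  by rewrite /= in_itv /= h.
have [m Nm zm] := dyadic_level z0 zN.
apply: (hG Nm zm) => c cs; rewrite leNgt; apply/negP => h; apply: nE; split => //; right.
exists m => //; rewrite /F -bigcup_seq; exists c => //=.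
rewrite in_itv /=; have := nm_distB z c; rewrite ler_norml => /andP[h1 h2].
by apply/andP; split; lra.
Qed.
End exceptional_sets.

(** * Exceptional arguments *)

Section angular_exceptional_set.
Variable R : realType.
Local Notation C := R[i].
Local Notation nm := (@normc R).
Local Notation mu := (@lebesgue_measure R).

Lemma mul_cos_le_sin (u : R) : 0 <= u -> u <= pi / 2 -> u * cos u <= sin u.
Proof.
rewrite le_eqVlt => /predU1P[<- _|u0 up]; first by rewrite mul0r sin0.
have pi0 := pi_gt0 R.
have hc : {within `[0, u], continuous (@sin R)}.
  by apply: continuous_subspaceT => y; exact: continuous_sin.
have [x] := @MVT R sin cos 0 u u0 (fun x _ => is_derive_sin x) hc.
rewrite in_itv /= sin0 !subr0 => /andP[x0 xu] ->; rewrite mulrC ler_wpM2r ?(ltW u0)//.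
by rewrite ltW// ltr_cos// in_itv /=; apply/andP; split; lra.
Qed.

(** For [y >= 0], doubling the angle and [mul_cos_le_sin] give [sin y >= y * cos (y / 2) ^+ 2 = y *
    (1 + cos y) / 2 >= y / 2]. *)
Lemma norm_sin_ge (y : R) : `|y| <= pi / 2 -> `|y| / 2 <= `|sin y|.
Proof.
have pi0 := pi_gt0 R.
wlog y0 : y / 0 <= y.
  move=> W; case: (leP 0 y) => [|/ltW] y0; first exact: W.
  by rewrite -normrN -[`|sin y|]normrN -sinN => h; apply: W => //; rewrite oppr_ge0.
rewrite ger0_norm// => yp; apply: le_trans (ler_norm _).
have h := @mul_cos_le_sin (y / 2) _ _.
have c0 : 0 <= cos y by apply: cos_ge0_pihalf; apply/andP; split; lra.
have c1 : 0 <= cos (y / 2) by apply: cos_ge0_pihalf; apply/andP; split; lra.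
have E : y = (y / 2) *+ 2 by rewrite -mulr_natr divfK ?pnatr_eq0.
have c2 : cos (y / 2) ^+ 2 = (1 + cos y) / 2.
  by rewrite [in RHS]E cos_mulr2n; field.
have hs : sin y = 2 * (cos (y / 2) * sin (y / 2)) by rewrite {1}E sin_mulr2n mulr_natl.
have {}h : cos (y / 2) * (y / 2 * cos (y / 2)) <= cos (y / 2) * sin (y / 2).
  by rewrite ler_wpM2l//; apply: h; lra.
have E2 : cos (y / 2) * (y / 2 * cos (y / 2)) = y / 2 * cos (y / 2) ^+ 2 by ring.
rewrite E2 c2 in h; have h2 : 0 <= y * cos y by exact: mulr_ge0.
rewrite hs; nra.
Qed.

(** The zeros of the sine between [- (2 * pi)] and [2 * pi], the range of the difference of two
    arguments. *)
Definition half_turns : seq R := [:: - (2 * pi); - pi; 0; pi; 2 * pi].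

Lemma norm_sin_half_turn (x j : R) : j \in half_turns -> `|sin (x - j)| = `|sin x|.
Proof.
move=> hj; have [h1 h2] : sin j = 0 /\ `|cos j| = 1.
  have E : 2 * pi = pi *+ 2 :> R by rewrite mulr_natl.
  move: hj; rewrite !inE => /orP[|/orP[|/orP[|/orP[]]]] /eqP ->;
  rewrite ?sinN ?cosN ?E ?sin2pi ?cos2pi ?sinpi ?cospi ?sin0 ?cos0 ?oppr0 ?normrN ?normr1;
  by split.
by rewrite sinB h1 mulr0 subr0 normrM h2 mulr1.
Qed.

Lemma half_turn_near (x : R) : - (2 * pi) <= x <= 2 * pi ->
  exists2 j, j \in half_turns & `|x - j| <= pi / 2.
Proof.
move=> /andP[x1 x2]; have pi0 := pi_gt0 R.
have K j : j \in half_turns -> - (pi / 2) <= x - j -> x - j <= pi / 2 ->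
    exists2 j, j \in half_turns & `|x - j| <= pi / 2.
  by move=> hj h1 h2; exists j => //; rewrite ler_norml h1.
case: (leP x (- (3 * (pi / 2)))) => h1.
  by apply: (K (- (2 * pi))); [rewrite !inE eqxx|lra|lra].
case: (leP x (- (pi / 2))) => h2.
  by apply: (K (- pi)); [rewrite !inE eqxx ?orbT|lra|lra].
case: (leP x (pi / 2)) => h3; first by apply: (K 0); [rewrite !inE eqxx ?orbT|lra|lra].
case: (leP x (3 * (pi / 2))) => h4.
  by apply: (K pi); [rewrite !inE eqxx ?orbT|lra|lra].
by apply: (K (2 * pi)); [rewrite !inE eqxx ?orbT|lra|lra].
Qed.

(** The left-hand side is the distance from [pol rho al] to the line of direction [th] through the
    origin. The proof is Lagrange's identity: [(a ^+ 2 + b ^+ 2) * (c ^+ 2 + d ^+ 2) - (b * c - a *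
    d) ^+ 2 = (a * c + b * d) ^+ 2]. *)
Lemma sin_dist_pol (r rho th al : R) :
  rho * `|sin (th - al)| <= nm (pol r th - pol rho al).
Proof.
set w := pol r th - pol rho al.
have E (x t : R) : pol x t = (x * cos t) +i* (x * sin t).
  by rewrite /pol -polarE.
have wr : complex.Re w = r * cos th - rho * cos al by rewrite /w !E.
have wi : complex.Im w = r * sin th - rho * sin al by rewrite /w !E.
apply: le_trans (_ : `|rho * sin (th - al)| <= _).
  by rewrite normrM ler_wpM2r// ler_norm.
have -> : rho * sin (th - al) = complex.Im w * cos th - complex.Re w * sin th.
  by rewrite wr wi sinB; ring.
rewrite -(ler_pXn2r (n := 2)) ?nnegrE ?nm_ge0// nm_sqr real_normK ?num_real//.
have h := cos2Dsin2 th; have := sqr_ge0 (complex.Re w * cos th + complex.Im w * sin th).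
move: (complex.Re w) (complex.Im w) (cos th) (sin th) h => a b c d h h'.
have -> : a ^+ 2 + b ^+ 2 = (a ^+ 2 + b ^+ 2) * (c ^+ 2 + d ^+ 2) by rewrite h mulr1.
by rewrite -subr_ge0; apply: le_trans h' _; rewrite le_eqVlt; apply/orP; left; apply/eqP; ring.
Qed.

Variables (s : nat -> seq C) (dl : nat -> R) (N : nat).
Hypothesis dl0 : forall m, 0 < dl m.
Hypothesis s_ann : forall m c, c \in s m -> 2 ^- m / 16 <= nm c <= 8 * 2 ^- m.
Hypothesis s_size : forall m, (size (s m))%:R * dl m <= 2 ^- m * 2 ^- m.
Variable G : C -> Prop.
Hypothesis hG : forall m z, (N <= m)%N -> 2 ^- m / 2 <= nm z <= 2 ^- m ->
  (forall c, c \in s m -> dl m <= nm (z - c)) -> G z.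

(** A ray that meets the disc of radius [dl m] around [c] makes with the direction of [c] an angle
    whose sine is small, so [th] is close to [arg c] up to a half turn. These intervals have
    summable measure, and [E] is their upper limit. *)
Lemma angular_exceptional_set : exists E : set R,
  [/\ measurable E, E `<=` `[0, 2 * pi[, mu E = 0%E &
    forall th : R, (`[0, 2 * pi[ `\` E) th -> exists2 r0 : R, 0 < r0 &
      forall z : C, z != 0 -> z = pol (nm z) th -> nm z < r0 -> G z].
Proof.
have pi0 := pi_gt0 R.
have /choice[arg harg] : forall c : C, exists t : R, 0 <= t <= 2 * pi /\ c = pol (nm c) t.
  by move=> c; have [t h1 h2] := polar_form c; exists t.
(* This is [dl m] divided by the lower bound [2 ^- m / 16] of [|c|]: it bounds the sine, and
   [2 * kap m] bounds the angle by [norm_sin_ge]. *)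
pose kap m := 16 * 2 ^+ m * dl m.
have kap0 m : 0 < kap m by rewrite !mulr_gt0 ?exprn_gt0.
pose J m : set R := \big[setU/set0]_(p <- [seq (c, j) | c <- s m, j <- half_turns])
  `](arg p.1 + p.2) - 2 * kap m, (arg p.1 + p.2) + 2 * kap m[%classic.
have mJ m : measurable (J m) by apply: bigsetU_measurable.
have muJ : mu (lim_sup_set J) = 0%E.
  apply: lim_sup_set_cvg0 => //; apply: (@series_pow2_lty _ (20 * 16)) => // m.
  apply: (@le_trans _ _ ((size [seq (c, j) | c <- s m, j <- half_turns])%:R *
      (2 * (2 * kap m)))%:E).
    apply: measure_bigsetU_le => // p; apply: measure_ball_itv.
    by rewrite mulr_ge0// ltW.
  rewrite lee_fin size_allpairs /= natrM /kap.
  (* The constant 20 is the product of 5 half turns and the length [4 * kap m] of an interval; 16 is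
     that of [kap]. *)
  have -> : 20 * 16 * 2 ^- m = 20 * 16 * 2 ^+ m * (2 ^- m * 2 ^- m) :> R.
    by field; rewrite expf_neq0 ?pnatr_eq0.
  have -> : (size (s m))%:R * 5 * (2 * (2 * (16 * 2 ^+ m * dl m))) =
    20 * 16 * 2 ^+ m * ((size (s m))%:R * dl m) by move: (_%:R) => x; ring.
  by rewrite ler_wpM2l ?mulr_ge0 ?exprn_ge0.
have mL : measurable (lim_sup_set J).
  by apply: bigcapT_measurable => n; apply: bigcup_measurable.
exists (lim_sup_set J `&` `[0, 2 * pi[); split.
- exact: measurableI.
- by move=> t [].
- by apply: subset_measure0 muJ; [exact: measurableI|exact: mL|exact: subIsetl].
move=> th [/= th1 nL].
have [n hn] : exists n, forall m, (n <= m)%N -> ~ J m th.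
  apply: contrapT => h; apply: nL; split => // n _; apply: contrapT => h'.
  by apply: h; exists n => m nm Jm; apply: h'; exists m.
(* Below this radius only levels [m] beyond both [n] and [N] occur: there [th] avoids [J m], and the
   estimate holds off the discs. *)
exists (2 ^- (maxn n N)) => [|z z0 zE zr]; first by rewrite invr_gt0 exprn_gt0.
have z1 : 0 < nm z by rewrite nm_gt0.
have [m mn zm] := dyadic_level z1 zr; rewrite geq_max in mn.
case/andP: mn => nm_ Nm; apply: (hG Nm zm) => c cs; rewrite leNgt; apply/negP => h.
apply: (hn m nm_); have [/andP[a0 a2] cE] := harg c.
have /andP[c1 _] := s_ann cs; have q0 : 0 < 2 ^- m :> R by rewrite invr_gt0 exprn_gt0.
have [j js jx] : exists2 j, j \in half_turns & `|th - arg c - j| <= pi / 2.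
  apply: half_turn_near; move: th1; rewrite in_itv /= => /andP[t0 t2].
  by apply/andP; split; lra.
have h1 := norm_sin_ge jx; rewrite norm_sin_half_turn// in h1.
have h2 := sin_dist_pol (nm z) (nm c) th (arg c); rewrite -zE -cE in h2.
have h3 : 2 ^- m / 16 * `|sin (th - arg c)| <= nm c * `|sin (th - arg c)|.
  by rewrite ler_wpM2r.
have h4 : 2 ^- m / 16 * `|sin (th - arg c)| < dl m by lra.
have h5 : `|sin (th - arg c)| < kap m.
  have := h4; rewrite mulrC -ltr_pdivlMr ?divr_gt0// invf_div mulrC => h4'.
  by rewrite /kap; move: h4'; rewrite invrK.
rewrite /J -bigcup_seq; exists (c, j); first by apply/allpairsP; exists (c, j).
rewrite /= in_itv /=; have : `|th - arg c - j| < 2 * kap m by lra.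
by rewrite ltr_norml => /andP[k1 k2]; apply/andP; split; lra.
Qed.
End angular_exceptional_set.

Theorem corollary2 (R : realType) (R0 R' : R) (n k : nat)
    (f : R[i]^o -> R[i]^o) (sigma eps : R)
    (R'_gt0 : 0 < R') (R'_lt : R' < R0)
    (n_ge2 : (2 <= n)%N) (k_gt0 : (0 < k)%N) (eps_gt0 : 0 < eps)
    (f_mero : meromorphic_on (punctured_disc R0) f)
    (f_nonconst : ~ exists c : R[i]^o, forall z, punctured_disc R0 z -> f z = c)
    (f_sing : singular_at f 0)
    (f_order : iterated_order R' n f = sigma%:E) :
  (exists E1 : set R,
    [/\ measurable E1,
        E1 `<=` `]0, R'[,
        (\int[lebesgue_measure]_(t in `]0%R, R'[) (\1_E1 t / t)%:E < +oo)%E &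
        forall z : R[i]^o, (`]0, R'[ `\` E1) (cabs z) ->
          exists2 v : R[i]^o,
            meromorphic_value (fun w => derive1n k f w / f w) z v &
            cabs v <= iter_exp n.-1 (1 / (cabs z `^ (sigma + eps)))])
  /\
  (exists E2 : set R,
    [/\ measurable E2,
        E2 `<=` `[0, 2 * pi[,
        lebesgue_measure E2 = 0%E &
        forall theta : R, (`[0, 2 * pi[ `\` E2) theta ->
          exists2 r0 : R, 0 < r0 &
            forall z : R[i]^o, z != 0 -> z = polar (cabs z) theta ->
              cabs z < r0 ->
              exists2 v : R[i]^o,
                meromorphic_value (fun w => derive1n k f w / f w) z v &
                cabs v <= iter_exp n.-1 (1 / (cabs z `^ (sigma + eps)))]).
Proof.
have [N [s [dl h]]] := dyadic_estimate R'_gt0 R'_lt n_ge2 k_gt0 eps_gt0 f_mero f_nonconst f_order.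
(* The levels below [N] receive no disc and a default radius, so that the hypotheses on the families
   hold for every [m]. *)
pose s' m := if (N <= m)%N then s m else [::].
pose dl' m : R := if (N <= m)%N then dl m else 2 ^- m / 32.
have q0 m : 0 < 2 ^- m :> R by rewrite invr_gt0 exprn_gt0.
have h0 m : 0 < dl' m.
  by rewrite /dl'; case: ifP => [/h[]//|_]; rewrite divr_gt0.
have h1 m : dl' m <= 2 ^- m / 32 by rewrite /dl'; case: ifP => [/h[]//|_].
have h2 m c : c \in s' m -> 2 ^- m / 16 <= normc c <= 8 * 2 ^- m.
  by rewrite /s'; case: ifP => [/h[_ _ h2 _ _]|_]; [exact: h2|rewrite in_nil => F; discriminate F].
have h3 m : (size (s' m))%:R * dl' m <= 2 ^- m * 2 ^- m.
  rewrite /s' /dl'; case: ifP => [/h[]//|_]; rewrite mul0r; apply: mulr_ge0; exact: ltW.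
pose G (z : R[i]) := exists2 v : R[i]^o,
  meromorphic_value (fun w => derive1n k f w / f w) z v &
  cabs v <= iter_exp n.-1 (1 / (cabs (z : R[i]^o) `^ (sigma + eps))).
have hG m z : (N <= m)%N -> 2 ^- m / 2 <= normc z <= 2 ^- m ->
    (forall c, c \in s' m -> dl' m <= normc (z - c)) -> G z.
  move=> Nm hz; rewrite /s' /dl' Nm => hc; have [_ _ _ _ H] := h m Nm.
  exact: H.
split.
  have [E [E1 E2 E3 E4]] := radial_exceptional_set h0 h1 h2 h3 hG R'_gt0.
  by exists E; split => // z; exact: E4.
have [E [E1 E2 E3 E4]] := angular_exceptional_set h0 h2 h3 hG.
exists E; split => // th hth; have [r0 r00 hr] := E4 th hth.
by exists r0 => // z z0 zE zr; apply: hr => //; rewrite /pol -polarE.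
Qed.
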